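(* For $\mathbf{G}=\mathbf{G}(a,b)$, the function $\mathbb{R}^2\ni(X,T)\mapsto\Psi(X,T;\mathbf{G})\in\mathbb{C}$ is a global solution (i.e., for all $(X,T)\in\mathbb{R}^2$) of the focusing nonlinear Schr\''odinger equation in the form $$\mathrm{i}\Psi_T+\frac12\Psi_{XX}+|\Psi|^2\Psi=0.$$
   Context: Notation: $*$ is complex conjugation; $\sigma_3=\mathrm{diag}(1,-1)$; $\mathrm{e}^{f\sigma_3}=\mathrm{diag}(\mathrm{e}^{f},\mathrm{e}^{-f})$. For $(a,b)\in\mathbb{C}^2\setminus\{(0,0)\}$ let $$\mathbf{G}(a,b)=\frac{1}{\sqrt{|a|^2+|b|^2}}\begin{bmatrix}a & b^*\\ -b & a^*\end{bmatrix}.$$ For $(X,T)\in\mathbb{R}^2$ and $\mathbf{G}=\mathbf{G}(a,b)$, $\mathbf{P}(\Lambda;X,T,\mathbf{G})$ denotes the unique (it is known to exist and to depend real-analytically on $(X,T)$) $2\times 2$ matrix function of $\Lambda$ such that: (i) it is analytic for $|\Lambda|\neq 1$ and takes continuous boundary values on the unit circle from the interior and from the exterior; (ii) writing $\mathbf{P}_+$ (resp. $\mathbf{P}_-$) for the boundary value on $|\Lambda|=1$ from the exterior (resp. interior), $$\mathbf{P}_+=\mathbf{P}_-\,\mathrm{e}^{-\mathrm{i}(\Lambda X+\Lambda^2T+2\Lambda^{-1})\sigma_3}\,\mathbf{G}\,\mathrm{e}^{\mathrm{i}(\Lambda X+\Lambda^2T+2\Lambda^{-1})\sigma_3},\quad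 |\Lambda|=1;$$ (iii) $\mathbf{P}\to\mathbb{I}$ as $\Lambda\to\infty$. Then $\Psi(X,T;\mathbf{G}):=2\mathrm{i}\lim_{\Lambda\to\infty}\Lambda P_{12}(\Lambda;X,T,\mathbf{G})$. *)

(* Defs.v *)
From Stdlib Require Import Reals.
From Coquelicot Require Import Coquelicot.

Open Scope C_scope.

Definition mat2 : Type := @matrix C 2 2.

(* Rows and columns are numbered from 0, so the entry M_12 is [entry M 0 1]. *)
Definition entry (M : mat2) (i j : nat) : C := coeff_mat (RtoC 0) M i j.

Definition mul2 (M N : mat2) : mat2 := @Mmult C_Ring 2 2 2 M N.

Definition id2 : mat2 := @Mone C_Ring 2.

Definition Cexp (z : C) : C :=
  ((exp (Re z) * cos (Im z))%R, (exp (Re z) * sin (Im z))%R).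

Definition exp_sigma3 (f : C) : mat2 :=
  [[ Cexp f, RtoC 0 ], [ RtoC 0, Cexp (- f) ]].

Definition G (a b : C) : mat2 :=
  let r := RtoC (sqrt (Cmod a ^ 2 + Cmod b ^ 2)) in
  [[ a / r, Cconj b / r ], [ - b / r, Cconj a / r ]].

Definition phase (X T : R) (z : C) : C :=
  z * RtoC X + z * z * RtoC T + RtoC 2 / z.

Definition jump (G0 : mat2) (X T : R) (z : C) : mat2 :=
  mul2 (exp_sigma3 (- (Ci * phase X T z)))
       (mul2 G0 (exp_sigma3 (Ci * phase X T z))).

(* The filter of neighbourhoods of the point at infinity of the Riemann
   sphere. *)
Definition C_infinity (S : C -> Prop) : Prop :=
  exists r : R, forall z : C, r < Cmod z -> S z.

Definition mat_filterlim (f : C -> mat2) (F : (C -> Prop) -> Prop) (L : mat2)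
  : Prop :=
  forall i j : nat, (i < 2)%nat -> (j < 2)%nat ->
    filterlim (fun z => entry (f z) i j) F (locally (entry L i j)).

(* Analyticity on an open set is complex differentiability at each point. *)
Definition mat_holomorphic_at (f : C -> mat2) (z : C) : Prop :=
  forall i j : nat, (i < 2)%nat -> (j < 2)%nat ->
    ex_derive (K := C_AbsRing) (V := C_NormedModule)
      (fun w => entry (f w) i j) z.

Definition continuous_boundary_values (f : C -> mat2) (D : C -> Prop)
  (g : C -> mat2) : Prop :=
  forall z : C, Cmod z = 1 ->
    mat_filterlim f (within D (locally z)) (g z) /\
    mat_filterlim g (within (fun w => Cmod w = 1) (locally z)) (g z).

(* The values of P on the circle itself are irrelevant: there, only the
   boundary values Pp (from the exterior) and Pm (from the interior) matter. *)
Record is_RHP_solution (G0 : mat2) (X T : R) (P : C -> mat2) : Prop := {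
  rhp_analytic : forall z : C, Cmod z <> 1 -> mat_holomorphic_at P z;
  rhp_jump : exists Pp Pm : C -> mat2,
    continuous_boundary_values P (fun w => 1 < Cmod w) Pp /\
    continuous_boundary_values P (fun w => Cmod w < 1) Pm /\
    (forall z : C, Cmod z = 1 -> Pp z = mul2 (Pm z) (jump G0 X T z));
  rhp_normalization : mat_filterlim P C_infinity id2
}.

(* [lim] is total, as in Coquelicot: it is the limit whenever there is one. *)
Definition limit_at_infinity (f : C -> C) : C :=
  @lim C_R_CompleteNormedModule (filtermap f C_infinity).

Definition Psi_of (P : C -> mat2) : C :=
  RtoC 2 * Ci * limit_at_infinity (fun z => z * entry (P z) 0 1).

Definition continuous_on_plane (f : R -> R -> C) : Prop :=
  forall p : R * R, continuous (fun q : R * R => f (fst q) (snd q)) p.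

(* Global classical solution: the derivatives in the equation exist at every
   point of the plane, are jointly continuous, and satisfy the equation. *)
Definition global_NLS_solution (Psi : R -> R -> C) : Prop :=
  exists Psi_X Psi_XX Psi_T : R -> R -> C,
    (forall X T : R,
       is_derive (V := C_R_NormedModule) (fun x => Psi x T) X (Psi_X X T) /\
       is_derive (V := C_R_NormedModule) (fun x => Psi_X x T) X (Psi_XX X T) /\
       is_derive (V := C_R_NormedModule) (fun t => Psi X t) T (Psi_T X T)) /\
    continuous_on_plane Psi /\ continuous_on_plane Psi_X /\
    continuous_on_plane Psi_XX /\ continuous_on_plane Psi_T /\
    (forall X T : R,
       Ci * Psi_T X T + RtoC (1 / 2) * Psi_XX X T
         + RtoC (Cmod (Psi X T) ^ 2) * Psi X T = 0).

(* Main.v *)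
(** The jump problem says that [P_+ = P_- v] with [P_+] analytic outside and
    [P_-] inside the unit circle.  Put [S = P_+ sigma3 P_+^-1], analytic
    outside, and let [Q_n] be the coefficient of [Lambda^-n] in it.  Comparing
    the solutions at two points, [E = P_+(X,T) P_+(X0,T0)^-1] has a jump close
    to the identity on the circle; orthogonality in [L^2] of the interior and
    exterior Hardy spaces turns this into [E = 1 + O(h)] in mean square, and
    then determines the coefficients of [E] up to [O(h^2)].  Since
    [S(X,T) = E S(X0,T0) E^-1], this shows that the [Q_n] are differentiable, with
    [d_X Q_1 = i [Q_2, sigma3]], [d_T Q_1 = i [Q_3, sigma3]] and
    [d_X Q_2 = i [Q_3, sigma3] + i [Q_2, Q_1]], without any appeal to
    smoothness of [P] in the parameters.  As [S^2 = 1] fixes the diagonals,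
    [Psi = -i (Q_1)_12] solves the equation as soon as
    [(Q_1)_21] is the conjugate of [(Q_1)_12]; this follows from
    uniqueness and the symmetry of the jump under [Lambda -> conj Lambda].

    Analyticity enters only through the constancy of circle means, which rests
    on Goursat's lemma in the coordinates [Lambda = exp (x + i t)]. *)

Require Import Defs.
From Stdlib Require Import Reals.
From Coquelicot Require Import Coquelicot.
From Stdlib Require Import Lra Lia Classical ClassicalEpsilon.

Open Scope R_scope.

(** * Continuity and complex differentiability *)

Definition cont_within (D : C -> Prop) (f : C -> C) (z : C) : Prop :=
  forall eps, 0 < eps -> exists d, 0 < d /\
    forall w, D w -> Cmod (w - z) < d -> Cmod (f w - f z) < eps.

Definition cont_at (f : C -> C) (z : C) : Prop := cont_within (fun _ => True) f z.

(* Caratheodory's form of complex differentiability: the difference quotient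
   extends continuously.  It turns the rules of calculus into algebra. *)
Definition cdiff (f : C -> C) (z : C) : Prop :=
  exists q, cont_at q z /\ forall w, f w = (f z + q w * (w - z))%C.

Lemma Cmod_minus_sym (x y : C) : Cmod (x - y) = Cmod (y - x).
Proof.
  replace (x - y)%C with (- (y - x))%C by ring. apply Cmod_opp.
Qed.

Lemma Cmod_ge_minus (x y : C) : Cmod x - Cmod y <= Cmod (x - y).
Proof.
  pose proof (Cmod_triangle (x - y) y) as H.
  replace (x - y + y)%C with x in H by ring. lra.
Qed.

Lemma im_le_Cmod (c : C) : Rabs (Im c) <= Cmod c.
Proof.
  pose proof (Rmax_Cmod c) as H. pose proof (Rmax_r (Rabs (fst c)) (Rabs (snd c))).
  unfold Im. lra.
Qed.

Lemma Cmod_le_sum (c : C) : Cmod c <= Rabs (Re c) + Rabs (Im c).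
Proof.
  assert (H : c = (RtoC (Re c) + Ci * RtoC (Im c))%C)
    by (destruct c; apply injective_projections; simpl; ring).
  rewrite H at 1.
  eapply Rle_trans; [apply Cmod_triangle|].
  rewrite Cmod_mult, !Cmod_R, Cmod_Ci. lra.
Qed.

Lemma cont_within_mono (D E : C -> Prop) (f : C -> C) (z : C) :
  (forall w, E w -> D w) -> cont_within D f z -> cont_within E f z.
Proof.
  intros H Hf eps He. destruct (Hf eps He) as [d [Hd K]].
  exists d; split; auto.
Qed.

Lemma cont_at_within (D : C -> Prop) (f : C -> C) (z : C) :
  cont_at f z -> cont_within D f z.
Proof. apply cont_within_mono; auto. Qed.

Lemma cont_within_ext (D : C -> Prop) (f g : C -> C) (z : C) :
  (forall w, D w -> f w = g w) -> D z -> cont_within D f z -> cont_within D g z.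
Proof.
  intros H Dz Hf eps He. destruct (Hf eps He) as [d [Hd K]].
  exists d; split; auto. intros w Dw Hw. rewrite <- !H by auto. auto.
Qed.

Lemma cont_within_const (D : C -> Prop) (k z : C) : cont_within D (fun _ => k) z.
Proof.
  intros eps He. exists 1; split; [lra|]. intros w _ _.
  replace (k - k)%C with (RtoC 0) by ring. rewrite Cmod_0; lra.
Qed.

Lemma cont_within_id (D : C -> Prop) (z : C) : cont_within D (fun w => w) z.
Proof. intros eps He. exists eps; split; auto. Qed.

Lemma cont_within_plus (D : C -> Prop) (f g : C -> C) (z : C) :
  cont_within D f z -> cont_within D g z -> cont_within D (fun w => f w + g w)%C z.
Proof.
  intros Hf Hg eps He.
  destruct (Hf (eps / 2)) as [d1 [Hd1 K1]]; [lra|].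
  destruct (Hg (eps / 2)) as [d2 [Hd2 K2]]; [lra|].
  exists (Rmin d1 d2); split; [now apply Rmin_pos|].
  intros w Dw Hw.
  specialize (K1 w Dw (Rlt_le_trans _ _ _ Hw (Rmin_l _ _))).
  specialize (K2 w Dw (Rlt_le_trans _ _ _ Hw (Rmin_r _ _))).
  replace (f w + g w - (f z + g z))%C with ((f w - f z) + (g w - g z))%C by ring.
  eapply Rle_lt_trans; [apply Cmod_triangle|]. lra.
Qed.

Lemma cont_within_mult (D : C -> Prop) (f g : C -> C) (z : C) :
  cont_within D f z -> cont_within D g z -> cont_within D (fun w => f w * g w)%C z.
Proof.
  intros Hf Hg eps He.
  pose proof (Cmod_ge_0 (f z)) as Pf. pose proof (Cmod_ge_0 (g z)) as Pg.
  set (e := Rmin 1 (eps / (Cmod (f z) + Cmod (g z) + 2))).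
  assert (He1 : 0 < e).
  { apply Rmin_pos; [lra|]. apply Rdiv_lt_0_compat; lra. }
  assert (He2 : e * (Cmod (f z) + Cmod (g z) + 2) <= eps).
  { apply Rle_trans with (eps / (Cmod (f z) + Cmod (g z) + 2)
      * (Cmod (f z) + Cmod (g z) + 2)).
    - apply Rmult_le_compat_r; [lra|apply Rmin_r].
    - right; field; lra. }
  assert (He3 : e <= 1) by apply Rmin_l.
  destruct (Hf e He1) as [d1 [Hd1 K1]]. destruct (Hg e He1) as [d2 [Hd2 K2]].
  exists (Rmin d1 d2); split; [now apply Rmin_pos|].
  intros w Dw Hw.
  specialize (K1 w Dw (Rlt_le_trans _ _ _ Hw (Rmin_l _ _))).
  specialize (K2 w Dw (Rlt_le_trans _ _ _ Hw (Rmin_r _ _))).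
  replace (f w * g w - f z * g z)%C with
    ((f w - f z) * (g w - g z) + ((f w - f z) * g z + f z * (g w - g z)))%C by ring.
  eapply Rle_lt_trans; [apply Cmod_triangle|].
  eapply Rle_lt_trans; [apply Rplus_le_compat_l, Cmod_triangle|].
  rewrite !Cmod_mult.
  pose proof (Cmod_ge_0 (f w - f z)). pose proof (Cmod_ge_0 (g w - g z)).
  nra.
Qed.

Lemma cont_within_opp (D : C -> Prop) (f : C -> C) (z : C) :
  cont_within D f z -> cont_within D (fun w => - f w)%C z.
Proof.
  intros Hf eps He. destruct (Hf eps He) as [d [Hd K]].
  exists d; split; auto. intros w Dw Hw.
  replace (- f w - - f z)%C with (- (f w - f z))%C by ring. rewrite Cmod_opp; auto.
Qed.

Lemma cont_within_minus (D : C -> Prop) (f g : C -> C) (z : C) :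
  cont_within D f z -> cont_within D g z -> cont_within D (fun w => f w - g w)%C z.
Proof. intros. now apply cont_within_plus, cont_within_opp. Qed.

Lemma Cconj_minus (x y : C) : Cconj (x - y) = (Cconj x - Cconj y)%C.
Proof. apply injective_projections; simpl; ring. Qed.

Lemma cont_within_conj (D : C -> Prop) (f : C -> C) (z : C) :
  cont_within D f z -> cont_within D (fun w => Cconj (f w)) z.
Proof.
  intros Hf eps He. destruct (Hf eps He) as [d [Hd K]].
  exists d; split; auto. intros w Dw Hw.
  rewrite <- Cconj_minus, Cmod_conj; auto.
Qed.

Lemma cont_within_comp (D E : C -> Prop) (f g : C -> C) (z : C) :
  (forall w, D w -> E (g w)) ->
  cont_within E f (g z) -> cont_within D g z -> cont_within D (fun w => f (g w)) z.
Proof.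
  intros H Hf Hg eps He. destruct (Hf eps He) as [e [He' K]].
  destruct (Hg e He') as [d [Hd L]]. exists d; split; auto.
Qed.

Lemma cont_at_inv (z : C) : z <> RtoC 0 -> cont_at (fun w => / w)%C z.
Proof.
  intros Hz eps He. pose proof (proj1 (Cmod_gt_0 z) Hz) as Pz.
  exists (Rmin (Cmod z / 2) (eps * (Cmod z * Cmod z / 2))).
  split.
  { apply Rmin_pos; [lra|]. apply Rmult_lt_0_compat; nra. }
  intros w _ Hw.
  assert (H1 : Cmod (w - z) < Cmod z / 2) by (eapply Rlt_le_trans; [apply Hw|apply Rmin_l]).
  assert (H2 : Cmod (w - z) < eps * (Cmod z * Cmod z / 2))
    by (eapply Rlt_le_trans; [apply Hw|apply Rmin_r]).
  assert (H3 : Cmod z / 2 < Cmod w).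
  { pose proof (Cmod_ge_minus z w). rewrite Cmod_minus_sym in H. lra. }
  assert (Hw0 : w <> RtoC 0) by (apply Cmod_gt_0; lra).
  replace (/ w - / z)%C with ((z - w) * (/ w * / z))%C by (field; auto).
  rewrite !Cmod_mult, !Cmod_inv, Cmod_minus_sym by auto.
  apply Rlt_le_trans with (eps * (Cmod z * Cmod z / 2) * (/ Cmod w * / Cmod z)).
  - apply Rmult_lt_compat_r; auto.
    apply Rmult_lt_0_compat; apply Rinv_0_lt_compat; lra.
  - replace (eps * (Cmod z * Cmod z / 2) * (/ Cmod w * / Cmod z))
      with (eps * (Cmod z / 2 / Cmod w)) by (field; lra).
    rewrite <- (Rmult_1_r eps) at 2. apply Rmult_le_compat_l; [lra|].
    apply Rmult_le_reg_r with (Cmod w); [lra|]. unfold Rdiv.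
    rewrite Rmult_assoc, Rinv_l; lra.
Qed.

Lemma cdiff_cont (f : C -> C) (z : C) : cdiff f z -> cont_at f z.
Proof.
  intros [q [Hq H]].
  assert (K : cont_at (fun w => f z + q w * (w - z))%C z).
  { apply cont_within_plus; [apply cont_within_const|].
    apply cont_within_mult; auto.
    apply cont_within_minus; [apply cont_within_id|apply cont_within_const]. }
  intros eps He. destruct (K eps He) as [d [Hd L]]. exists d; split; auto.
  intros w _ Hw. specialize (L w I Hw). simpl in L.
  rewrite <- H in L. replace (f z + q z * (z - z))%C with (f z) in L by ring. auto.
Qed.

Lemma cdiff_const (k z : C) : cdiff (fun _ => k) z.
Proof.
  exists (fun _ => RtoC 0); split; [apply cont_within_const|]. intros; ring.
Qed.

Lemma cdiff_id (z : C) : cdiff (fun w => w) z.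
Proof.
  exists (fun _ => RtoC 1); split; [apply cont_within_const|]. intros; ring.
Qed.

Lemma cdiff_plus (f g : C -> C) (z : C) :
  cdiff f z -> cdiff g z -> cdiff (fun w => f w + g w)%C z.
Proof.
  intros [q [Hq H]] [r [Hr K]]. exists (fun w => q w + r w)%C; split.
  - now apply cont_within_plus.
  - intros w. rewrite (H w), (K w). ring.
Qed.

Lemma cdiff_mult (f g : C -> C) (z : C) :
  cdiff f z -> cdiff g z -> cdiff (fun w => f w * g w)%C z.
Proof.
  intros Hf Hg. pose proof (cdiff_cont g z Hg) as Cg.
  destruct Hf as [q [Hq H]], Hg as [r [Hr K]].
  exists (fun w => q w * g w + f z * r w)%C; split.
  - apply cont_within_plus; apply cont_within_mult; auto. apply cont_within_const.
  - intros w. rewrite (H w), (K w). ring.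
Qed.

Lemma cdiff_opp (f : C -> C) (z : C) : cdiff f z -> cdiff (fun w => - f w)%C z.
Proof.
  intros [q [Hq H]]. exists (fun w => - q w)%C; split.
  - now apply cont_within_opp.
  - intros w. rewrite (H w). ring.
Qed.

Lemma cdiff_minus (f g : C -> C) (z : C) :
  cdiff f z -> cdiff g z -> cdiff (fun w => f w - g w)%C z.
Proof. intros. now apply cdiff_plus, cdiff_opp. Qed.

Lemma cdiff_comp (f g : C -> C) (z : C) :
  cdiff f (g z) -> cdiff g z -> cdiff (fun w => f (g w)) z.
Proof.
  intros [q [Hq H]] Hg. pose proof (cdiff_cont g z Hg) as Cg.
  destruct Hg as [r [Hr K]].
  exists (fun w => q (g w) * r w)%C; split.
  - apply cont_within_mult; auto.
    now apply cont_within_comp with (E := fun _ => True).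
  - intros w. rewrite (H (g w)). rewrite (K w) at 2. ring.
Qed.

Lemma cdiff_conj_conj (f : C -> C) (z : C) :
  cdiff f (Cconj z) -> cdiff (fun w => Cconj (f (Cconj w))) z.
Proof.
  intros [q [Hq H]]. exists (fun w => Cconj (q (Cconj w))); split.
  - apply cont_within_conj.
    apply cont_within_comp with (E := fun _ => True); auto.
    apply cont_within_conj, cont_within_id.
  - intros w. rewrite H, Cplus_conj, Cmult_conj, Cconj_minus, !Cconj_conj. reflexivity.
Qed.

Lemma cdiff_local (f g : C -> C) (z : C) (d : R) :
  0 < d -> (forall w, Cmod (w - z) < d -> f w = g w) -> cdiff f z -> cdiff g z.
Proof.
  intros Hd Hfg [q [Hq H]].
  assert (Z : f z = g z).
  { apply Hfg. replace (z - z)%C with (RtoC 0) by ring. now rewrite Cmod_0. }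
  exists (fun w => if Ceq_dec w z then q z else ((g w - g z) / (w - z))%C); split.
  - intros eps He. destruct (Hq eps He) as [e [He' K]].
    exists (Rmin d e); split; [now apply Rmin_pos|].
    intros w _ Hw. destruct (Ceq_dec z z); [|easy].
    destruct (Ceq_dec w z) as [->|N].
    + apply K; auto. eapply Rlt_le_trans; [apply Hw|apply Rmin_r].
    + replace ((g w - g z) / (w - z))%C with (q w).
      * apply K; auto. eapply Rlt_le_trans; [apply Hw|apply Rmin_r].
      * rewrite <- Z, <- (Hfg w), (H w); [field|].
        -- intro E. apply N. replace w with (w - z + z)%C by ring. rewrite E. ring.
        -- eapply Rlt_le_trans; [apply Hw|apply Rmin_l].
  - intros w. destruct (Ceq_dec w z) as [->|N]; [ring|]. field.
    intro E. apply N. replace w with (w - z + z)%C by ring. rewrite E. ring.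
Qed.

Lemma cdiff_inv (z : C) : z <> RtoC 0 -> cdiff (fun w => / w)%C z.
Proof.
  intros Hz. pose proof (proj1 (Cmod_gt_0 z) Hz) as Pz.
  apply cdiff_local with
    (f := fun w => if Ceq_dec w 0 then (/ z + - / z * / z * (w - z))%C else (/ w)%C)
    (d := Cmod z); auto.
  - intros w Hw. destruct (Ceq_dec w 0) as [->|]; auto.
    exfalso. replace (0 - z)%C with (- z)%C in Hw by ring. rewrite Cmod_opp in Hw. lra.
  - exists (fun w => if Ceq_dec w 0 then (- / z * / z)%C else (- / z * / w)%C); split.
    + intros eps He.
      assert (K : cont_at (fun w => - / z * / w)%C z).
      { apply cont_within_mult; [apply cont_within_const|now apply cont_at_inv]. }
      destruct (K eps He) as [e [He' L]]. exists (Rmin e (Cmod z)).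
      split; [now apply Rmin_pos|]. intros w _ Hw.
      destruct (Ceq_dec z 0); [easy|]. destruct (Ceq_dec w 0).
      * replace (- / z * / z - - / z * / z)%C with (RtoC 0) by ring. now rewrite Cmod_0.
      * apply L; auto. eapply Rlt_le_trans; [apply Hw|apply Rmin_l].
    + intros w. destruct (Ceq_dec z 0); [easy|]. destruct (Ceq_dec w 0); [reflexivity|].
      field; auto.
Qed.

(** * Goursat's lemma *)

Definition Cint (g : R -> C) (a b : R) : C :=
  (RInt (fun t => Re (g t)) a b, RInt (fun t => Im (g t)) a b).

Definition Rcont (g : R -> C) (t : R) : Prop :=
  continuous (fun s => Re (g s)) t /\ continuous (fun s => Im (g s)) t.

Lemma Rcont_intro (g : R -> C) (t : R) :
  (forall eps, 0 < eps -> exists d, 0 < d /\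
    forall s, Rabs (s - t) < d -> Cmod (g s - g t) < eps) -> Rcont g t.
Proof.
  intros H. split; apply filterlim_locally; intros eps;
    destruct (H eps (cond_pos eps)) as [d [Hd K]]; exists (mkposreal d Hd);
    intros s Hs; specialize (K s Hs).
  - eapply Rle_lt_trans; [|exact K].
    pose proof (re_le_Cmod (g s - g t)) as L. simpl in L. exact L.
  - eapply Rle_lt_trans; [|exact K].
    pose proof (im_le_Cmod (g s - g t)) as L. simpl in L. exact L.
Qed.

Lemma Cint_ext (g h : R -> C) (a b : R) : a <= b ->
  (forall t, a <= t <= b -> g t = h t) -> Cint g a b = Cint h a b.
Proof.
  intros Hab H. unfold Cint. f_equal; apply RInt_ext;
    rewrite Rmin_left, Rmax_right by auto; intros t Ht; rewrite H; auto; lra.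
Qed.

Lemma Rcont_ex_RInt (g : R -> C) (a b : R) : a <= b ->
  (forall t, a <= t <= b -> Rcont g t) ->
  ex_RInt (fun t => Re (g t)) a b /\ ex_RInt (fun t => Im (g t)) a b.
Proof.
  intros Hab H. split; apply (ex_RInt_continuous (V := R_CompleteNormedModule));
    rewrite Rmin_left, Rmax_right by auto; intros t Ht; apply H; auto.
Qed.

Lemma Cint_Chasles (g : R -> C) (a b c : R) : a <= b -> b <= c ->
  (forall t, a <= t <= c -> Rcont g t) ->
  (Cint g a b + Cint g b c)%C = Cint g a c.
Proof.
  intros Hab Hbc H.
  destruct (Rcont_ex_RInt g a b) as [P Q]; auto. { intros; apply H; lra. }
  destruct (Rcont_ex_RInt g b c) as [P' Q']; auto. { intros; apply H; lra. }
  apply injective_projections; simpl.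
  - now apply (RInt_Chasles (V := R_CompleteNormedModule)).
  - now apply (RInt_Chasles (V := R_CompleteNormedModule)).
Qed.

Lemma Cint_minus (g h : R -> C) (a b : R) : a <= b ->
  (forall t, a <= t <= b -> Rcont g t) -> (forall t, a <= t <= b -> Rcont h t) ->
  Cint (fun t => g t - h t)%C a b = (Cint g a b - Cint h a b)%C.
Proof.
  intros Hab H K.
  destruct (Rcont_ex_RInt g a b) as [P Q]; auto.
  destruct (Rcont_ex_RInt h a b) as [P' Q']; auto.
  apply injective_projections; simpl.
  - now apply (RInt_minus (V := R_CompleteNormedModule)).
  - now apply (RInt_minus (V := R_CompleteNormedModule)).
Qed.

Lemma Cint_bound (g : R -> C) (a b B : R) : a <= b ->
  (forall t, a <= t <= b -> Rcont g t) ->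
  (forall t, a <= t <= b -> Cmod (g t) <= B) ->
  Cmod (Cint g a b) <= 2 * B * (b - a).
Proof.
  intros Hab H K.
  destruct (Rcont_ex_RInt g a b) as [P Q]; auto.
  eapply Rle_trans; [apply Cmod_le_sum|]. simpl.
  replace (2 * B * (b - a)) with ((b - a) * B + (b - a) * B) by ring.
  apply Rplus_le_compat.
  - apply (abs_RInt_le_const (fun t => Re (g t))); auto.
    intros t Ht. eapply Rle_trans; [apply re_le_Cmod|auto].
  - apply (abs_RInt_le_const (fun t => Im (g t))); auto.
    intros t Ht. eapply Rle_trans; [apply im_le_Cmod|auto].
Qed.

Lemma RInt_affine (g : R -> R) (p q a b : R) : (forall x, g x = p + q * x) ->
  RInt g a b = p * (b - a) + q * (b * b - a * a) / 2.
Proof.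
  intros Hg.
  rewrite (RInt_ext g (fun x => p + q * x)) by (intros; apply Hg).
  apply is_RInt_unique.
  replace (p * (b - a) + q * (b * b - a * a) / 2) with
    (minus (p * b + q * (b * b) / 2) (p * a + q * (a * a) / 2))
    by (unfold minus, plus, opp; simpl; field).
  apply (is_RInt_derive (V := R_CompleteNormedModule) (fun x => p * x + q * (x * x) / 2)).
  - intros x _. auto_derive; auto. field.
  - intros x _. apply (ex_derive_continuous (V := R_NormedModule)).
    auto_derive; auto.
Qed.

Definition rect_int (f : C -> C) (a b c d : R) : C :=
  (Cint (fun x => f (x, c)) a b + Ci * Cint (fun y => f (b, y)) c d
   - Cint (fun x => f (x, d)) a b - Ci * Cint (fun y => f (a, y)) c d)%C.

Lemma rect_int_affine (k l : C) (a b c d : R) :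
  rect_int (fun w => k + l * w)%C a b c d = RtoC 0.
Proof.
  unfold rect_int, Cint. destruct k as [k1 k2], l as [l1 l2]. simpl.
  rewrite (RInt_affine _ (k1 - l2 * c) l1), (RInt_affine _ (k2 + l1 * c) l2),
    (RInt_affine _ (k1 + l1 * b) (- l2)), (RInt_affine _ (k2 + l2 * b) l1),
    (RInt_affine _ (k1 - l2 * d) l1), (RInt_affine _ (k2 + l1 * d) l2),
    (RInt_affine _ (k1 + l1 * a) (- l2)), (RInt_affine _ (k2 + l2 * a) l1)
    by (intros; ring).
  apply injective_projections; simpl; field.
Qed.

Lemma Cmod_horizontal (x x' y : R) : Cmod ((x, y) - (x', y)) = Rabs (x - x').
Proof.
  replace ((x, y) - (x', y))%C with (RtoC (x - x')).
  - apply Cmod_R.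
  - apply injective_projections; simpl; ring.
Qed.

Lemma Cmod_vertical (x y y' : R) : Cmod ((x, y) - (x, y')) = Rabs (y - y').
Proof.
  replace ((x, y) - (x, y'))%C with (Ci * RtoC (y - y'))%C.
  - rewrite Cmod_mult, Cmod_Ci, Cmod_R. ring.
  - apply injective_projections; simpl; ring.
Qed.

Lemma cont_at_horizontal (f : C -> C) (x y : R) :
  cont_at f (x, y) -> Rcont (fun s => f (s, y)) x.
Proof.
  intros H. apply Rcont_intro. intros eps He. destruct (H eps He) as [d [Hd K]].
  exists d; split; auto. intros s Hs. apply K; auto. now rewrite Cmod_horizontal.
Qed.

Lemma cont_at_vertical (f : C -> C) (x y : R) :
  cont_at f (x, y) -> Rcont (fun s => f (x, s)) y.
Proof.
  intros H. apply Rcont_intro. intros eps He. destruct (H eps He) as [d [Hd K]].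
  exists d; split; auto. intros s Hs. apply K; auto. now rewrite Cmod_vertical.
Qed.

Definition cont_rect (f : C -> C) (a b c d : R) : Prop :=
  forall x y, a <= x <= b -> c <= y <= d -> cont_at f (x, y).

Lemma rect_int_minus (f g : C -> C) (a b c d : R) : a <= b -> c <= d ->
  cont_rect f a b c d -> cont_rect g a b c d ->
  rect_int (fun w => f w - g w)%C a b c d
  = (rect_int f a b c d - rect_int g a b c d)%C.
Proof.
  intros Hab Hcd Hf Hg. unfold rect_int.
  rewrite !Cint_minus; try ring; auto; intros;
    (apply cont_at_horizontal || apply cont_at_vertical); (apply Hf || apply Hg); lra.
Qed.

Lemma rect_int_bound (f : C -> C) (a b c d B : R) : a <= b -> c <= d ->
  cont_rect f a b c d ->
  (forall x y, a <= x <= b -> c <= y <= d -> Cmod (f (x, y)) <= B) ->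
  Cmod (rect_int f a b c d) <= 4 * B * ((b - a) + (d - c)).
Proof.
  intros Hab Hcd Hf HB. unfold rect_int.
  assert (H1 : forall y, c <= y <= d ->
    Cmod (Cint (fun x => f (x, y)) a b) <= 2 * B * (b - a)).
  { intros y Hy. apply Cint_bound; auto.
    intros; apply cont_at_horizontal; apply Hf; lra. }
  assert (H2 : forall x, a <= x <= b ->
    Cmod (Cint (fun y => f (x, y)) c d) <= 2 * B * (d - c)).
  { intros x Hx. apply Cint_bound; auto.
    intros; apply cont_at_vertical; apply Hf; lra. }
  pose proof (H1 c ltac:(lra)). pose proof (H1 d ltac:(lra)).
  pose proof (H2 a ltac:(lra)). pose proof (H2 b ltac:(lra)).
  unfold Cminus.
  eapply Rle_trans; [apply Cmod_triangle|].
  eapply Rle_trans; [apply Rplus_le_compat_r, Cmod_triangle|].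
  eapply Rle_trans; [apply Rplus_le_compat_r, Rplus_le_compat_r, Cmod_triangle|].
  rewrite !Cmod_opp, !Cmod_mult, Cmod_Ci. lra.
Qed.

Lemma rect_int_quarters (f : C -> C) (a c l h : R) : 0 <= l -> 0 <= h ->
  cont_rect f a (a + 2 * l) c (c + 2 * h) ->
  rect_int f a (a + 2 * l) c (c + 2 * h) =
  (rect_int f a (a + l) c (c + h)
   + rect_int f (a + l) (a + l + l) c (c + h)
   + rect_int f a (a + l) (c + h) (c + h + h)
   + rect_int f (a + l) (a + l + l) (c + h) (c + h + h))%C.
Proof.
  intros Hl Hh Hf. unfold rect_int.
  replace (a + l + l) with (a + 2 * l) by ring.
  replace (c + h + h) with (c + 2 * h) by ring.
  rewrite <- (Cint_Chasles (fun x => f (x, c)) a (a + l) (a + 2 * l)),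
    <- (Cint_Chasles (fun x => f (x, c + 2 * h)) a (a + l) (a + 2 * l)),
    <- (Cint_Chasles (fun y => f (a, y)) c (c + h) (c + 2 * h)),
    <- (Cint_Chasles (fun y => f (a + 2 * l, y)) c (c + h) (c + 2 * h));
    try lra; try ring;
    intros; (apply cont_at_horizontal || apply cont_at_vertical); apply Hf; lra.
Qed.

Lemma nested_intervals (a b : nat -> R) :
  (forall n, a n <= a (S n)) -> (forall n, b (S n) <= b n) -> (forall n, a n <= b n) ->
  exists x, forall n, a n <= x <= b n.
Proof.
  intros Ha Hb Hab.
  assert (Ma : forall n m, (n <= m)%nat -> a n <= a m).
  { intros n m H. induction H; [lra|]. eapply Rle_trans; eauto. }
  assert (Mb : forall n m, (n <= m)%nat -> b m <= b n).
  { intros n m H. induction H; [lra|]. eapply Rle_trans; eauto. }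
  assert (K : forall n m, a n <= b m).
  { intros n m. apply Rle_trans with (a (max n m)); [apply Ma; lia|].
    apply Rle_trans with (b (max n m)); auto. apply Mb; lia. }
  destruct (completeness (fun x => exists n, x = a n)) as [x [U L]].
  - exists (b 0%nat). intros y [n ->]. auto.
  - exists (a 0%nat). now exists 0%nat.
  - exists x. intros n. split; [apply U; now exists n|].
    apply L. intros y [m ->]. auto.
Qed.

Section Bisection.

Variables (f : C -> C) (a0 c0 L H : R).

Definition side (l : R) (n : nat) : R := l / 2 ^ n.

Definition cell_int (n : nat) (p : R * R) : R :=
  Cmod (rect_int f (fst p) (fst p + side L n) (snd p) (snd p + side H n)).

Fixpoint corner (n : nat) : R * R :=
  match n with
  | O => (a0, c0)
  | S k =>
      let p := corner k in
      let l := side L (S k) in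
      let h := side H (S k) in
      let good q := Rle_dec (cell_int k p / 4) (cell_int (S k) q) in
      if good (fst p, snd p) then (fst p, snd p)
      else if good (fst p + l, snd p) then (fst p + l, snd p)
      else if good (fst p, snd p + h) then (fst p, snd p + h)
      else (fst p + l, snd p + h)
  end.

Lemma side_S (l : R) (n : nat) : side l n = 2 * side l (S n).
Proof. unfold side. simpl. field. apply pow_nonzero; lra. Qed.

Lemma side_pos (l : R) (n : nat) : 0 <= l -> 0 <= side l n.
Proof.
  intros. unfold side. apply Rdiv_le_0_compat; auto. apply pow_lt; lra.
Qed.

Hypotheses (HL : 0 <= L) (HH : 0 <= H).

Lemma corner_step (n : nat) :
  (fst (corner (S n)) = fst (corner n)
   \/ fst (corner (S n)) = fst (corner n) + side L (S n)) /\
  (snd (corner (S n)) = snd (corner n)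
   \/ snd (corner (S n)) = snd (corner n) + side H (S n)).
Proof.
  simpl. repeat destruct (Rle_dec _ _); simpl; auto.
Qed.

Lemma corner_mono (n : nat) :
  fst (corner n) <= fst (corner (S n)) /\
  fst (corner (S n)) + side L (S n) <= fst (corner n) + side L n /\
  snd (corner n) <= snd (corner (S n)) /\
  snd (corner (S n)) + side H (S n) <= snd (corner n) + side H n.
Proof.
  destruct (corner_step n) as [A B].
  pose proof (side_pos L (S n) HL). pose proof (side_pos H (S n) HH).
  rewrite (side_S L n), (side_S H n). lra.
Qed.

Lemma corner_in (n : nat) :
  a0 <= fst (corner n) /\ fst (corner n) + side L n <= a0 + L /\
  c0 <= snd (corner n) /\ snd (corner n) + side H n <= c0 + H.
Proof.
  induction n as [|n IH].
  - simpl. unfold side. simpl. lra.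
  - pose proof (corner_mono n). lra.
Qed.

Hypothesis Hf : cont_rect f a0 (a0 + L) c0 (c0 + H).

Lemma corner_large (n : nat) : cell_int 0 (corner 0) / 4 ^ n <= cell_int n (corner n).
Proof.
  induction n as [|n IH]; [simpl; lra|].
  assert (K : cell_int n (corner n) / 4 <= cell_int (S n) (corner (S n))).
  { assert (Q : cell_int n (corner n) <=
      cell_int (S n) (fst (corner n), snd (corner n))
      + cell_int (S n) (fst (corner n) + side L (S n), snd (corner n))
      + cell_int (S n) (fst (corner n), snd (corner n) + side H (S n))
      + cell_int (S n) (fst (corner n) + side L (S n), snd (corner n) + side H (S n))).
    { unfold cell_int at 1. rewrite (side_S L n), (side_S H n).
      pose proof (side_pos L (S n) HL). pose proof (side_pos H (S n) HH).
      pose proof (corner_in n) as I. rewrite (side_S L n), (side_S H n) in I.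
      rewrite rect_int_quarters; auto.
      - unfold cell_int; simpl fst; simpl snd.
        eapply Rle_trans; [apply Cmod_triangle|]. apply Rplus_le_compat_r.
        eapply Rle_trans; [apply Cmod_triangle|]. apply Rplus_le_compat_r.
        apply Cmod_triangle.
      - intros x y Hx Hy. apply Hf; lra. }
    cbn [corner]. cbv zeta.
    destruct (Rle_dec _ _); auto. destruct (Rle_dec _ _); auto.
    destruct (Rle_dec _ _); auto. lra. }
  eapply Rle_trans; [|exact K].
  replace (cell_int 0 (corner 0) / 4 ^ S n) with (cell_int 0 (corner 0) / 4 ^ n / 4).
  - lra.
  - simpl. field. apply pow_nonzero; lra.
Qed.

End Bisection.

Lemma goursat_local (f : C -> C) (p : C) (eps : R) : cdiff f p -> 0 < eps ->
  exists r, 0 < r /\ forall a c l h,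
    0 <= l -> 0 <= h -> l + h < r ->
    a <= fst p <= a + l -> c <= snd p <= c + h ->
    cont_rect f a (a + l) c (c + h) ->
    Cmod (rect_int f a (a + l) c (c + h)) <= eps * ((l + h) * (l + h)).
Proof.
  intros [q [Hq Hfq]] He.
  destruct (Hq (eps / 4)) as [r [Hr K]]; [lra|].
  exists r; split; auto. intros a c l h Hl Hh Hlh Ha Hc Cf.
  set (A := fun w => (f p - q p * p + q p * w)%C).
  assert (CA : cont_rect A a (a + l) c (c + h)).
  { intros x y _ _. apply cont_within_plus; [apply cont_within_const|].
    apply cont_within_mult; [apply cont_within_const|apply cont_within_id]. }
  assert (E : rect_int f a (a + l) c (c + h)
    = rect_int (fun w => f w - A w)%C a (a + l) c (c + h)).
  { rewrite rect_int_minus; auto; try lra.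
    unfold A at 1. rewrite rect_int_affine. ring. }
  rewrite E.
  replace (eps * ((l + h) * (l + h))) with
    (4 * (eps / 4 * (l + h)) * ((a + l - a) + (c + h - c))) by field.
  apply rect_int_bound; try lra.
  - intros x y Hx Hy. apply cont_within_minus; [apply Cf|apply CA]; auto.
  - intros x y Hx Hy. unfold A. rewrite (Hfq (x, y)).
    replace (f p + q (x, y) * ((x, y) - p) - (f p - q p * p + q p * (x, y)))%C
      with ((q (x, y) - q p) * ((x, y) - p))%C by ring.
    rewrite Cmod_mult.
    assert (D : Cmod ((x, y) - p) <= l + h).
    { eapply Rle_trans; [apply Cmod_le_sum|]. destruct p as [p1 p2]; simpl in *.
      apply Rplus_le_compat; apply Rabs_le; lra. }
    apply Rmult_le_compat; auto; try apply Cmod_ge_0.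
    left. apply K; auto. lra.
Qed.

Theorem goursat (f : C -> C) (a b c d : R) : a <= b -> c <= d ->
  (forall x y, a <= x <= b -> c <= y <= d -> cdiff f (x, y)) ->
  rect_int f a b c d = RtoC 0.
Proof.
  intros Hab Hcd Hf.
  set (L := b - a). set (H := d - c).
  assert (HL : 0 <= L) by (unfold L; lra). assert (HH : 0 <= H) by (unfold H; lra).
  replace b with (a + L) in * by (unfold L; ring).
  replace d with (c + H) in * by (unfold H; ring). clearbody L H.
  assert (Cf : cont_rect f a (a + L) c (c + H)) by (intros x y Hx Hy; apply cdiff_cont; auto).
  set (co := corner f a c L H).
  destruct (nested_intervals (fun n => fst (co n)) (fun n => fst (co n) + side L n))
    as [x Hx].
  { intros n. apply corner_mono; auto. }
  { intros n. apply corner_mono; auto. }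
  { intros n. pose proof (side_pos L n HL). lra. }
  destruct (nested_intervals (fun n => snd (co n)) (fun n => snd (co n) + side H n))
    as [y Hy].
  { intros n. apply corner_mono; auto. }
  { intros n. apply corner_mono; auto. }
  { intros n. pose proof (side_pos H n HH). lra. }
  assert (D : cdiff f (x, y)).
  { pose proof (Hx 0%nat) as H0. pose proof (Hy 0%nat) as H1. unfold side in *.
    simpl in H0, H1. apply Hf; lra. }
  apply Cmod_eq_0. apply Rle_antisym; [|apply Cmod_ge_0].
  apply le_epsilon. intros eps He. rewrite Rplus_0_l.
  set (e := eps / ((L + H) * (L + H) + 1)).
  assert (He' : 0 < e) by (apply Rdiv_lt_0_compat; nra).
  destruct (goursat_local f (x, y) e D He') as [r [Hr K]].
  assert (exists n, (L + H) / 2 ^ n < r) as [n Hn].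
  { destruct (pow_lt_1_zero (/ 2)) with (y := r / (L + H + 1)) as [n Hn].
    - rewrite Rabs_right; lra.
    - apply Rdiv_lt_0_compat; lra.
    - exists n. specialize (Hn n (le_n n)).
      rewrite pow_inv, Rabs_right in Hn
        by (left; apply Rinv_0_lt_compat, pow_lt; lra).
      assert (0 < / 2 ^ n) by (apply Rinv_0_lt_compat, pow_lt; lra).
      apply (Rmult_lt_compat_r (L + H + 1)) in Hn; [|lra].
      unfold Rdiv in Hn. rewrite Rmult_assoc, Rinv_l in Hn by lra.
      unfold Rdiv. nra. }
  pose proof (corner_large f a c L H HL HH Cf n) as B.
  specialize (K (fst (co n)) (snd (co n)) (side L n) (side H n)
    (side_pos L n HL) (side_pos H n HH)).
  pose proof (corner_in f a c L H HL HH n) as In. fold co in In, B.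
  assert (side L n + side H n = (L + H) / 2 ^ n) as S
    by (unfold side; field; apply pow_nonzero; lra).
  assert (K' : cell_int f L H n (co n) <= e * ((L + H) / 2 ^ n * ((L + H) / 2 ^ n))).
  { rewrite <- S. apply K; auto; [lra|].
    intros u v Hu Hv. apply Cf; lra. }
  assert (E : cell_int f L H 0 (co 0%nat) = Cmod (rect_int f a (a + L) c (c + H))).
  { unfold cell_int, co, side. simpl. now rewrite !Rdiv_1_r. }
  rewrite E in B.
  assert (P4 : 0 < 4 ^ n) by (apply pow_lt; lra).
  assert (P2 : 2 ^ n * 2 ^ n = 4 ^ n) by (rewrite <- Rpow_mult_distr; f_equal; lra).
  assert (Z : Cmod (rect_int f a (a + L) c (c + H)) <= e * ((L + H) * (L + H))).
  { apply Rmult_le_reg_r with (/ 4 ^ n); [now apply Rinv_0_lt_compat|].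
    eapply Rle_trans; [exact B|]. eapply Rle_trans; [exact K'|].
    rewrite <- P2. right. field. apply pow_nonzero; lra. }
  eapply Rle_trans; [exact Z|].
  apply Rle_trans with (e * ((L + H) * (L + H) + 1)); [nra|].
  unfold e. right. field. nra.
Qed.

(** * The exponential and means over the unit circle *)

Lemma Cexp_plus (z w : C) : Cexp (z + w) = (Cexp z * Cexp w)%C.
Proof.
  destruct z as [x y], w as [u v]. unfold Cexp; simpl.
  rewrite exp_plus, cos_plus, sin_plus.
  apply injective_projections; simpl; ring.
Qed.

Lemma Cmod_Cexp (z : C) : Cmod (Cexp z) = exp (Re z).
Proof.
  unfold Cmod, Cexp; simpl.
  replace (exp (Re z) * cos (Im z) * (exp (Re z) * cos (Im z) * 1) +
    exp (Re z) * sin (Im z) * (exp (Re z) * sin (Im z) * 1))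
    with (exp (Re z) * exp (Re z) * (Rsqr (sin (Im z)) + Rsqr (cos (Im z))))
    by (unfold Rsqr; ring).
  rewrite sin2_cos2, Rmult_1_r. apply sqrt_square. left; apply exp_pos.
Qed.

Lemma Cexp_0 : Cexp 0 = RtoC 1.
Proof.
  unfold Cexp; simpl. rewrite exp_0, cos_0, sin_0.
  apply injective_projections; simpl; ring.
Qed.

Lemma Rabs_sin_le (y : R) : Rabs (sin y) <= Rabs y.
Proof.
  destruct (MVT_gen sin 0 y cos) as [c [_ Hc]].
  - intros x _. apply is_derive_sin.
  - intros x _. apply continuity_sin.
  - rewrite sin_0, !Rminus_0_r in Hc. rewrite Hc, Rabs_mult.
    rewrite <- (Rmult_1_l (Rabs y)) at 2. apply Rmult_le_compat_r; [apply Rabs_pos|].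
    apply Rabs_le. pose proof (COS_bound c). lra.
Qed.

Lemma Rabs_cos_1_le (y : R) : Rabs (cos y - 1) <= y * y / 2.
Proof.
  replace y with (2 * (y / 2)) at 1 by field. rewrite cos_2a_sin.
  replace (1 - 2 * sin (y / 2) * sin (y / 2) - 1)
    with (- (2 * (sin (y / 2) * sin (y / 2)))) by ring.
  rewrite Rabs_Ropp, Rabs_mult, Rabs_mult, (Rabs_right 2) by lra.
  pose proof (Rabs_sin_le (y / 2)) as H. pose proof (Rabs_pos (sin (y / 2))).
  assert (K : Rabs (y / 2) * Rabs (y / 2) = y * y / 4).
  { rewrite <- Rabs_mult, Rabs_right; [field|]. nra. }
  nra.
Qed.

Lemma Rabs_sin_minus_le (y : R) : Rabs (sin y - y) <= Rabs y * (y * y / 2).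
Proof.
  destruct (MVT_gen sin 0 y cos) as [c [Hr Hc]].
  - intros x _. apply is_derive_sin.
  - intros x _. apply continuity_sin.
  - rewrite sin_0, !Rminus_0_r in Hc. rewrite Hc.
    replace (cos c * y - y) with (y * (cos c - 1)) by ring. rewrite Rabs_mult.
    apply Rmult_le_compat_l; [apply Rabs_pos|].
    eapply Rle_trans; [apply Rabs_cos_1_le|].
    assert (c * c <= y * y); [|lra].
    unfold Rmin, Rmax in Hr. destruct (Rle_dec 0 y); nra.
Qed.

Lemma exp_quadratic (x : R) : Rabs x <= 1 / 2 -> Rabs (exp x - 1 - x) <= 2 * (x * x).
Proof.
  intros Hx. apply Rabs_le_between in Hx.
  pose proof (exp_ineq1_le x). pose proof (exp_ineq1_le (- x)).
  rewrite exp_Ropp in H0. pose proof (exp_pos x).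
  assert (exp x * (1 - x) <= 1).
  { replace 1 with (exp x * / exp x) at 2 by (field; lra).
    apply Rmult_le_compat_l; lra. }
  apply Rabs_le. split; [nra|].
  apply Rmult_le_reg_r with (1 - x); [lra|]. nra.
Qed.

Lemma Cexp_quadratic (w : C) : Cmod w <= 1 / 2 ->
  Cmod (Cexp w - 1 - w) <= 4 * (Cmod w * Cmod w).
Proof.
  intros Hw. pose proof (re_le_Cmod w) as Hx. pose proof (im_le_Cmod w) as Hy.
  assert (E : Cmod w * Cmod w = Re w * Re w + Im w * Im w).
  { pose proof (Cmod2_alt w) as K. simpl in K. lra. }
  rewrite E. destruct w as [x y]. simpl in *.
  eapply Rle_trans; [apply Cmod_le_sum|]. simpl.
  pose proof (exp_quadratic x ltac:(lra)) as H1.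
  pose proof (Rabs_cos_1_le y) as H2. pose proof (Rabs_sin_minus_le y) as H3.
  pose proof (Rabs_sin_le y) as H4.
  pose proof (Rabs_pos x) as Px. pose proof (Rabs_pos y) as Py.
  assert (Ex : Rabs x * Rabs x = x * x) by (rewrite <- Rabs_mult; apply Rabs_right; nra).
  assert (Ey : Rabs y * Rabs y = y * y) by (rewrite <- Rabs_mult; apply Rabs_right; nra).
  assert (A : Rabs (exp x * cos y + - (1) + - x) <= 2 * (x * x) + 3 / 2 * (y * y / 2)).
  { replace (exp x * cos y + - (1) + - x)
      with ((exp x - 1 - x) * cos y + (1 + x) * (cos y - 1)) by ring.
    eapply Rle_trans; [apply Rabs_triang|]. rewrite !Rabs_mult.
    apply Rplus_le_compat.
    - rewrite <- (Rmult_1_r (2 * (x * x))).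
      apply Rmult_le_compat; auto using Rabs_pos.
      apply Rabs_le. pose proof (COS_bound y); lra.
    - apply Rmult_le_compat; auto using Rabs_pos.
      apply Rabs_le. apply Rabs_le_between in Hx. lra. }
  assert (B : Rabs (exp x * sin y + - 0 + - y) <= 2 * Rabs x * Rabs y + Rabs y * (y * y / 2)).
  { replace (exp x * sin y + - 0 + - y)
      with ((exp x - 1) * sin y + (sin y - y)) by ring.
    eapply Rle_trans; [apply Rabs_triang|]. rewrite Rabs_mult.
    apply Rplus_le_compat; auto.
    apply Rmult_le_compat; auto using Rabs_pos.
    replace (exp x - 1) with ((exp x - 1 - x) + x) by ring.
    eapply Rle_trans; [apply Rabs_triang|].
    assert (Hx2 : Rabs x <= 1 / 2) by lra.
    assert (2 * (x * x) <= Rabs x) by (rewrite <- Ex; nra). lra. }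
  assert (Hy2 : Rabs y <= 1 / 2) by lra.
  assert (Rabs y * (y * y / 2) <= y * y / 4).
  { rewrite <- Ey. assert (0 <= Rabs y * Rabs y) by nra. nra. }
  assert (2 * Rabs x * Rabs y <= x * x + y * y).
  { rewrite <- Ex, <- Ey. pose proof (Rle_0_sqr (Rabs x - Rabs y)) as Q. unfold Rsqr in Q. lra. }
  pose proof (Rle_0_sqr x) as Sx. pose proof (Rle_0_sqr y) as Sy. unfold Rsqr in Sx, Sy.
  lra.
Qed.

Lemma cdiff_Cexp (z : C) : cdiff Cexp z.
Proof.
  assert (H0 : cdiff Cexp 0).
  { exists (fun w => if Ceq_dec w 0 then RtoC 1 else ((Cexp w - 1) / w)%C); split.
    - intros eps He. exists (Rmin (1 / 2) (eps / 8)).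
      split; [apply Rmin_pos; lra|]. intros w _ Hw.
      replace (w - 0)%C with w in Hw by ring.
      destruct (Ceq_dec 0 0); [|easy]. destruct (Ceq_dec w 0) as [_|N].
      + replace (1 - 1)%C with (RtoC 0) by ring. now rewrite Cmod_0.
      + replace ((Cexp w - 1) / w - 1)%C with ((Cexp w - 1 - w) * / w)%C by (field; auto).
        pose proof (Rmin_l (1 / 2) (eps / 8)). pose proof (Rmin_r (1 / 2) (eps / 8)).
        pose proof (proj1 (Cmod_gt_0 w) N) as P.
        pose proof (Cexp_quadratic w ltac:(lra)) as Q.
        rewrite Cmod_mult, Cmod_inv by auto.
        apply Rle_lt_trans with (4 * (Cmod w * Cmod w) * / Cmod w).
        * apply Rmult_le_compat_r; auto. left; now apply Rinv_0_lt_compat.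
        * replace (4 * (Cmod w * Cmod w) * / Cmod w) with (4 * Cmod w) by (field; lra). lra.
    - intros w. rewrite Cexp_0. destruct (Ceq_dec w 0) as [->|N].
      + rewrite Cexp_0. ring.
      + field; auto. }
  apply cdiff_local with (f := fun w => (Cexp z * Cexp (w - z))%C) (d := 1); [lra| |].
  - intros w _. rewrite <- Cexp_plus. f_equal. ring.
  - apply cdiff_mult; [apply cdiff_const|].
    apply cdiff_comp with (f := Cexp).
    + replace (z - z)%C with (RtoC 0) by ring. auto.
    + apply cdiff_minus; [apply cdiff_id|apply cdiff_const].
Qed.

Definition cis (t : R) : C := Cexp (0, t).

Lemma Cmod_cis (t : R) : Cmod (cis t) = 1.
Proof. unfold cis. rewrite Cmod_Cexp. simpl. apply exp_0. Qed.

Lemma cis_neq_0 (t : R) : cis t <> RtoC 0.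
Proof. apply Cmod_gt_0. rewrite Cmod_cis. lra. Qed.

Lemma Cconj_unit (z : C) : Cmod z = 1 -> Cconj z = (/ z)%C.
Proof.
  intros H. assert (N : z <> RtoC 0) by (apply Cmod_gt_0; lra).
  pose proof (Cmod2_conj z) as K. rewrite H in K.
  replace (RtoC (1 ^ 2)) with (RtoC 1) in K by (f_equal; ring).
  replace (Cconj z) with (z * Cconj z * / z)%C by (field; auto).
  rewrite <- K. ring.
Qed.

Definition circle_cont (h : C -> C) : Prop :=
  forall z, Cmod z = 1 -> cont_within (fun w => Cmod w = 1) h z.

Lemma circle_cont_const (k : C) : circle_cont (fun _ => k).
Proof. intros z _; apply cont_within_const. Qed.

Lemma circle_cont_id : circle_cont (fun z => z).
Proof. intros z _; apply cont_within_id. Qed.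

Lemma circle_cont_plus (f g : C -> C) :
  circle_cont f -> circle_cont g -> circle_cont (fun z => f z + g z)%C.
Proof. intros Hf Hg z Hz; apply cont_within_plus; auto. Qed.

Lemma circle_cont_minus (f g : C -> C) :
  circle_cont f -> circle_cont g -> circle_cont (fun z => f z - g z)%C.
Proof. intros Hf Hg z Hz; apply cont_within_minus; auto. Qed.

Lemma circle_cont_opp (f : C -> C) : circle_cont f -> circle_cont (fun z => - f z)%C.
Proof. intros Hf z Hz; apply cont_within_opp; auto. Qed.

Lemma circle_cont_mult (f g : C -> C) :
  circle_cont f -> circle_cont g -> circle_cont (fun z => f z * g z)%C.
Proof. intros Hf Hg z Hz; apply cont_within_mult; auto. Qed.

Lemma circle_cont_conj (f : C -> C) : circle_cont f -> circle_cont (fun z => Cconj (f z)).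
Proof. intros Hf z Hz; apply cont_within_conj; auto. Qed.

Lemma circle_cont_Rcont (h : C -> C) (t : R) :
  circle_cont h -> Rcont (fun s => h (cis s)) t.
Proof.
  intros H. apply Rcont_intro. intros eps He.
  destruct (H (cis t) (Cmod_cis t) eps He) as [d [Hd K]].
  destruct (cdiff_cont _ _ (cdiff_Cexp (0, t)) d Hd) as [e [He' L]].
  exists e; split; auto. intros s Hs. apply K; [apply Cmod_cis|].
  apply L; auto. now rewrite Cmod_vertical.
Qed.

Definition turn (t : R) : Prop := 0 <= t <= 2 * PI.

Definition mean (h : C -> C) : C :=
  (Cint (fun t => h (cis t)) 0 (2 * PI) / RtoC (2 * PI))%C.

Lemma two_PI_pos : 0 < 2 * PI.
Proof. pose proof PI_RGT_0. lra. Qed.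

Lemma RtoC_neq_0 (x : R) : x <> 0 -> RtoC x <> RtoC 0.
Proof. intros H E. apply H. now apply (f_equal fst) in E. Qed.

Lemma two_PI_neq_0 : RtoC (2 * PI) <> RtoC 0.
Proof. apply RtoC_neq_0. pose proof two_PI_pos. lra. Qed.

Lemma mean_ext (f g : C -> C) : (forall t, turn t -> f (cis t) = g (cis t)) ->
  mean f = mean g.
Proof.
  intros H. unfold mean. f_equal. apply Cint_ext; auto. left; apply two_PI_pos.
Qed.

Lemma mean_minus (f g : C -> C) : circle_cont f -> circle_cont g ->
  mean (fun z => f z - g z)%C = (mean f - mean g)%C.
Proof.
  intros Hf Hg. unfold mean. rewrite Cint_minus.
  - field. apply two_PI_neq_0.
  - left; apply two_PI_pos.
  - intros; now apply circle_cont_Rcont.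
  - intros; now apply circle_cont_Rcont.
Qed.

Lemma mean_conj (f : C -> C) : circle_cont f ->
  mean (fun z => Cconj (f z)) = Cconj (mean f).
Proof.
  intros Hf. unfold mean.
  destruct (Rcont_ex_RInt (fun t => f (cis t)) 0 (2 * PI)) as [P Q].
  - left; apply two_PI_pos.
  - intros; now apply circle_cont_Rcont.
  - assert (E : Cint (fun t => Cconj (f (cis t))) 0 (2 * PI)
      = Cconj (Cint (fun t => f (cis t)) 0 (2 * PI))).
    { apply injective_projections; simpl; auto.
      now apply (RInt_opp (V := R_CompleteNormedModule)). }
    rewrite E. unfold Cdiv. rewrite Cmult_conj. f_equal.
    rewrite <- RtoC_inv by (pose proof two_PI_pos; lra). unfold Cconj; simpl. apply injective_projections; simpl; ring.
Qed.

Lemma mean_scal (k : C) (f : C -> C) : circle_cont f ->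
  mean (fun z => k * f z)%C = (k * mean f)%C.
Proof.
  intros Hf. unfold mean.
  destruct (Rcont_ex_RInt (fun t => f (cis t)) 0 (2 * PI)) as [P Q].
  - left; apply two_PI_pos.
  - intros; now apply circle_cont_Rcont.
  - assert (E : Cint (fun t => (k * f (cis t))%C) 0 (2 * PI)
      = (k * Cint (fun t => f (cis t)) 0 (2 * PI))%C).
    { destruct k as [k1 k2].
      pose proof (ex_RInt_scal (V := R_NormedModule) _ _ _ k1 P) as P1.
      pose proof (ex_RInt_scal (V := R_NormedModule) _ _ _ k2 P) as P2.
      pose proof (ex_RInt_scal (V := R_NormedModule) _ _ _ k1 Q) as Q1.
      pose proof (ex_RInt_scal (V := R_NormedModule) _ _ _ k2 Q) as Q2.
      apply injective_projections; simpl.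
      - eapply eq_trans.
        { apply (RInt_minus (V := R_CompleteNormedModule) _ _ _ _ P1 Q2). }
        exact (f_equal2 Rminus (RInt_scal (V := R_CompleteNormedModule) _ _ _ k1 P)
          (RInt_scal (V := R_CompleteNormedModule) _ _ _ k2 Q)).
      - eapply eq_trans.
        { apply (RInt_plus (V := R_CompleteNormedModule) _ _ _ _ Q1 P2). }
        exact (f_equal2 Rplus (RInt_scal (V := R_CompleteNormedModule) _ _ _ k1 Q)
          (RInt_scal (V := R_CompleteNormedModule) _ _ _ k2 P)). }
    rewrite E. unfold Cdiv. ring.
Qed.

Lemma mean_const (k : C) : mean (fun _ => k) = k.
Proof.
  unfold mean, Cint. rewrite !RInt_const, Rminus_0_r.
  pose proof two_PI_neq_0 as N. revert N. generalize (2 * PI). intros p N.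
  assert (E : (scal p (Re k), scal p (Im k)) = (RtoC p * k)%C).
  { unfold scal; simpl; unfold mult; simpl.
    destruct k; apply injective_projections; simpl; ring. }
  eapply eq_trans; [apply (f_equal (fun c => (c / RtoC p)%C) E)|]. field. exact N.
Qed.

Lemma mean_opp (f : C -> C) : circle_cont f -> mean (fun z => - f z)%C = (- mean f)%C.
Proof.
  intros Hf. rewrite (mean_ext _ (fun z => - (1) * f z)%C).
  - rewrite mean_scal by auto. ring.
  - intros; ring.
Qed.

Lemma mean_plus (f g : C -> C) : circle_cont f -> circle_cont g ->
  mean (fun z => f z + g z)%C = (mean f + mean g)%C.
Proof.
  intros Hf Hg. rewrite (mean_ext _ (fun z => f z - - g z)%C) by (intros; ring).
  rewrite mean_minus, mean_opp; auto using circle_cont_opp. ring.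
Qed.

Lemma Re_mean (f : C -> C) :
  Re (mean f) = RInt (fun t => Re (f (cis t))) 0 (2 * PI) / (2 * PI).
Proof.
  unfold mean, Cdiv. rewrite <- RtoC_inv by (pose proof two_PI_pos; lra). simpl. unfold Rdiv. ring.
Qed.

Lemma Re_mean_le (f g : C -> C) : circle_cont f -> circle_cont g ->
  (forall t, turn t -> Re (f (cis t)) <= Re (g (cis t))) -> Re (mean f) <= Re (mean g).
Proof.
  intros Hf Hg H. rewrite !Re_mean. pose proof two_PI_pos.
  apply Rmult_le_compat_r; [left; now apply Rinv_0_lt_compat|].
  destruct (Rcont_ex_RInt (fun t => f (cis t)) 0 (2 * PI)) as [P _]; [lra| |].
  { intros; now apply circle_cont_Rcont. }
  destruct (Rcont_ex_RInt (fun t => g (cis t)) 0 (2 * PI)) as [Q _]; [lra| |].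
  { intros; now apply circle_cont_Rcont. }
  apply RInt_le; auto; [lra|]. intros t Ht. apply H. unfold turn. lra.
Qed.

Lemma Cmod_mean_le (f g : C -> C) : circle_cont f -> circle_cont g ->
  (forall t, turn t -> Cmod (f (cis t)) <= Re (g (cis t))) -> Cmod (mean f) <= 2 * Re (mean g).
Proof.
  intros Hf Hg H.
  assert (Cf : circle_cont (fun z => - f z)%C) by now apply circle_cont_opp.
  assert (Ci' : circle_cont (fun z => - Ci * f z)%C)
    by (apply circle_cont_mult; auto; apply circle_cont_const).
  assert (Ci'' : circle_cont (fun z => Ci * f z)%C)
    by (apply circle_cont_mult; auto; apply circle_cont_const).
  assert (B : forall t, turn t -> Rabs (Re (f (cis t))) <= Re (g (cis t)) /\
    Rabs (Im (f (cis t))) <= Re (g (cis t))).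
  { intros t Ht. pose proof (H t Ht). pose proof (re_le_Cmod (f (cis t))).
    pose proof (im_le_Cmod (f (cis t))). lra. }
  pose proof (Re_mean_le f g Hf Hg) as R1.
  pose proof (Re_mean_le _ g Cf Hg) as R2.
  pose proof (Re_mean_le _ g Ci' Hg) as R3.
  pose proof (Re_mean_le _ g Ci'' Hg) as R4.
  rewrite mean_opp in R2 by auto. rewrite mean_scal in R3, R4 by auto.
  simpl in R1, R2, R3, R4.
  assert (forall t, turn t -> Re (f (cis t)) <= Re (g (cis t)) /\ - Re (f (cis t)) <= Re (g (cis t))
    /\ Im (f (cis t)) <= Re (g (cis t)) /\ - Im (f (cis t)) <= Re (g (cis t))) as B'.
  { intros t Ht. destruct (B t Ht) as [B1 B2]. apply Rabs_le_between in B1, B2. lra. }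
  unfold Re, Im in *.
  assert (K1 : fst (mean f) <= fst (mean g)) by (apply R1; intros t Ht; apply (B' t Ht)).
  assert (K2 : - fst (mean f) <= fst (mean g)) by (apply R2; intros t Ht; apply (B' t Ht)).
  assert (K3 : snd (mean f) <= fst (mean g)).
  { apply Rle_trans with (- 0 * fst (mean f) - - (1) * snd (mean f)); [lra|].
    apply R3; intros t Ht; pose proof (B' t Ht); lra. }
  assert (K4 : - snd (mean f) <= fst (mean g)).
  { apply Rle_trans with (0 * fst (mean f) - 1 * snd (mean f)); [lra|].
    apply R4; intros t Ht; pose proof (B' t Ht); lra. }
  eapply Rle_trans; [apply Cmod_le_sum|]. unfold Re, Im.
  assert (Rabs (fst (mean f)) <= fst (mean g)) by (apply Rabs_le; lra).
  assert (Rabs (snd (mean f)) <= fst (mean g)) by (apply Rabs_le; lra).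
  lra.
Qed.

(** * Constancy of circle means *)

Definition outside (w : C) : Prop := 1 <= Cmod w.

Definition lim_infinity (f : C -> C) (l : C) : Prop :=
  forall eps, 0 < eps -> exists r, forall z, r < Cmod z -> Cmod (f z - l) < eps.

Definition circle_int (f : C -> C) (x : R) : C :=
  Cint (fun t => f (Cexp (x, t))) 0 (2 * PI).

Lemma Cexp_outside (x t : R) : 0 <= x -> outside (Cexp (x, t)).
Proof.
  intros Hx. unfold outside. rewrite Cmod_Cexp. simpl.
  rewrite <- exp_0. destruct Hx as [Hx|<-]; [left; now apply exp_increasing|right; auto].
Qed.

Lemma Rmax_0_lip (u x : R) : Rabs (Rmax u 0 - Rmax x 0) <= Rabs (u - x).
Proof.
  unfold Rmax, Rabs. repeat destruct (Rle_dec _ _); repeat destruct (Rcase_abs _); lra.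
Qed.

Lemma clamp_continuous (f : C -> C) (x t : R) :
  (forall z, outside z -> cont_within outside f z) ->
  forall eps, 0 < eps -> exists d, 0 < d /\ forall u v,
    Rabs (u - x) < d -> Rabs (v - t) < d ->
    Cmod (f (Cexp (Rmax u 0, v)) - f (Cexp (Rmax x 0, t))) < eps.
Proof.
  intros Hf eps He.
  destruct (Hf (Cexp (Rmax x 0, t)) (Cexp_outside _ t (Rmax_r x 0)) eps He)
    as [d [Hd K]].
  destruct (cdiff_cont _ _ (cdiff_Cexp (Rmax x 0, t)) d Hd) as [e [He' L]].
  exists (e / 2); split; [lra|]. intros u v Hu Hv.
  apply K; [apply Cexp_outside, Rmax_r|]. apply L; auto.
  eapply Rle_lt_trans; [apply Cmod_le_sum|]. simpl.
  pose proof (Rmax_0_lip u x). unfold Rminus in *. lra.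
Qed.

Lemma clamp_Rcont (f : C -> C) (x t : R) : 0 <= x ->
  (forall z, outside z -> cont_within outside f z) ->
  Rcont (fun s => f (Cexp (x, s))) t.
Proof.
  intros Hx Hf. apply Rcont_intro. intros eps He.
  destruct (clamp_continuous f x t Hf eps He) as [d [Hd K]].
  exists d; split; auto. intros s Hs.
  specialize (K x s). rewrite (Rmax_left x 0) in K by auto. apply K; auto.
  replace (x - x) with 0 by ring. now rewrite Rabs_R0.
Qed.

Lemma circle_int_continuous (f : C -> C) (x : R) : 0 <= x ->
  (forall z, outside z -> cont_within outside f z) ->
  forall eps, 0 < eps -> exists d, 0 < d /\ forall y, 0 <= y -> Rabs (y - x) < d ->
    Cmod (circle_int f y - circle_int f x) <= eps.
Proof.
  intros Hx Hf eps He. pose proof two_PI_pos as P.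
  set (e := eps / (4 * (2 * PI))).
  assert (Pe : 0 < e) by (apply Rdiv_lt_0_compat; lra).
  assert (U : forall g : C -> R, (forall z w, Rabs (g z - g w) <= Cmod (z - w)) ->
    exists d, 0 < d /\ forall y t, 0 <= y -> 0 <= t <= 2 * PI -> Rabs (y - x) < d ->
      Rabs (g (f (Cexp (y, t))) - g (f (Cexp (x, t)))) < e).
  { intros g Hg.
    destruct (uniform_continuity_2d (fun u v => g (f (Cexp (Rmax u 0, v))))
      0 (x + 1) 0 (2 * PI)) with (eps := mkposreal e Pe) as [d Hd].
    - intros u v _ _ eta.
      destruct (clamp_continuous f u v Hf eta (cond_pos eta)) as [d [Hd K]].
      exists (mkposreal d Hd). intros u' v' Hu Hv.
      eapply Rle_lt_trans; [apply Hg|]. now apply K.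
    - exists (Rmin d 1); split; [apply Rmin_pos; [apply cond_pos|lra]|].
      intros y t Hy Ht Hyx.
      pose proof (Rmin_l d 1). pose proof (Rmin_r d 1).
      assert (Rabs (y - x) < 1) as B by lra. apply Rabs_lt_between in B.
      specialize (Hd x t y t). simpl in Hd.
      rewrite (Rmax_left x 0), (Rmax_left y 0) in Hd by auto.
      apply Hd; try lra. replace (t - t) with 0 by ring. rewrite Rabs_R0. apply cond_pos. }
  destruct (U Re) as [d1 [Hd1 K1]].
  { intros z w. pose proof (re_le_Cmod (z - w)) as H. simpl in H. exact H. }
  destruct (U Im) as [d2 [Hd2 K2]].
  { intros z w. pose proof (im_le_Cmod (z - w)) as H. simpl in H. exact H. }
  exists (Rmin d1 d2); split; [now apply Rmin_pos|]. intros y Hy Hyx.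
  pose proof (Rmin_l d1 d2). pose proof (Rmin_r d1 d2).
  unfold circle_int. rewrite <- Cint_minus; try lra.
  - eapply Rle_trans; [apply Cint_bound with (B := 2 * e); try lra|].
    + intros t _. apply Rcont_intro. intros eta Heta.
      destruct (clamp_continuous f y t Hf (eta / 2)) as [c1 [Hc1 L1]]; [lra|].
      destruct (clamp_continuous f x t Hf (eta / 2)) as [c2 [Hc2 L2]]; [lra|].
      exists (Rmin c1 c2); split; [now apply Rmin_pos|]. intros s Hs.
      pose proof (Rmin_l c1 c2). pose proof (Rmin_r c1 c2).
      specialize (L1 y s). specialize (L2 x s).
      rewrite (Rmax_left y 0) in L1 by auto. rewrite (Rmax_left x 0) in L2 by auto.
      replace (y - y) with 0 in L1 by ring. replace (x - x) with 0 in L2 by ring.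
      rewrite Rabs_R0 in L1, L2. specialize (L1 Hc1 ltac:(lra)).
      specialize (L2 Hc2 ltac:(lra)).
      match goal with |- Cmod (?a - ?b - (?c - ?d)) < _ =>
        replace (a - b - (c - d))%C with ((a - c) + - (b - d))%C by ring end.
      eapply Rle_lt_trans; [apply Cmod_triangle|]. rewrite Cmod_opp. lra.
    + intros t Ht. eapply Rle_trans; [apply Cmod_le_sum|].
      specialize (K1 y t Hy Ht ltac:(lra)). specialize (K2 y t Hy Ht ltac:(lra)).
      simpl. unfold Rminus, Re, Im in *. lra.
    + unfold e. right. field. lra.
  - intros t _. now apply clamp_Rcont.
  - intros t _. now apply clamp_Rcont.
Qed.

Lemma circle_int_const (f : C -> C) (x y : R) : x <= y ->
  (forall s t, x <= s <= y -> cdiff f (Cexp (s, t))) ->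
  circle_int f x = circle_int f y.
Proof.
  intros Hxy Hf. pose proof two_PI_pos as P.
  assert (G : rect_int (fun w => f (Cexp w)) x y 0 (2 * PI) = RtoC 0).
  { apply goursat; try lra. intros s t Hs Ht.
    apply cdiff_comp; auto. apply cdiff_Cexp. }
  unfold rect_int in G.
  rewrite (Cint_ext (fun s => f (Cexp (s, 0))) (fun s => f (Cexp (s, 2 * PI)))) in G; auto.
  - change (Cint (fun s => f (Cexp (x, s))) 0 (2 * PI)) with (circle_int f x) in G.
    change (Cint (fun s => f (Cexp (y, s))) 0 (2 * PI)) with (circle_int f y) in G.
    assert (E : (Ci * (circle_int f y - circle_int f x))%C = RtoC 0)
      by (rewrite <- G; ring).
    assert (E' : (circle_int f y - circle_int f x)%C = RtoC 0).
    { replace (circle_int f y - circle_int f x)%C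
        with (- Ci * (Ci * (circle_int f y - circle_int f x)))%C.
      - rewrite E. ring.
      - rewrite Cmult_assoc. replace (- Ci * Ci)%C with (RtoC 1); [ring|].
        apply injective_projections; simpl; ring. }
    replace (circle_int f y) with (circle_int f y - circle_int f x + circle_int f x)%C by ring.
    rewrite E'. ring.
  - intros t _. f_equal. unfold Cexp. simpl. now rewrite cos_0, sin_0, cos_2PI, sin_2PI.
Qed.

(* Continuity suffices on one circle [|z| = rho]: the integral over circles is
   constant on either side of it and depends continuously on the radius. *)
Theorem mean_exterior (f : C -> C) (rho : R) (l : C) : 1 <= rho ->
  (forall z, outside z -> cont_within outside f z) ->
  (forall z, 1 < Cmod z -> Cmod z <> rho -> cdiff f z) ->
  lim_infinity f l -> mean f = l.
Proof.
  intros Hrho Cf Df Lf. pose proof two_PI_pos as P.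
  set (x0 := ln rho).
  assert (Ex : exp x0 = rho) by (apply exp_ln; lra).
  assert (Hx0 : 0 <= x0).
  { unfold x0. rewrite <- ln_1. destruct Hrho as [H|<-]; [left; apply ln_increasing; lra|lra]. }
  assert (D : forall s t, 0 < s -> s <> x0 -> cdiff f (Cexp (s, t))).
  { intros s t Hs N. apply Df; rewrite Cmod_Cexp; simpl.
    - rewrite <- exp_0. now apply exp_increasing.
    - rewrite <- Ex. intro E. apply N. now apply exp_inv. }
  assert (Z : circle_int f 0 = (RtoC (2 * PI) * l)%C).
  { assert (Q : forall eps, 0 < eps ->
      Cmod (circle_int f 0 - RtoC (2 * PI) * l) <= 5 * eps).
    { intros eps He.
      destruct (circle_int_continuous f x0 Hx0 Cf eps He) as [d [Hd K]].
      set (y1 := x0 + d / 2).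
      assert (H1 : Cmod (circle_int f y1 - circle_int f x0) <= eps).
      { apply K; unfold y1; [lra|]. rewrite Rabs_right; lra. }
      assert (H2 : Cmod (circle_int f y1 - RtoC (2 * PI) * l) <= eps).
      { destruct (Lf (eps / (2 * (2 * PI)))) as [r Hr].
        { apply Rdiv_lt_0_compat; lra. }
        set (y2 := Rmax y1 (Rmax r 1)).
        assert (R1 : y1 <= y2) by apply Rmax_l.
        assert (R2 : r <= y2) by (eapply Rle_trans; [apply (Rmax_l r 1)|apply Rmax_r]).
        rewrite (circle_int_const f y1 y2); auto.
        - replace (RtoC (2 * PI) * l)%C with (Cint (fun _ => l) 0 (2 * PI)).
          + unfold circle_int. rewrite <- Cint_minus; try lra.
            * eapply Rle_trans.
              -- apply Cint_bound with (B := eps / (2 * (2 * PI))); try lra.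
                 ++ intros t _. apply Rcont_intro. intros eta Heta.
                    destruct (clamp_continuous f y2 t Cf eta Heta) as [c [Hc L]].
                    exists c; split; auto. intros s Hs.
                    specialize (L y2 s). rewrite (Rmax_left y2 0) in L
                      by (unfold y1 in R1; lra).
                    replace (y2 - y2) with 0 in L by ring. rewrite Rabs_R0 in L.
                    replace (f (Cexp (y2, s)) - l - (f (Cexp (y2, t)) - l))%C
                      with (f (Cexp (y2, s)) - f (Cexp (y2, t)))%C by ring.
                    now apply L.
                 ++ intros t _. left. apply Hr. rewrite Cmod_Cexp. simpl.
                    pose proof (exp_ineq1_le y2). lra.
              -- right. field. lra.
            * intros t _. apply clamp_Rcont; auto. unfold y1 in R1. lra.
            * intros t _. apply Rcont_intro. intros eta Heta. exists 1; split; [lra|].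
              intros. replace (l - l)%C with (RtoC 0) by ring. now rewrite Cmod_0.
          + pose proof (f_equal (Cmult (RtoC (2 * PI))) (mean_const l)) as M.
            rewrite <- M. unfold mean. field. apply two_PI_neq_0.
        - intros s t Hs. apply D; unfold y1 in *; lra. }
      assert (H3 : Cmod (circle_int f 0 - circle_int f x0) <= 2 * eps).
      { destruct Hx0 as [Hx0|<-].
        - destruct (circle_int_continuous f 0 (Rle_refl 0) Cf eps He) as [d' [Hd' K']].
          set (y0 := x0 - Rmin (d / 2) (x0 / 2)).
          set (z0 := Rmin (d' / 2) y0).
          pose proof (Rmin_l (d / 2) (x0 / 2)). pose proof (Rmin_r (d / 2) (x0 / 2)).
          assert (0 < Rmin (d / 2) (x0 / 2)) by (apply Rmin_pos; lra).
          assert (Y : 0 < y0 < x0) by (unfold y0; lra).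
          assert (Z0 : 0 < z0) by (apply Rmin_pos; lra).
          assert (Z1 : z0 <= d' / 2) by apply Rmin_l.
          assert (Z2 : z0 <= y0) by apply Rmin_r.
          assert (A : Cmod (circle_int f y0 - circle_int f x0) <= eps).
          { apply K; [lra|]. unfold y0. rewrite Rabs_left; lra. }
          assert (B : Cmod (circle_int f z0 - circle_int f 0) <= eps).
          { apply K'; [lra|]. rewrite Rminus_0_r, Rabs_right; lra. }
          rewrite (circle_int_const f z0 y0) in B; auto.
          + replace (circle_int f 0 - circle_int f x0)%C with
              (- (circle_int f y0 - circle_int f 0) +
                 (circle_int f y0 - circle_int f x0))%C by ring.
            eapply Rle_trans; [apply Cmod_triangle|]. rewrite Cmod_opp. lra.
          + intros s t Hs. apply D; lra.
        - replace (circle_int f 0 - circle_int f 0)%C with (RtoC 0) by ring.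
          rewrite Cmod_0. lra. }
      replace (circle_int f 0 - RtoC (2 * PI) * l)%C with
        ((circle_int f 0 - circle_int f x0) + (- (circle_int f y1 - circle_int f x0)
          + (circle_int f y1 - RtoC (2 * PI) * l)))%C by ring.
      eapply Rle_trans; [apply Cmod_triangle|].
      eapply Rle_trans; [apply Rplus_le_compat_l, Cmod_triangle|].
      rewrite Cmod_opp. lra. }
    assert (Q0 : (circle_int f 0 - RtoC (2 * PI) * l)%C = RtoC 0).
    { apply Cmod_eq_0. apply Rle_antisym; [|apply Cmod_ge_0].
      apply le_epsilon. intros eps He. specialize (Q (eps / 5) ltac:(lra)). lra. }
    replace (circle_int f 0)
      with (circle_int f 0 - RtoC (2 * PI) * l + RtoC (2 * PI) * l)%C by ring.
    rewrite Q0. ring. }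
  unfold mean. change (Cint (fun t => f (cis t)) 0 (2 * PI)) with (circle_int f 0).
  rewrite Z. field. apply two_PI_neq_0.
Qed.

(** * Hardy functions outside the disc *)

Lemma circle_bounded (f : C -> C) : circle_cont f ->
  exists B, 0 <= B /\ forall t, turn t -> Cmod (f (cis t)) <= B.
Proof.
  intros Hf. pose proof two_PI_pos as P.
  set (g := fun t => Re (f (cis t) * Cconj (f (cis t)))).
  assert (E : forall t, g t = Cmod (f (cis t)) * Cmod (f (cis t))).
  { intros t. unfold g. rewrite <- Cmod2_conj. simpl. ring. }
  destruct (continuity_ab_maj g 0 (2 * PI)) as [M [HM _]]; [lra| |].
  - intros c _. apply continuity_pt_filterlim.
    apply (proj1 (circle_cont_Rcont _ c
      (circle_cont_mult _ _ Hf (circle_cont_conj _ Hf)))).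
  - exists (g M + 1). split.
    + rewrite E. nra.
    + intros t Ht. specialize (HM t Ht). rewrite E in HM at 1. nra.
Qed.

Lemma mean_square_0 (u : C -> C) : circle_cont u ->
  Re (mean (fun z => u z * Cconj (u z)))%C <= 0 ->
  forall t, turn t -> u (cis t) = RtoC 0.
Proof.
  intros Hu Hm t0 Ht0. apply NNPP. intro N. pose proof two_PI_pos as P.
  pose proof (proj1 (Cmod_gt_0 _) N) as Pu.
  set (g := fun t => Re (u (cis t) * Cconj (u (cis t)))).
  assert (E : forall t, g t = Cmod (u (cis t)) * Cmod (u (cis t))).
  { intros t. unfold g. rewrite <- Cmod2_conj. simpl. ring. }
  assert (Cg : forall t, continuous g t).
  { intros t. apply (proj1 (circle_cont_Rcont _ t
      (circle_cont_mult _ _ Hu (circle_cont_conj _ Hu)))). }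
  assert (Pg : 0 < g t0) by (rewrite E; nra).
  rewrite Re_mean in Hm. fold g in Hm.
  assert (I0 : RInt g 0 (2 * PI) <= 0).
  { apply Rmult_le_reg_r with (/ (2 * PI)); [now apply Rinv_0_lt_compat|].
    unfold Rdiv in Hm. lra. }
  assert (exists d, 0 < d /\ forall t, Rabs (t - t0) < d -> g t0 / 2 < g t) as [d [Hd K]].
  { assert (Q : 0 < g t0 / 2) by lra.
    destruct (proj1 (filterlim_locally _ _) (Cg t0) (mkposreal _ Q)) as [d K].
    exists d; split; [apply cond_pos|]. intros t Ht. specialize (K t Ht).
    unfold ball in K; simpl in K; unfold AbsRing_ball, abs, minus, plus, opp in K; simpl in K.
    apply Rabs_lt_between in K. lra. }
  destruct Ht0 as [H1 H2].
  set (p := Rmax 0 (t0 - d / 2)). set (q := Rmin (2 * PI) (t0 + d / 2)).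
  assert (Hp : 0 <= p /\ t0 - d / 2 <= p /\ p <= t0)
    by (unfold p, Rmax; destruct (Rle_dec _ _); lra).
  assert (Hq : q <= 2 * PI /\ q <= t0 + d / 2 /\ t0 <= q)
    by (unfold q, Rmin; destruct (Rle_dec _ _); lra).
  assert (Hpq : p < q).
  { unfold p, q, Rmax, Rmin. destruct (Rle_dec _ _), (Rle_dec _ _); lra. }
  assert (Ex : forall a b, ex_RInt g a b)
    by (intros; apply (ex_RInt_continuous (V := R_CompleteNormedModule)); auto).
  assert (C1 : RInt g 0 p + RInt g p (2 * PI) = RInt g 0 (2 * PI))
    by (apply (RInt_Chasles (V := R_CompleteNormedModule)); auto).
  assert (C2 : RInt g p q + RInt g q (2 * PI) = RInt g p (2 * PI))
    by (apply (RInt_Chasles (V := R_CompleteNormedModule)); auto).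
  assert (G0 : forall t, 0 <= g t) by (intros; rewrite E; apply Rle_0_sqr).
  assert (0 <= RInt g 0 p) by (apply RInt_ge_0; auto; lra).
  assert (0 <= RInt g q (2 * PI)) by (apply RInt_ge_0; auto; lra).
  assert ((q - p) * (g t0 / 2) <= RInt g p q).
  { replace ((q - p) * (g t0 / 2)) with (RInt (fun _ => g t0 / 2) p q)
      by (rewrite RInt_const; reflexivity).
    apply RInt_le; auto; [lra|apply ex_RInt_const|].
    intros t Ht. left. apply K. apply Rabs_lt_between. lra. }
  assert (0 < (q - p) * (g t0 / 2)) by (apply Rmult_lt_0_compat; lra).
  lra.
Qed.

Lemma cont_within_local (D : C -> Prop) (f g : C -> C) (z : C) (d : R) :
  0 < d -> D z -> (forall w, D w -> Cmod (w - z) < d -> f w = g w) ->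
  cont_within D f z -> cont_within D g z.
Proof.
  intros Hd Dz H Hf eps He. destruct (Hf eps He) as [e [He' K]].
  exists (Rmin d e); split; [now apply Rmin_pos|]. intros w Dw Hw.
  rewrite <- !H; auto.
  - apply K; auto. eapply Rlt_le_trans; [apply Hw|apply Rmin_r].
  - replace (z - z)%C with (RtoC 0) by ring. now rewrite Cmod_0.
  - eapply Rlt_le_trans; [apply Hw|apply Rmin_l].
Qed.

Definition chart_infinity (f : C -> C) (l w : C) : C :=
  if Ceq_dec w 0 then l else f (/ w)%C.

Lemma lim_infinity_chart (f : C -> C) (l : C) :
  lim_infinity f l <-> cont_at (chart_infinity f l) 0.
Proof.
  unfold chart_infinity. split.
  - intros H eps He. destruct (H eps He) as [r Hr].
    assert (Pr : 0 < Rmax r 1) by (eapply Rlt_le_trans; [|apply Rmax_r]; lra).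
    exists (/ Rmax r 1); split; [now apply Rinv_0_lt_compat|].
    intros w _ Hw. destruct (Ceq_dec 0 0); [|easy].
    destruct (Ceq_dec w 0) as [_|N].
    + replace (l - l)%C with (RtoC 0) by ring. now rewrite Cmod_0.
    + apply Hr. rewrite Cmod_inv by auto. replace (w - 0)%C with w in Hw by ring.
      pose proof (proj1 (Cmod_gt_0 w) N). eapply Rle_lt_trans; [apply (Rmax_l r 1)|].
      rewrite <- (Rinv_inv (Rmax r 1)). apply Rinv_lt_contravar; auto.
      apply Rmult_lt_0_compat; auto. now apply Rinv_0_lt_compat.
  - intros H eps He. destruct (H eps He) as [d [Hd K]].
    exists (/ d). intros z Hz.
    assert (Pd : 0 < / d) by now apply Rinv_0_lt_compat.
    assert (N : z <> RtoC 0) by (apply Cmod_gt_0; lra).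
    assert (N' : (/ z)%C <> RtoC 0).
    { apply Cmod_gt_0. rewrite Cmod_inv by auto. apply Rinv_0_lt_compat; lra. }
    specialize (K (/ z)%C I). destruct (Ceq_dec 0 0); [|easy].
    destruct (Ceq_dec (/ z) 0); [easy|].
    replace (/ / z)%C with z in K by (field; auto). apply K.
    replace (/ z - 0)%C with (/ z)%C by ring. rewrite Cmod_inv by auto.
    rewrite <- (Rinv_inv d). apply Rinv_lt_contravar; auto.
    apply Rmult_lt_0_compat; lra.
Qed.

Lemma lim_infinity_op (op : C -> C -> C) (f g : C -> C) (l m : C) :
  (forall u v, cont_at u 0 -> cont_at v 0 -> cont_at (fun w => op (u w) (v w)) 0) ->
  lim_infinity f l -> lim_infinity g m -> lim_infinity (fun z => op (f z) (g z)) (op l m).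
Proof.
  intros Hop. rewrite !lim_infinity_chart. intros Hf Hg.
  apply cont_within_ext with
    (f := fun w => op (chart_infinity f l w) (chart_infinity g m w)).
  - intros w _. unfold chart_infinity. now destruct (Ceq_dec w 0).
  - exact I.
  - now apply Hop.
Qed.

Lemma lim_infinity_const (k : C) : lim_infinity (fun _ => k) k.
Proof.
  intros eps He. exists 0. intros. replace (k - k)%C with (RtoC 0) by ring.
  now rewrite Cmod_0.
Qed.

Lemma lim_infinity_ext (f g : C -> C) (l : C) (r : R) :
  (forall z, r < Cmod z -> f z = g z) -> lim_infinity f l -> lim_infinity g l.
Proof.
  intros H Hf eps He. destruct (Hf eps He) as [s Hs]. exists (Rmax r s). intros z Hz.
  rewrite <- H; [apply Hs|]; (eapply Rle_lt_trans; [|exact Hz]); [apply Rmax_r|apply Rmax_l].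
Qed.

Lemma lim_infinity_inv_affine (k c : C) : c <> RtoC 0 ->
  lim_infinity (fun z => / (k + c * z))%C 0.
Proof.
  intros Hc eps He. pose proof (proj1 (Cmod_gt_0 c) Hc) as P.
  exists ((/ eps + Cmod k) / Cmod c). intros z Hz.
  assert (Pe : 0 < / eps) by now apply Rinv_0_lt_compat.
  assert (H : / eps < Cmod (k + c * z)).
  { pose proof (Cmod_ge_minus (c * z) (- k)) as T.
    rewrite Cmod_opp, Cmod_mult in T. replace (c * z - - k)%C with (k + c * z)%C in T by ring.
    apply (Rmult_lt_compat_r (Cmod c)) in Hz; auto.
    unfold Rdiv in Hz. rewrite Rmult_assoc, Rinv_l in Hz by lra. lra. }
  replace (/ (k + c * z) - 0)%C with (/ (k + c * z))%C by ring.
  rewrite Cmod_inv by (apply Cmod_gt_0; lra).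
  rewrite <- (Rinv_inv eps). apply Rinv_lt_contravar; auto.
  apply Rmult_lt_0_compat; lra.
Qed.

Definition hardy (f : C -> C) (l : C) : Prop :=
  (forall z, 1 < Cmod z -> cdiff f z) /\
  (forall z, Cmod z = 1 -> cont_within outside f z) /\ lim_infinity f l.

Lemma hardy_cont (f : C -> C) (l : C) : hardy f l ->
  forall z, outside z -> cont_within outside f z.
Proof.
  intros [H [K _]] z [Hz|Hz]; auto. now apply cont_at_within, cdiff_cont, H.
Qed.

Lemma hardy_circle_cont (f : C -> C) (l : C) : hardy f l -> circle_cont f.
Proof.
  intros [_ [K _]] z Hz. apply cont_within_mono with (D := outside); auto.
  intros w Hw. unfold outside. lra.
Qed.

Lemma hardy_mean (f : C -> C) (l : C) : hardy f l -> mean f = l.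
Proof.
  intros H. apply mean_exterior with (rho := 1); [lra| | |apply H].
  - now apply hardy_cont with l.
  - intros z Hz _. now apply H.
Qed.

Lemma hardy_const (k : C) : hardy (fun _ => k) k.
Proof.
  repeat split.
  - intros; apply cdiff_const.
  - intros; apply cont_within_const.
  - apply lim_infinity_const.
Qed.

Lemma hardy_plus (f g : C -> C) (l m : C) : hardy f l -> hardy g m ->
  hardy (fun z => f z + g z)%C (l + m)%C.
Proof.
  intros [F1 [F2 F3]] [G1 [G2 G3]]. repeat split.
  - intros; apply cdiff_plus; auto.
  - intros; apply cont_within_plus; auto.
  - apply (lim_infinity_op Cplus); auto. intros; now apply cont_within_plus.
Qed.

Lemma hardy_mult (f g : C -> C) (l m : C) : hardy f l -> hardy g m ->
  hardy (fun z => f z * g z)%C (l * m)%C.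
Proof.
  intros [F1 [F2 F3]] [G1 [G2 G3]]. repeat split.
  - intros; apply cdiff_mult; auto.
  - intros; apply cont_within_mult; auto.
  - apply (lim_infinity_op Cmult); auto. intros; now apply cont_within_mult.
Qed.

Lemma hardy_opp (f : C -> C) (l : C) : hardy f l -> hardy (fun z => - f z)%C (- l)%C.
Proof.
  intros [F1 [F2 F3]]. repeat split.
  - intros; apply cdiff_opp; auto.
  - intros; apply cont_within_opp; auto.
  - apply (lim_infinity_op (fun x _ => - x)%C f f l l); auto.
    intros; now apply cont_within_opp.
Qed.

Lemma hardy_minus (f g : C -> C) (l m : C) : hardy f l -> hardy g m ->
  hardy (fun z => f z - g z)%C (l - m)%C.
Proof. intros. now apply hardy_plus, hardy_opp. Qed.

Lemma hardy_conj_conj (f : C -> C) (l : C) : hardy f l ->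
  hardy (fun z => Cconj (f (Cconj z))) (Cconj l).
Proof.
  intros [F1 [F2 F3]]. repeat split.
  - intros. apply cdiff_conj_conj, F1. now rewrite Cmod_conj.
  - intros z Hz. apply cont_within_conj.
    apply cont_within_comp with (E := outside).
    + intros w Hw. unfold outside. now rewrite Cmod_conj.
    + apply F2. now rewrite Cmod_conj.
    + apply cont_within_conj, cont_within_id.
  - intros eps He. destruct (F3 eps He) as [r Hr]. exists r. intros z Hz.
    rewrite <- Cconj_minus, Cmod_conj. apply Hr. now rewrite Cmod_conj.
Qed.

Lemma hardy_reflect (h : C -> C) : (forall z, Cmod z < 1 -> cdiff h z) ->
  (forall z, Cmod z = 1 -> cont_within (fun w => Cmod w <= 1) h z) ->
  hardy (fun z => Cconj (h (/ Cconj z)%C)) (Cconj (h 0)).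
Proof.
  intros H K.
  assert (I1 : forall z, 1 <= Cmod z -> z <> RtoC 0) by (intros; apply Cmod_gt_0; lra).
  repeat split.
  - intros z Hz. apply (cdiff_conj_conj (fun w => h (/ w)%C)).
    rewrite <- (Cmod_conj z) in Hz. set (y := Cconj z) in *. clearbody y.
    assert (N : y <> RtoC 0) by (apply I1; lra).
    apply cdiff_comp with (g := fun w => (/ w)%C).
    + apply H. rewrite Cmod_inv by auto. rewrite <- Rinv_1.
      apply Rinv_lt_contravar; lra.
    + now apply cdiff_inv.
  - intros z Hz. apply cont_within_conj.
    rewrite <- (Cmod_conj z) in Hz.
    apply cont_within_comp with (E := outside) (f := fun w => h (/ w)%C).
    + intros w Hw. unfold outside. now rewrite Cmod_conj.
    + set (y := Cconj z) in *. clearbody y. assert (N : y <> RtoC 0) by (apply I1; lra).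
      apply cont_within_comp with (E := fun w => Cmod w <= 1) (g := fun w => (/ w)%C).
      * intros w Hw. rewrite Cmod_inv by now apply I1.
        rewrite <- Rinv_1. apply Rinv_le_contravar; [lra|auto].
      * apply K. rewrite Cmod_inv, Hz, Rinv_1 by auto. reflexivity.
      * now apply cont_at_within, cont_at_inv.
    + apply cont_within_conj, cont_within_id.
  - assert (C0 : cont_at h 0) by (apply cdiff_cont, H; rewrite Cmod_0; lra).
    intros eps He. destruct (C0 eps He) as [d [Hd L]].
    exists (/ d). intros z Hz. assert (Pd : 0 < / d) by now apply Rinv_0_lt_compat.
    rewrite <- Cconj_minus, Cmod_conj. apply L; auto.
    rewrite <- (Cmod_conj z) in Hz. set (y := Cconj z) in *. clearbody y.
    replace (/ y - 0)%C with (/ y)%C by ring.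
    rewrite Cmod_inv by (apply Cmod_gt_0; lra).
    rewrite <- (Rinv_inv d). apply Rinv_lt_contravar; auto.
    apply Rmult_lt_0_compat; lra.
Qed.

Lemma hardy_inv : hardy (fun z => / z)%C 0.
Proof.
  repeat split.
  - intros z Hz. apply cdiff_inv, Cmod_gt_0. lra.
  - intros z Hz. apply cont_at_within, cont_at_inv, Cmod_gt_0. lra.
  - apply lim_infinity_ext with (f := fun z => (/ (0 + 1 * z))%C) (r := 0).
    + intros; f_equal; ring.
    + apply lim_infinity_inv_affine. apply RtoC_neq_0; lra.
Qed.

Lemma mean_conj_hardy (f g : C -> C) (l : C) : hardy g l ->
  (forall t, turn t -> f (cis t) = Cconj (g (cis t))) -> mean f = Cconj l.
Proof.
  intros Hg H. rewrite (mean_ext f (fun z => Cconj (g z))) by auto.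
  rewrite mean_conj by (eapply hardy_circle_cont, Hg).
  now rewrite (hardy_mean g l).
Qed.

Lemma Cconj_RtoC (x : R) : Cconj (RtoC x) = RtoC x.
Proof. apply injective_projections; simpl; ring. Qed.

Lemma Cinv_cis (t : R) : (/ cis t)%C = Cconj (cis t).
Proof. symmetry. apply Cconj_unit, Cmod_cis. Qed.

(* [f] extends analytically to both sides of the circle, so this is
   Liouville's theorem; orthogonality of the two Hardy spaces replaces it. *)
Lemma hardy_liouville (f g : C -> C) (l m : C) : hardy f l -> hardy g m ->
  (forall t, turn t -> f (cis t) = Cconj (g (cis t))) ->
  forall t, turn t -> f (cis t) = l.
Proof.
  intros Hf Hg H.
  assert (Hu : hardy (fun z => f z - l)%C (l - l)%C)
    by (apply hardy_minus; auto; apply hardy_const).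
  assert (Hv : hardy (fun z => g z - Cconj l)%C (m - Cconj l)%C)
    by (apply hardy_minus; auto; apply hardy_const).
  pose proof (hardy_mean _ _ (hardy_mult _ _ _ _ Hu Hv)) as M.
  assert (Z : forall t, turn t -> (f (cis t) - l)%C = RtoC 0).
  { apply (mean_square_0 (fun z => f z - l)%C).
    - eapply hardy_circle_cont, Hu.
    - right. rewrite (mean_ext _ (fun z => (f z - l) * (g z - Cconj l))%C).
      + rewrite M. replace (l - l)%C with (RtoC 0) by ring. rewrite Cmult_0_l. reflexivity.
      + intros t Ht. f_equal. rewrite Cconj_minus, H, Cconj_conj by auto. reflexivity. }
  intros t Ht. replace (f (cis t)) with (f (cis t) - l + l)%C by ring.
  rewrite Z by auto. ring.
Qed.

Lemma cauchy_exterior (g : C -> C) (z : C) : hardy g 0 -> 1 < Cmod z ->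
  (z * g z)%C = mean (fun w => w * g w * (z / (z - w)))%C.
Proof.
  intros Hg Hz. pose proof Hg as [G1 [G2 G3]].
  destruct (G1 z Hz) as [q [Cq Hq]].
  assert (Nz : forall w, w <> z -> (w - z)%C <> RtoC 0).
  { intros w N E. apply N. replace w with (w - z + z)%C by ring. rewrite E. ring. }
  assert (Q : forall w, w <> z -> q w = ((g w - g z) / (w - z))%C).
  { intros w N. rewrite (Hq w). field. auto. }
  assert (Far : forall w y, w <> z -> Cmod (y - w) < Cmod (w - z) -> y <> z).
  { intros w y _ Hy ->. rewrite Cmod_minus_sym in Hy. lra. }
  assert (Dq : forall w, 1 < Cmod w -> w <> z -> cdiff q w).
  { intros w Hw N.
    apply cdiff_local with (f := fun y => ((g y - g z) * / (y - z))%C) (d := Cmod (w - z)).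
    - now apply Cmod_gt_0, Nz.
    - intros y Hy. symmetry. apply Q. now apply Far with w.
    - apply cdiff_mult.
      + apply cdiff_minus; auto. apply cdiff_const.
      + apply cdiff_comp with (f := fun y => (/ y)%C).
        * now apply cdiff_inv, Nz.
        * apply cdiff_minus; [apply cdiff_id|apply cdiff_const]. }
  assert (Kq : forall w, outside w -> cont_within outside q w).
  { intros w Hw. destruct (Ceq_dec w z) as [->|N].
    - now apply cont_at_within.
    - apply cont_within_local with (f := fun y => ((g y - g z) * / (y - z))%C)
        (d := Cmod (w - z)); auto.
      + now apply Cmod_gt_0, Nz.
      + intros y _ Hy. symmetry. apply Q. now apply Far with w.
      + apply cont_within_mult.
        * apply cont_within_minus; [eapply hardy_cont; eauto|apply cont_within_const].
        * apply cont_within_comp with (E := fun _ => True) (f := fun y => (/ y)%C); auto.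
          -- now apply cont_at_inv, Nz.
          -- apply cont_within_minus; [apply cont_within_id|apply cont_within_const]. }
  assert (Linv : lim_infinity (fun w => / (w - z))%C 0).
  { apply lim_infinity_ext with (f := fun w => (/ (- z + 1 * w))%C) (r := 0).
    - intros; f_equal; ring.
    - apply lim_infinity_inv_affine. apply RtoC_neq_0; lra. }
  assert (M1 : mean (fun w => w * q w)%C = (- g z)%C).
  { apply mean_exterior with (rho := Cmod z); [lra| | |].
    - intros w Hw. apply cont_within_mult; [apply cont_within_id|auto].
    - intros w Hw N. apply cdiff_mult; [apply cdiff_id|]. apply Dq; auto.
      intros ->. auto.
    - replace (- g z)%C with ((1 + z * 0) * (0 - g z))%C by ring.
      apply lim_infinity_ext with
        (f := fun w => ((1 + z * / (w - z)) * (g w - g z))%C) (r := Cmod z).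
      + intros w Hw. assert (N : w <> z) by (intros ->; lra).
        rewrite Q by auto. field. auto.
      + apply (lim_infinity_op Cmult (fun w => 1 + z * / (w - z))%C).
        { intros; now apply cont_within_mult. }
        * apply (lim_infinity_op Cplus (fun _ => RtoC 1)).
          { intros; now apply cont_within_plus. }
          { apply lim_infinity_const. }
          apply (lim_infinity_op Cmult (fun _ => z)); auto.
          { intros; now apply cont_within_mult. }
          apply lim_infinity_const.
        * apply (lim_infinity_op Cminus g (fun _ => g z)); auto.
          { intros; now apply cont_within_minus. }
          apply lim_infinity_const. }
  assert (Pz : z <> RtoC 0) by (apply Cmod_gt_0; lra).
  assert (Pz' : Cconj z <> RtoC 0) by (apply Cmod_gt_0; rewrite Cmod_conj; lra).
  assert (Nw : forall w, Cmod w = 1 -> w <> z) by (intros w Hw ->; lra).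
  assert (N1 : forall w, 1 <= Cmod w -> (1 + - Cconj z * w)%C <> RtoC 0).
  { intros w Hw E. assert (E' : (Cconj z * w)%C = RtoC 1).
    { replace (Cconj z * w)%C with (1 - (1 + - Cconj z * w))%C by ring. rewrite E. ring. }
    apply (f_equal Cmod) in E'. rewrite Cmod_mult, Cmod_conj, Cmod_1 in E'. nra. }
  assert (Hr : hardy (fun w => / (1 + - Cconj z * w))%C 0).
  { assert (Cd : forall w, 1 <= Cmod w -> cdiff (fun w => / (1 + - Cconj z * w))%C w).
    { intros w Hw. apply cdiff_comp with (f := fun y => (/ y)%C).
      - now apply cdiff_inv, N1.
      - apply cdiff_plus; [apply cdiff_const|].
        apply cdiff_mult; [apply cdiff_const|apply cdiff_id]. }
    repeat split.
    - intros w Hw. apply Cd. lra.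
    - intros w Hw. apply cont_at_within, cdiff_cont, Cd. lra.
    - apply lim_infinity_inv_affine. apply Cmod_gt_0. rewrite Cmod_opp, Cmod_conj. lra. }
  assert (Cz : circle_cont (fun w => / (w - z))%C).
  { intros w Hw. apply cont_within_comp with (E := fun _ => True) (f := fun y => (/ y)%C); auto.
    - now apply cont_at_inv, Nz, Nw.
    - apply cont_within_minus; [apply cont_within_id|apply cont_within_const]. }
  assert (M2 : mean (fun w => w * / (w - z))%C = RtoC 0).
  { rewrite (mean_conj_hardy _ (fun w => / (1 + - Cconj z * w))%C 0 Hr).
    - apply Cconj_RtoC.
    - intros t _. pose proof (Cmod_cis t) as Ht.
      rewrite Cinv_conj by (apply N1; lra).
      rewrite Cplus_conj, Cmult_conj, <- Cinv_cis, Cconj_RtoC.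
      replace (Cconj (- Cconj z)) with (- z)%C
        by (apply injective_projections; simpl; ring).
      pose proof (cis_neq_0 t). field. split; auto.
      apply Nz, Nw, Ht. }
  assert (Cg : circle_cont g) by (eapply hardy_circle_cont, Hg).
  assert (M3 : mean (fun w => w * g w * / (w - z))%C = (- g z)%C).
  { rewrite <- M1. rewrite (mean_ext (fun w => w * q w)%C
      (fun w => w * g w * / (w - z) - g z * (w * / (w - z)))%C).
    - rewrite mean_minus, mean_scal, M2.
      + ring.
      + apply circle_cont_mult; auto using circle_cont_id.
      + apply circle_cont_mult; auto.
        apply circle_cont_mult; auto using circle_cont_id.
      + apply circle_cont_mult; auto using circle_cont_const.
        apply circle_cont_mult; auto using circle_cont_id.
    - intros t _. pose proof (Nw _ (Cmod_cis t)). rewrite Q by auto. field. auto. }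
  rewrite (mean_ext _ (fun w => - z * (w * g w * / (w - z)))%C).
  - rewrite mean_scal, M3.
    + ring.
    + apply circle_cont_mult; auto.
      apply circle_cont_mult; auto using circle_cont_id.
  - intros t _. pose proof (Nw _ (Cmod_cis t)) as N.
    assert (N' : (z - cis t)%C <> RtoC 0).
    { intro E. apply N. replace (cis t) with (z - (z - cis t))%C by ring. rewrite E. ring. }
    field. auto.
Qed.

Lemma mean_id : mean (fun z => z) = RtoC 0.
Proof.
  rewrite (mean_conj_hardy _ (fun z => / z)%C 0 hardy_inv).
  - apply Cconj_RtoC.
  - intros t _. now rewrite Cinv_cis, Cconj_conj.
Qed.

Lemma hardy_shift (f : C -> C) (l : C) : hardy f l ->
  hardy (fun z => z * (f z - l))%C (mean (fun z => z * f z)%C).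
Proof.
  intros Hf.
  assert (Hg : hardy (fun z => f z - l)%C 0).
  { replace (RtoC 0) with (l - l)%C by ring. apply hardy_minus; auto. apply hardy_const. }
  set (g := fun z => (f z - l)%C) in *.
  assert (Cf : circle_cont f) by (eapply hardy_circle_cont, Hf).
  assert (Cg : circle_cont g) by (eapply hardy_circle_cont, Hg).
  assert (Cwg : circle_cont (fun w => w * g w)%C)
    by (apply circle_cont_mult; auto using circle_cont_id).
  assert (E : mean (fun z => z * f z)%C = mean (fun z => z * g z)%C).
  { rewrite (mean_ext (fun z => z * g z)%C (fun z => z * f z - l * z)%C).
    - rewrite mean_minus, mean_scal, mean_id; auto using circle_cont_id.
      + ring.
      + apply circle_cont_mult; auto using circle_cont_id.
      + apply circle_cont_mult; auto using circle_cont_id, circle_cont_const.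
    - intros; unfold g; ring. }
  rewrite E. repeat split.
  - intros z Hz. apply cdiff_mult; [apply cdiff_id|now apply Hg].
  - intros z Hz. apply cont_within_mult; [apply cont_within_id|now apply Hg].
  - destruct (circle_bounded g Cg) as [B [HB Bg]].
    intros eps He. exists (1 + 2 * (B + 1) / eps). intros z Hz.
    assert (Pe : 0 < 2 * (B + 1) / eps) by (apply Rdiv_lt_0_compat; lra).
    change (z * (f z - l))%C with (z * g z)%C.
    rewrite cauchy_exterior by (auto; lra).
    assert (Nw : forall w, Cmod w = 1 -> (z - w)%C <> RtoC 0).
    { intros w Hw E'. assert (z = w) by
        (replace z with (z - w + w)%C by ring; rewrite E'; ring).
      subst. lra. }
    assert (Cz : circle_cont (fun w => / (z - w))%C).
    { intros w Hw.
      apply cont_within_comp with (E := fun _ => True) (f := fun y => (/ y)%C); auto.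
      - now apply cont_at_inv, Nw.
      - apply cont_within_minus; [apply cont_within_const|apply cont_within_id]. }
    rewrite <- mean_minus; auto.
    + apply Rle_lt_trans with (2 * Re (mean (fun _ => RtoC (B / (Cmod z - 1))))).
      * apply Cmod_mean_le; auto using circle_cont_const.
        -- apply circle_cont_minus; auto. apply circle_cont_mult; auto.
           apply circle_cont_mult; auto using circle_cont_const.
        -- intros t Ht. pose proof (Cmod_cis t) as C1. pose proof (Nw _ C1) as N.
           replace (cis t * g (cis t) * (z / (z - cis t)) - cis t * g (cis t))%C
             with (cis t * g (cis t) * (cis t * / (z - cis t)))%C by (field; auto).
           rewrite !Cmod_mult, C1, Cmod_inv by auto.
           rewrite !Rmult_1_l. simpl.
           unfold Rdiv. apply Rmult_le_compat; auto using Cmod_ge_0.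
           ++ left. apply Rinv_0_lt_compat, Cmod_gt_0. auto.
           ++ apply Rinv_le_contravar; [lra|].
              pose proof (Cmod_ge_minus z (cis t)). lra.
      * rewrite mean_const. simpl.
        apply Rmult_lt_reg_r with (Cmod z - 1); [lra|].
        replace (2 * (B / (Cmod z - 1)) * (Cmod z - 1)) with (2 * B) by (field; lra).
        apply Rlt_le_trans with (eps * (2 * (B + 1) / eps)).
        -- replace (eps * (2 * (B + 1) / eps)) with (2 * (B + 1)) by (field; lra). lra.
        -- apply Rmult_le_compat_l; lra.
    + apply circle_cont_mult; auto.
      apply circle_cont_mult; auto using circle_cont_const.
Qed.

(** * Matrix factorizations on the circle *)

Record cmat := CM { c11 : C; c12 : C; c21 : C; c22 : C }.

Definition cmul (A B : cmat) : cmat :=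
  CM (c11 A * c11 B + c12 A * c21 B) (c11 A * c12 B + c12 A * c22 B)
     (c21 A * c11 B + c22 A * c21 B) (c21 A * c12 B + c22 A * c22 B).

Definition cadj (A : cmat) : cmat := CM (c22 A) (- c12 A) (- c21 A) (c11 A).

Definition cdet (A : cmat) : C := (c11 A * c22 A - c12 A * c21 A)%C.

Definition cmconj (A : cmat) : cmat :=
  CM (Cconj (c11 A)) (Cconj (c12 A)) (Cconj (c21 A)) (Cconj (c22 A)).

Definition cdiag (a b : C) : cmat := CM a 0 0 b.

Definition cid : cmat := cdiag 1 1.

Definition csigma : cmat := cdiag 1 (- (1))%C.

Lemma cmat_ext (A B : cmat) : c11 A = c11 B -> c12 A = c12 B -> c21 A = c21 B ->
  c22 A = c22 B -> A = B.
Proof. destruct A, B; simpl; intros; subst; auto. Qed.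

Ltac cmat_ring := intros; apply cmat_ext;
  unfold cmul, cadj, cdet, cid, csigma, cdiag; cbn [c11 c12 c21 c22]; ring.

Lemma cmul_assoc (A B M : cmat) : cmul A (cmul B M) = cmul (cmul A B) M.
Proof. cmat_ring. Qed.

Lemma cmul_1_l (A : cmat) : cmul cid A = A.
Proof. cmat_ring. Qed.

Lemma cmul_1_r (A : cmat) : cmul A cid = A.
Proof. cmat_ring. Qed.

Lemma cadj_mul (A B : cmat) : cadj (cmul A B) = cmul (cadj B) (cadj A).
Proof. cmat_ring. Qed.

Lemma cdet_mul (A B : cmat) : cdet (cmul A B) = (cdet A * cdet B)%C.
Proof. unfold cdet, cmul; cbn [c11 c12 c21 c22]; ring. Qed.

Lemma cmul_adj_r (A : cmat) : cdet A = RtoC 1 -> cmul A (cadj A) = cid.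
Proof.
  intros H. transitivity (cdiag (cdet A) (cdet A)); [cmat_ring|]. now rewrite H.
Qed.

Lemma cmul_adj_l (A : cmat) : cdet A = RtoC 1 -> cmul (cadj A) A = cid.
Proof.
  intros H. transitivity (cdiag (cdet A) (cdet A)); [cmat_ring|]. now rewrite H.
Qed.

Lemma cmconj_mul (A B : cmat) : cmconj (cmul A B) = cmul (cmconj A) (cmconj B).
Proof.
  apply cmat_ext; unfold cmconj, cmul; cbn [c11 c12 c21 c22];
    now rewrite Cplus_conj, !Cmult_conj.
Qed.

Lemma Cconj_opp (z : C) : Cconj (- z) = (- Cconj z)%C.
Proof. apply injective_projections; simpl; ring. Qed.

Lemma cmconj_adj (A : cmat) : cmconj (cadj A) = cadj (cmconj A).
Proof.
  apply cmat_ext; unfold cmconj, cadj; cbn [c11 c12 c21 c22]; auto using Cconj_opp.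
Qed.

Lemma cdet_conj (A : cmat) : cdet (cmconj A) = Cconj (cdet A).
Proof.
  unfold cdet, cmconj; cbn [c11 c12 c21 c22]. now rewrite Cconj_minus, !Cmult_conj.
Qed.

Definition entrywise (Q : (C -> C) -> Prop) (p : C -> cmat) : Prop :=
  Q (fun z => c11 (p z)) /\ Q (fun z => c12 (p z)) /\
  Q (fun z => c21 (p z)) /\ Q (fun z => c22 (p z)).

Definition hardy_mat (p : C -> cmat) (L : cmat) : Prop :=
  hardy (fun z => c11 (p z)) (c11 L) /\ hardy (fun z => c12 (p z)) (c12 L) /\
  hardy (fun z => c21 (p z)) (c21 L) /\ hardy (fun z => c22 (p z)) (c22 L).

Lemma hardy_mat_cont (p : C -> cmat) (L : cmat) :
  hardy_mat p L -> entrywise circle_cont p.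
Proof.
  intros [H1 [H2 [H3 H4]]]. repeat split; eapply hardy_circle_cont; eauto.
Qed.

Lemma hardy_mat_const (A : cmat) : hardy_mat (fun _ => A) A.
Proof. repeat split; apply hardy_const. Qed.

Lemma hardy_mat_mul (p q : C -> cmat) (L M : cmat) : hardy_mat p L -> hardy_mat q M ->
  hardy_mat (fun z => cmul (p z) (q z)) (cmul L M).
Proof.
  intros [H1 [H2 [H3 H4]]] [K1 [K2 [K3 K4]]]. unfold hardy_mat, cmul.
  cbn [c11 c12 c21 c22].
  split; [|split; [|split]]; apply hardy_plus; now apply hardy_mult.
Qed.

Lemma hardy_mat_adj (p : C -> cmat) (L : cmat) : hardy_mat p L ->
  hardy_mat (fun z => cadj (p z)) (cadj L).
Proof.
  intros [H1 [H2 [H3 H4]]]. unfold hardy_mat, cadj. cbn [c11 c12 c21 c22].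
  split; [|split; [|split]]; auto; now apply hardy_opp.
Qed.

Lemma hardy_mat_det (p : C -> cmat) (L : cmat) : hardy_mat p L ->
  hardy (fun z => cdet (p z)) (cdet L).
Proof.
  intros [H1 [H2 [H3 H4]]]. unfold cdet. apply hardy_minus; now apply hardy_mult.
Qed.

Lemma cont_mat_mul (p q : C -> cmat) : entrywise circle_cont p ->
  entrywise circle_cont q -> entrywise circle_cont (fun z => cmul (p z) (q z)).
Proof.
  intros [H1 [H2 [H3 H4]]] [K1 [K2 [K3 K4]]]. unfold entrywise, cmul.
  cbn [c11 c12 c21 c22].
  split; [|split; [|split]]; apply circle_cont_plus; now apply circle_cont_mult.
Qed.

Lemma cont_mat_adj (p : C -> cmat) : entrywise circle_cont p ->
  entrywise circle_cont (fun z => cadj (p z)).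
Proof.
  intros [H1 [H2 [H3 H4]]]. unfold entrywise, cadj. cbn [c11 c12 c21 c22].
  split; [|split; [|split]]; auto; now apply circle_cont_opp.
Qed.

Lemma cont_mat_conj (p : C -> cmat) : entrywise circle_cont p ->
  entrywise circle_cont (fun z => cmconj (p z)).
Proof.
  intros [H1 [H2 [H3 H4]]]. unfold entrywise, cmconj. cbn [c11 c12 c21 c22].
  split; [|split; [|split]]; now apply circle_cont_conj.
Qed.

Lemma cont_mat_diag (f g : C -> C) : circle_cont f -> circle_cont g ->
  entrywise circle_cont (fun z => cdiag (f z) (g z)).
Proof.
  intros Hf Hg. unfold entrywise, cdiag. cbn [c11 c12 c21 c22].
  split; [|split; [|split]]; auto; apply circle_cont_const.
Qed.

(* [p] is the exterior factor; the interior one is the conjugate, on the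
   circle, of [k], which is the Schwarz reflection of a function analytic
   inside. *)
Definition factorization (v p k : C -> cmat) : Prop :=
  hardy_mat p cid /\ (exists L, hardy_mat k L) /\
  forall t, turn t -> p (cis t) = cmul (cmconj (k (cis t))) (v (cis t)).

Lemma cdet_cid : cdet cid = RtoC 1.
Proof. unfold cdet, cid, cdiag; simpl. apply injective_projections; simpl; ring. Qed.

Section Factorization.

Variables (v : C -> cmat).
Hypothesis det_v : forall t, turn t -> cdet (v (cis t)) = RtoC 1.

Lemma factorization_det (p k : C -> cmat) : factorization v p k ->
  forall t, turn t -> cdet (p (cis t)) = RtoC 1 /\ cdet (cmconj (k (cis t))) = RtoC 1.
Proof.
  intros [Hp [[L Hk] H]].
  assert (E : forall t, turn t -> cdet (p (cis t)) = Cconj (cdet (k (cis t)))).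
  { intros t Ht. rewrite H, cdet_mul, det_v, cdet_conj by auto. ring. }
  assert (K : forall t, turn t -> cdet (p (cis t)) = cdet cid).
  { apply (hardy_liouville (fun z => cdet (p z)) (fun z => cdet (k z)) _ (cdet L)); auto;
      now apply hardy_mat_det. }
  intros t Ht. rewrite cdet_conj, <- E, K, cdet_cid by auto. auto.
Qed.

Lemma factorization_unique (p k p' k' : C -> cmat) :
  factorization v p k -> factorization v p' k' ->
  forall t, turn t -> p' (cis t) = p (cis t).
Proof.
  intros F F' t Ht.
  pose proof F as [Hp [[L Hk] H]]. destruct F' as [Hp' [[L' Hk'] H']].
  pose proof (factorization_det p k F) as Det.
  assert (He : hardy_mat (fun z => cmul (p' z) (cadj (p z))) cid).
  { replace cid with (cmul cid (cadj cid)) by cmat_ring.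
    apply hardy_mat_mul; auto. now apply hardy_mat_adj. }
  assert (HK : hardy_mat (fun z => cmul (k' z) (cadj (k z))) (cmul L' (cadj L))).
  { apply hardy_mat_mul; auto. now apply hardy_mat_adj. }
  assert (E : forall t, turn t -> cmul (p' (cis t)) (cadj (p (cis t)))
    = cmconj (cmul (k' (cis t)) (cadj (k (cis t))))).
  { intros s Hs. rewrite H, H' by auto. rewrite cmconj_mul, cmconj_adj, cadj_mul.
    rewrite <- cmul_assoc, (cmul_assoc (v (cis s))), cmul_adj_r, cmul_1_l by auto.
    reflexivity. }
  assert (Z : cmul (p' (cis t)) (cadj (p (cis t))) = cid).
  { destruct He as [E1 [E2 [E3 E4]]], HK as [K1 [K2 [K3 K4]]]. apply cmat_ext.
    - apply (hardy_liouville _ _ _ _ E1 K1); auto. intros; now rewrite E.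
    - apply (hardy_liouville _ _ _ _ E2 K2); auto. intros; now rewrite E.
    - apply (hardy_liouville _ _ _ _ E3 K3); auto. intros; now rewrite E.
    - apply (hardy_liouville _ _ _ _ E4 K4); auto. intros; now rewrite E. }
  rewrite <- (cmul_1_r (p' (cis t))), <- (cmul_adj_l (p (cis t))) by now apply Det.
  rewrite cmul_assoc, Z. apply cmul_1_l.
Qed.

End Factorization.

Fixpoint monom (n : nat) (z : C) : C :=
  match n with O => RtoC 1 | S k => (z * monom k z)%C end.

Lemma monom_cont (n : nat) : circle_cont (monom n).
Proof.
  induction n; simpl.
  - apply circle_cont_const.
  - apply circle_cont_mult; auto using circle_cont_id.
Qed.

Lemma Cmod_monom (n : nat) (t : R) : Cmod (monom n (cis t)) = 1.
Proof.
  induction n; simpl.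
  - apply Cmod_1.
  - rewrite Cmod_mult, IHn, Cmod_cis. ring.
Qed.

Definition moment (n : nat) (f : C -> C) : C := mean (fun z => monom n z * f z)%C.

Lemma moment_ext (n : nat) (f g : C -> C) :
  (forall t, turn t -> f (cis t) = g (cis t)) -> moment n f = moment n g.
Proof. intros H. apply mean_ext. intros t Ht. now rewrite H. Qed.

Lemma moment_plus (n : nat) (f g : C -> C) : circle_cont f -> circle_cont g ->
  moment n (fun z => f z + g z)%C = (moment n f + moment n g)%C.
Proof.
  intros Hf Hg. unfold moment. rewrite <- mean_plus.
  - apply mean_ext. intros; ring.
  - apply circle_cont_mult; auto using monom_cont.
  - apply circle_cont_mult; auto using monom_cont.
Qed.

Lemma moment_scal (n : nat) (k : C) (f : C -> C) : circle_cont f ->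
  moment n (fun z => k * f z)%C = (k * moment n f)%C.
Proof.
  intros Hf. unfold moment. rewrite <- mean_scal.
  - apply mean_ext. intros; ring.
  - apply circle_cont_mult; auto using monom_cont.
Qed.

Lemma moment_minus (n : nat) (f g : C -> C) : circle_cont f -> circle_cont g ->
  moment n (fun z => f z - g z)%C = (moment n f - moment n g)%C.
Proof.
  intros Hf Hg. unfold moment. rewrite <- mean_minus.
  - apply mean_ext. intros; ring.
  - apply circle_cont_mult; auto using monom_cont.
  - apply circle_cont_mult; auto using monom_cont.
Qed.

Lemma moment_id (n : nat) (f : C -> C) :
  moment n (fun z => z * f z)%C = moment (S n) f.
Proof. apply mean_ext. intros; simpl; ring. Qed.

Lemma Cmod_moment_le (n : nat) (f g : C -> C) : circle_cont f -> circle_cont g ->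
  (forall t, turn t -> Cmod (f (cis t)) <= Re (g (cis t))) ->
  Cmod (moment n f) <= 2 * Re (mean g).
Proof.
  intros Hf Hg H. apply Cmod_mean_le; auto.
  - apply circle_cont_mult; auto using monom_cont.
  - intros t Ht. rewrite Cmod_mult, Cmod_monom, Rmult_1_l. auto.
Qed.

Lemma moment_conj_hardy (n : nat) (g : C -> C) (l : C) : hardy g l ->
  moment (S n) (fun z => Cconj (g z)) = RtoC 0.
Proof.
  intros Hg.
  assert (Hm : forall m, exists f, hardy f 0 /\
    forall t, turn t -> monom (S m) (cis t) = Cconj (f (cis t))).
  { induction m as [|m [f [Hf E]]].
    - exists (fun z => / z)%C. split; [apply hardy_inv|]. intros t _. simpl.
      rewrite Cinv_cis, Cconj_conj. ring.
    - exists (fun z => / z * f z)%C. split.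
      + replace (RtoC 0) with (0 * 0)%C by ring.
        apply hardy_mult; auto using hardy_inv.
      + intros t Ht. rewrite Cmult_conj, Cinv_cis, Cconj_conj, <- E by auto.
        reflexivity. }
  destruct (Hm n) as [f [Hf E]].
  unfold moment. rewrite (mean_conj_hardy _ (fun z => f z * g z)%C (0 * l)).
  - rewrite Cmult_0_l. apply Cconj_RtoC.
  - now apply hardy_mult.
  - intros t Ht. now rewrite E, Cmult_conj.
Qed.

Lemma moment_1_mult (f g : C -> C) (m : C) : hardy f 0 -> hardy g m ->
  moment 1 (fun z => f z * g z)%C = (moment 1 f * m)%C.
Proof.
  intros Hf Hg. pose proof (hardy_shift f 0 Hf) as Hs.
  transitivity (mean (fun z => z * f z) * m)%C.
  - rewrite <- (hardy_mean _ _ (hardy_mult _ _ _ _ Hs Hg)).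
    apply mean_ext. intros; simpl; ring.
  - f_equal. apply mean_ext. intros; simpl; ring.
Qed.

Lemma moment_2_mult (f g : C -> C) (m : C) : hardy f 0 -> hardy g m ->
  moment 2 (fun z => f z * g z)%C = (moment 2 f * m + moment 1 f * moment 1 g)%C.
Proof.
  intros Hf Hg. set (U := mean (fun z => z * f z)%C).
  assert (EU : moment 1 f = U) by (apply mean_ext; intros; simpl; ring).
  pose proof (hardy_shift f 0 Hf) as Hs. fold U in Hs.
  assert (Cf : circle_cont f) by (eapply hardy_circle_cont, Hf).
  assert (Cg : circle_cont g) by (eapply hardy_circle_cont, Hg).
  assert (H1 : hardy (fun z => z * (f z - 0) - U)%C 0).
  { pose proof (hardy_minus _ _ _ _ Hs (hardy_const U)) as H.
    now replace (U - U)%C with (RtoC 0) in H by ring. }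
  assert (C1 : circle_cont (fun z => z * (f z - 0) - U)%C)
    by (eapply hardy_circle_cont, H1).
  pose proof (moment_1_mult _ g m H1 Hg) as M.
  assert (E : moment 1 (fun z => z * (f z - 0) - U)%C = moment 2 f).
  { rewrite (moment_ext 1 _ (fun z => z * f z - U * 1)%C) by (intros; ring).
    rewrite moment_minus, moment_scal.
    - rewrite moment_id. replace (moment 1 (fun _ => RtoC 1)) with (RtoC 0); [ring|].
      rewrite <- mean_id. apply mean_ext. intros; simpl; ring.
    - apply circle_cont_const.
    - apply circle_cont_mult; auto using circle_cont_id.
    - apply circle_cont_const. }
  rewrite E in M. rewrite <- M, EU, <- moment_scal, <- moment_plus; auto.
  - unfold moment. apply mean_ext. intros; simpl; ring.
  - apply circle_cont_mult; auto.
  - apply circle_cont_mult; auto using circle_cont_const.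
Qed.

(** * Mean square estimates *)

Definition sq (f : C -> C) (z : C) : C := (f z * Cconj (f z))%C.

Definition msq (f : C -> C) : R := Re (mean (sq f)).

Lemma sq_cont (f : C -> C) : circle_cont f -> circle_cont (sq f).
Proof. intros. now apply circle_cont_mult; [|apply circle_cont_conj]. Qed.

Lemma Re_sq (f : C -> C) (z : C) : Re (sq f z) = Cmod (f z) * Cmod (f z).
Proof. unfold sq. rewrite <- Cmod2_conj. simpl. ring. Qed.

Lemma msq_pos (f : C -> C) : circle_cont f -> 0 <= msq f.
Proof.
  intros Hf. unfold msq.
  replace 0 with (Re (mean (fun _ => RtoC 0))) by (rewrite mean_const; reflexivity).
  apply Re_mean_le; auto using circle_cont_const, sq_cont.
  intros t _. rewrite Re_sq. simpl. apply Rle_0_sqr.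
Qed.

Lemma Re_mean_affine (k a : R) (f g : C -> C) : circle_cont f -> circle_cont g ->
  Re (mean (fun z => RtoC a * (RtoC k + (f z + g z)))%C)
  = a * (k + (Re (mean f) + Re (mean g))).
Proof.
  intros Hf Hg.
  rewrite mean_scal, mean_plus, mean_const, mean_plus;
    auto using circle_cont_plus, circle_cont_const.
  simpl. ring.
Qed.

(* [u] lies in one Hardy space and [conj kappa] in the orthogonal one. *)
Lemma msq_projection (u kappa w : C -> C) (l : C) : hardy u 0 -> hardy kappa l ->
  circle_cont w -> (forall t, turn t -> u (cis t) = (Cconj (kappa (cis t)) - w (cis t))%C) ->
  msq u <= msq w.
Proof.
  intros Hu Hk Cw H.
  assert (Cu : circle_cont u) by (eapply hardy_circle_cont, Hu).
  assert (Ck : circle_cont kappa) by (eapply hardy_circle_cont, Hk).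
  assert (C1 : circle_cont (fun z => u z * Cconj (w z))%C)
    by (apply circle_cont_mult; auto; now apply circle_cont_conj).
  assert (E : mean (sq u) = (- mean (fun z => u z * Cconj (w z)))%C).
  { rewrite (mean_ext (sq u) (fun z => u z * kappa z - u z * Cconj (w z))%C).
    - rewrite mean_minus; auto using circle_cont_mult.
      rewrite (hardy_mean _ _ (hardy_mult _ _ _ _ Hu Hk)). ring.
    - intros t Ht. unfold sq. rewrite (H t Ht) at 2.
      rewrite Cconj_minus, Cconj_conj. ring. }
  assert (L : Re (mean (fun z => - (u z * Cconj (w z)))%C) <= / 2 * (0 + (msq u + msq w))).
  { unfold msq. rewrite <- Re_mean_affine by auto using sq_cont.
    apply Re_mean_le.
    - now apply circle_cont_opp.
    - apply circle_cont_mult; [apply circle_cont_const|].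
      apply circle_cont_plus; [apply circle_cont_const|].
      apply circle_cont_plus; now apply sq_cont.
    - intros t Ht.
      replace (Re (RtoC (/ 2) * (0 + (sq u (cis t) + sq w (cis t)))))
        with (/ 2 * (Re (sq u (cis t)) + Re (sq w (cis t)))) by (simpl; ring).
      rewrite !Re_sq. eapply Rle_trans; [apply Rle_abs|].
      eapply Rle_trans; [apply re_le_Cmod|].
      rewrite Cmod_opp, Cmod_mult, Cmod_conj.
      pose proof (Rle_0_sqr (Cmod (u (cis t)) - Cmod (w (cis t)))) as Q.
      unfold Rsqr in Q. lra. }
  rewrite mean_opp, <- E in L by auto. fold (msq u) in L. lra.
Qed.

Section Row.

Variables (u1 u2 : C -> C) (d : R).
Hypotheses (H1 : hardy u1 0) (H2 : hardy u2 0) (Hd : 0 <= d <= 1 / 4).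

Lemma entry_bound (u kappa F D1 D2 : C -> C) (l : C) : hardy u 0 -> hardy kappa l ->
  circle_cont F -> circle_cont D1 -> circle_cont D2 ->
  (forall t, turn t -> Cmod (F (cis t)) <= d /\ Cmod (D1 (cis t)) <= d /\
    Cmod (D2 (cis t)) <= d) ->
  (forall t, turn t -> u (cis t) = (Cconj (kappa (cis t)) -
    (F (cis t) + (u1 (cis t) * D1 (cis t) + u2 (cis t) * D2 (cis t))))%C) ->
  msq u <= 3 * (d * d) * (1 + (msq u1 + msq u2)) /\
  forall n, Cmod (moment (S n) u + moment (S n) F) <= msq u1 + msq u2 + 2 * (d * d).
Proof.
  intros Hu Hk CF C1 C2 Hb H.
  assert (Cu1 : circle_cont u1) by (eapply hardy_circle_cont, H1).
  assert (Cu2 : circle_cont u2) by (eapply hardy_circle_cont, H2).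
  assert (Cp : circle_cont (fun z => u1 z * D1 z + u2 z * D2 z)%C)
    by auto using circle_cont_plus, circle_cont_mult.
  set (w := fun z => (F z + (u1 z * D1 z + u2 z * D2 z))%C).
  assert (Cw : circle_cont w) by (apply circle_cont_plus; auto).
  split.
  - eapply Rle_trans; [apply (msq_projection u kappa w l); auto|].
    unfold msq. rewrite <- Re_mean_affine by auto using sq_cont.
    apply Re_mean_le.
    + now apply sq_cont.
    + apply circle_cont_mult; [apply circle_cont_const|].
      apply circle_cont_plus; [apply circle_cont_const|].
      apply circle_cont_plus; now apply sq_cont.
    + intros t Ht.
      replace (Re (RtoC (3 * (d * d)) * (1 + (sq u1 (cis t) + sq u2 (cis t)))))
        with (3 * (d * d) * (1 + (Re (sq u1 (cis t)) + Re (sq u2 (cis t)))))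
        by (simpl; ring).
      rewrite !Re_sq. destruct (Hb t Ht) as [B0 [B1 B2]].
      assert (B : Cmod (w (cis t)) <= d * (1 + (Cmod (u1 (cis t)) + Cmod (u2 (cis t))))).
      { unfold w. eapply Rle_trans; [apply Cmod_triangle|].
        eapply Rle_trans; [apply Rplus_le_compat_l, Cmod_triangle|].
        rewrite !Cmod_mult.
        pose proof (Cmod_ge_0 (u1 (cis t))). pose proof (Cmod_ge_0 (u2 (cis t))). nra. }
      revert B. pose proof (Cmod_ge_0 (w (cis t))) as Pw.
      generalize dependent (Cmod (w (cis t))).
      generalize (Cmod (u1 (cis t))) (Cmod (u2 (cis t))). intros x y r Pr B.
      apply Rle_trans with (d * (1 + (x + y)) * (d * (1 + (x + y)))).
      { apply Rmult_le_compat; auto. }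
      replace (d * (1 + (x + y)) * (d * (1 + (x + y))))
        with (d * d * ((1 + (x + y)) * (1 + (x + y)))) by ring.
      replace (3 * (d * d) * (1 + (x * x + y * y)))
        with (d * d * (3 * (1 + (x * x + y * y)))) by ring.
      apply Rmult_le_compat_l; [nra|].
      pose proof (Rle_0_sqr (x - y)) as Q1. pose proof (Rle_0_sqr (1 - x)) as Q2.
      pose proof (Rle_0_sqr (1 - y)) as Q3. unfold Rsqr in *. lra.
  - intros n.
    assert (E : (moment (S n) u + moment (S n) F)%C
      = (- (1) * moment (S n) (fun z => u1 z * D1 z + u2 z * D2 z))%C).
    { rewrite (moment_ext _ u (fun z => Cconj (kappa z) - w z)%C) by auto.
      rewrite moment_minus, (moment_conj_hardy n kappa l); auto.
      - unfold w. rewrite moment_plus by auto. ring.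
      - apply circle_cont_conj. eapply hardy_circle_cont, Hk. }
    rewrite E, Cmod_mult, Cmod_opp, Cmod_1, Rmult_1_l.
    eapply Rle_trans.
    + apply Cmod_moment_le with
        (g := fun z => (RtoC (/ 2) * (RtoC (2 * (d * d)) + (sq u1 z + sq u2 z)))%C); auto.
      * apply circle_cont_mult; [apply circle_cont_const|].
        apply circle_cont_plus; [apply circle_cont_const|].
        apply circle_cont_plus; now apply sq_cont.
      * intros t Ht.
        replace (Re (RtoC (/ 2) * (RtoC (2 * (d * d)) + (sq u1 (cis t) + sq u2 (cis t)))))
          with (/ 2 * (2 * (d * d) + (Re (sq u1 (cis t)) + Re (sq u2 (cis t)))))
          by (simpl; ring).
        rewrite !Re_sq. destruct (Hb t Ht) as [_ [B1 B2]].
        eapply Rle_trans; [apply Cmod_triangle|]. rewrite !Cmod_mult.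
        pose proof (Cmod_ge_0 (u1 (cis t))). pose proof (Cmod_ge_0 (u2 (cis t))).
        pose proof (Rle_0_sqr (Cmod (u1 (cis t)) - d)) as Q1.
        pose proof (Rle_0_sqr (Cmod (u2 (cis t)) - d)) as Q2. unfold Rsqr in *. nra.
    + rewrite Re_mean_affine by auto using sq_cont.
      unfold msq. lra.
Qed.

Lemma row_bound (k1 k2 F1 F2 D11 D12 D21 D22 : C -> C) (l1 l2 : C) :
  hardy k1 l1 -> hardy k2 l2 ->
  circle_cont F1 -> circle_cont F2 -> circle_cont D11 -> circle_cont D12 ->
  circle_cont D21 -> circle_cont D22 ->
  (forall t, turn t -> Cmod (F1 (cis t)) <= d /\ Cmod (F2 (cis t)) <= d /\
    Cmod (D11 (cis t)) <= d /\ Cmod (D12 (cis t)) <= d /\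
    Cmod (D21 (cis t)) <= d /\ Cmod (D22 (cis t)) <= d) ->
  (forall t, turn t -> u1 (cis t) = (Cconj (k1 (cis t)) -
    (F1 (cis t) + (u1 (cis t) * D11 (cis t) + u2 (cis t) * D21 (cis t))))%C) ->
  (forall t, turn t -> u2 (cis t) = (Cconj (k2 (cis t)) -
    (F2 (cis t) + (u1 (cis t) * D12 (cis t) + u2 (cis t) * D22 (cis t))))%C) ->
  msq u1 + msq u2 <= 12 * (d * d) /\
  forall n, Cmod (moment (S n) u1 + moment (S n) F1) <= 14 * (d * d) /\
    Cmod (moment (S n) u2 + moment (S n) F2) <= 14 * (d * d).
Proof.
  intros K1 K2 CF1 CF2 CD1 CD2 CD3 CD4 Hb E1 E2.
  destruct (entry_bound u1 k1 F1 D11 D21 l1) as [A1 B1]; auto.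
  { intros t Ht. destruct (Hb t Ht) as (?&?&?&?&?&?). auto. }
  destruct (entry_bound u2 k2 F2 D12 D22 l2) as [A2 B2]; auto.
  { intros t Ht. destruct (Hb t Ht) as (?&?&?&?&?&?). auto. }
  assert (P1 : 0 <= msq u1) by (apply msq_pos; eapply hardy_circle_cont, H1).
  assert (P2 : 0 <= msq u2) by (apply msq_pos; eapply hardy_circle_cont, H2).
  assert (Q : d * d <= 1 / 16) by nra.
  assert (N : msq u1 + msq u2 <= 12 * (d * d)) by nra.
  split; auto. intros n. specialize (B1 n). specialize (B2 n). lra.
Qed.

End Row.

(** * The jump between two parameter values *)

Definition dress (A : cmat) : cmat := cmul A (cmul csigma (cadj A)).

Lemma cmconj_dress (A : cmat) : cmconj (dress A) = dress (cmconj A).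
Proof.
  unfold dress. rewrite !cmconj_mul, cmconj_adj. do 2 f_equal.
  apply cmat_ext; unfold cmconj, csigma, cdiag; cbn [c11 c12 c21 c22];
    apply injective_projections; simpl; ring.
Qed.

Lemma hardy_dress (p : C -> cmat) : hardy_mat p cid ->
  hardy_mat (fun z => dress (p z)) csigma.
Proof.
  intros Hp. replace csigma with (cmul cid (cmul csigma (cadj cid))) by cmat_ring.
  apply hardy_mat_mul; auto. apply hardy_mat_mul; [apply hardy_mat_const|].
  now apply hardy_mat_adj.
Qed.

Definition half_sum (s : C) : C := ((Cexp (- (Ci * s)) + Cexp (Ci * s)) / 2)%C.
Definition half_diff (s : C) : C := ((Cexp (- (Ci * s)) - Cexp (Ci * s)) / 2)%C.

Lemma RtoC_2_neq_0 : RtoC 2 <> RtoC 0.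
Proof. apply RtoC_neq_0; lra. Qed.

Lemma Cexp_opp (z : C) : (Cexp (- z) * Cexp z)%C = RtoC 1.
Proof. rewrite <- Cexp_plus, <- Cexp_0. f_equal. ring. Qed.

Lemma half_sum_diff (s : C) :
  (half_sum s * half_sum s - half_diff s * half_diff s)%C = RtoC 1.
Proof.
  rewrite <- (Cexp_opp (Ci * s)). unfold half_sum, half_diff.
  field.
Qed.

Lemma half_bounds (s : C) (h : R) : Cmod s <= h -> h <= 1 / 4 ->
  Cmod (half_sum s * half_diff s + Ci * s) <= 8 * (h * h) /\
  Cmod (half_diff s * half_diff s) <= 4 * (h * h).
Proof.
  intros Hs Hh. pose proof (Cmod_ge_0 s) as P0.
  assert (Mi : forall z, Cmod (Ci * z) = Cmod z)
    by (intros; rewrite Cmod_mult, Cmod_Ci; ring).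
  assert (N2 : RtoC 2 <> RtoC 0) by apply RtoC_2_neq_0.
  assert (M2 : Cmod 2 = 2) by (rewrite Cmod_R; apply Rabs_right; lra).
  split.
  - set (x := (- (Ci * s) + - (Ci * s))%C). set (y := (Ci * s + Ci * s)%C).
    assert (Bx : Cmod x <= 2 * h).
    { unfold x. eapply Rle_trans; [apply Cmod_triangle|]. rewrite Cmod_opp, Mi. lra. }
    assert (By : Cmod y <= 2 * h).
    { unfold y. eapply Rle_trans; [apply Cmod_triangle|]. rewrite Mi. lra. }
    pose proof (Cexp_quadratic x ltac:(lra)) as Qx.
    pose proof (Cexp_quadratic y ltac:(lra)) as Qy.
    replace (half_sum s * half_diff s + Ci * s)%C with
      (((Cexp x - 1 - x) - (Cexp y - 1 - y)) / 4)%C.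
    2:{ unfold x, y, half_sum, half_diff. rewrite !Cexp_plus. field. }
    unfold Cdiv. rewrite Cmod_mult, Cmod_inv by (apply RtoC_neq_0; lra).
    rewrite Cmod_R, Rabs_right by lra.
    assert (Cmod ((Cexp x - 1 - x) - (Cexp y - 1 - y)) <=
      4 * (Cmod x * Cmod x) + 4 * (Cmod y * Cmod y)).
    { eapply Rle_trans; [apply Cmod_triangle|]. rewrite Cmod_opp. lra. }
    pose proof (Cmod_ge_0 x). pose proof (Cmod_ge_0 y).
    assert (Cmod x * Cmod x <= 2 * h * (2 * h)) by (apply Rmult_le_compat; auto).
    assert (Cmod y * Cmod y <= 2 * h * (2 * h)) by (apply Rmult_le_compat; auto).
    lra.
  - set (x := (- (Ci * s))%C). set (y := (Ci * s)%C).
    assert (Bx : Cmod x <= h) by (unfold x; rewrite Cmod_opp, Mi; lra).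
    assert (By : Cmod y <= h) by (unfold y; rewrite Mi; lra).
    pose proof (Cexp_quadratic x ltac:(lra)) as Qx.
    pose proof (Cexp_quadratic y ltac:(lra)) as Qy.
    pose proof (Cmod_ge_0 x). pose proof (Cmod_ge_0 y).
    assert (Cmod x * Cmod x <= h * h) by (apply Rmult_le_compat; auto).
    assert (Cmod y * Cmod y <= h * h) by (apply Rmult_le_compat; auto).
    assert (B : Cmod (half_diff s) <= 2 * h).
    { replace (half_diff s) with (((Cexp x - 1 - x) - (Cexp y - 1 - y)) / 2 - y)%C
        by (unfold x, y, half_diff; field).
      eapply Rle_trans; [apply Cmod_triangle|]. rewrite Cmod_opp.
      unfold Cdiv. rewrite Cmod_mult, Cmod_inv, M2 by auto.
      assert (Cmod ((Cexp x - 1 - x) - (Cexp y - 1 - y)) <=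
        4 * (Cmod x * Cmod x) + 4 * (Cmod y * Cmod y)).
      { eapply Rle_trans; [apply Cmod_triangle|]. rewrite Cmod_opp. lra. }
      nra. }
    rewrite Cmod_mult. pose proof (Cmod_ge_0 (half_diff s)). nra.
Qed.

Definition twist (s : C) (P M : cmat) : cmat :=
  cmul (cmul P (cmul (cdiag (Cexp (- (Ci * s))) (Cexp (Ci * s))) (cadj P)))
       (cmul M (cmul (cdiag (Cexp (Ci * s)) (Cexp (- (Ci * s)))) (cadj M))).

Lemma cmul_diag_dress (a b : C) (P : cmat) : cdet P = RtoC 1 ->
  cmul P (cmul (cdiag (a + b) (a - b)) (cadj P)) =
  CM (a + b * c11 (dress P)) (b * c12 (dress P))
     (b * c21 (dress P)) (a + b * c22 (dress P)).
Proof.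
  intros H.
  transitivity (CM (a * cdet P + b * c11 (dress P)) (b * c12 (dress P))
     (b * c21 (dress P)) (a * cdet P + b * c22 (dress P))).
  - apply cmat_ext; unfold dress, cmul, cadj, cdet, csigma, cdiag;
      cbn [c11 c12 c21 c22]; ring.
  - rewrite H. apply cmat_ext; cbn [c11 c12 c21 c22]; ring.
Qed.

Lemma twist_expand (s : C) (P M : cmat) : cdet P = RtoC 1 -> cdet M = RtoC 1 ->
  let a := half_sum s in let b := half_diff s in
  let S := dress P in let T := dress M in let U := cmul S T in
  twist s P M =
  CM (1 + (a * b * (c11 S - c11 T) + b * b * (1 - c11 U)))
     (a * b * (c12 S - c12 T) + b * b * (0 - c12 U))
     (a * b * (c21 S - c21 T) + b * b * (0 - c21 U))
     (1 + (a * b * (c22 S - c22 T) + b * b * (1 - c22 U))).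
Proof.
  intros HP HM a b S T U.
  assert (E1 : Cexp (- (Ci * s)) = (a + b)%C)
    by (unfold a, b, half_sum, half_diff; field).
  assert (E2 : Cexp (Ci * s) = (a - b)%C)
    by (unfold a, b, half_sum, half_diff; field).
  assert (E3 : (a * a)%C = (1 + b * b)%C).
  { rewrite <- (half_sum_diff s). fold a b. ring. }
  assert (E4 : cdiag (a - b) (a + b) = cdiag (a + - b) (a - - b))
    by (unfold cdiag; f_equal; ring).
  unfold twist. rewrite E1, E2, E4, !cmul_diag_dress by auto. fold S T.
  unfold U, cmul. cbn [c11 c12 c21 c22]. clearbody S T a b.
  f_equal; ring [E3].
Qed.

Lemma entry_estimate (a b s x y e m : C) (h B : R) : 0 <= B -> Cmod s <= h -> h <= 1 / 4 ->
  Cmod (a * b + Ci * s) <= 8 * (h * h) -> Cmod (b * b) <= 4 * (h * h) ->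
  Cmod x <= B -> Cmod y <= B -> Cmod e <= 1 -> Cmod m <= 2 * (B * B) ->
  let C0 := 4 + 16 * B + 8 * (B * B) in
  Cmod (a * b * (x - y) + b * b * (e - m) + Ci * s * (x - y)) <= C0 * (h * h) /\
  Cmod (a * b * (x - y) + b * b * (e - m)) <= (C0 + 2 * B) * h.
Proof.
  intros HB Hs Hh H1 H2 Hx Hy He Hm C0.
  pose proof (Cmod_ge_0 s) as P0.
  assert (T1 : Cmod (x - y) <= 2 * B).
  { eapply Rle_trans; [apply Cmod_triangle|]. rewrite Cmod_opp. lra. }
  assert (T2 : Cmod (e - m) <= 1 + 2 * (B * B)).
  { eapply Rle_trans; [apply Cmod_triangle|]. rewrite Cmod_opp. lra. }
  assert (R : Cmod (a * b * (x - y) + b * b * (e - m) + Ci * s * (x - y)) <= C0 * (h * h)).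
  { replace (a * b * (x - y) + b * b * (e - m) + Ci * s * (x - y))%C with
      ((a * b + Ci * s) * (x - y) + b * b * (e - m))%C by ring.
    eapply Rle_trans; [apply Cmod_triangle|].
    rewrite (Cmod_mult _ (x - y)), (Cmod_mult _ (e - m)).
    apply Rle_trans with (8 * (h * h) * (2 * B) + 4 * (h * h) * (1 + 2 * (B * B))).
    - apply Rplus_le_compat; apply Rmult_le_compat; auto using Cmod_ge_0.
    - unfold C0. right. ring. }
  split; auto.
  replace (a * b * (x - y) + b * b * (e - m))%C with
    ((a * b * (x - y) + b * b * (e - m) + Ci * s * (x - y)) - Ci * s * (x - y))%C by ring.
  eapply Rle_trans; [apply Cmod_triangle|]. rewrite Cmod_opp, !Cmod_mult, Cmod_Ci, Rmult_1_l.
  assert (Cmod s * Cmod (x - y) <= h * (2 * B)) by (apply Rmult_le_compat; auto using Cmod_ge_0).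
  assert (0 <= C0) by (unfold C0; nra).
  assert (C0 * (h * h) <= C0 * h) by (apply Rmult_le_compat_l; nra).
  lra.
Qed.

Definition phase_shift (dX dT : R) (z : C) : C := (RtoC dX * z + RtoC dT * (z * z))%C.

Definition perturbed (dX dT : R) (v0 v : C -> cmat) : Prop :=
  forall t, turn t -> let s := phase_shift dX dT (cis t) in
    v (cis t) = cmul (cdiag (Cexp (- (Ci * s))) (Cexp (Ci * s)))
      (cmul (v0 (cis t)) (cdiag (Cexp (Ci * s)) (Cexp (- (Ci * s))))).

Lemma phase_shift_bound (dX dT h : R) (t : R) : Rabs dX + Rabs dT <= h ->
  Cmod (phase_shift dX dT (cis t)) <= h.
Proof.
  intros H. unfold phase_shift. eapply Rle_trans; [apply Cmod_triangle|].
  rewrite !Cmod_mult, !Cmod_R, Cmod_cis. lra.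
Qed.

Lemma phase_shift_cont (dX dT : R) : circle_cont (phase_shift dX dT).
Proof.
  apply circle_cont_plus; apply circle_cont_mult; auto using circle_cont_const, circle_cont_id.
  apply circle_cont_mult; apply circle_cont_id.
Qed.

Lemma circle_cont_Cexp (f : C -> C) : circle_cont f -> circle_cont (fun z => Cexp (f z)).
Proof.
  intros Hf z Hz. apply cont_within_comp with (E := fun _ => True); auto.
  apply cdiff_cont, cdiff_Cexp.
Qed.

Lemma twist_cont (s : C -> C) (P M : C -> cmat) : circle_cont s ->
  entrywise circle_cont P -> entrywise circle_cont M ->
  entrywise circle_cont (fun z => twist (s z) (P z) (M z)).
Proof.
  intros Hs HP HM. unfold twist.
  assert (C1 : circle_cont (fun z => Ci * s z)%C)
    by (apply circle_cont_mult; auto using circle_cont_const).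
  assert (C2 : circle_cont (fun z => Cexp (Ci * s z))) by now apply circle_cont_Cexp.
  assert (C3 : circle_cont (fun z => Cexp (- (Ci * s z))))
    by now apply circle_cont_Cexp, circle_cont_opp.
  apply cont_mat_mul; apply cont_mat_mul; auto; apply cont_mat_mul;
    auto using cont_mat_diag, cont_mat_adj.
Qed.

(* The interior factors satisfy [m m0^-1 = e W], where [e = p p0^-1] and
   [W] is close to the identity. *)
Lemma perturbed_jump (s : C) (p p0 m m0 v v0 : cmat) :
  cdet v0 = RtoC 1 -> cdet p0 = RtoC 1 -> cdet m0 = RtoC 1 ->
  p = cmul m v -> p0 = cmul m0 v0 ->
  v = cmul (cdiag (Cexp (- (Ci * s))) (Cexp (Ci * s)))
      (cmul v0 (cdiag (Cexp (Ci * s)) (Cexp (- (Ci * s))))) ->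
  cmul m (cadj m0) = cmul (cmul p (cadj p0)) (twist s p0 m0).
Proof.
  intros Hv0 Hp0 Hm0 Ep Ep0 Ev.
  set (E := cdiag (Cexp (- (Ci * s))) (Cexp (Ci * s))) in *.
  set (E' := cdiag (Cexp (Ci * s)) (Cexp (- (Ci * s)))) in *.
  assert (EE : cmul E E' = cid).
  { apply cmat_ext; unfold E, E', cmul, cid, cdiag; cbn [c11 c12 c21 c22];
      rewrite ?Cexp_opp; try ring.
    rewrite Cmult_comm with (x := Cexp (Ci * s)), Cexp_opp. ring. }
  assert (EE' : cmul E' E = cid).
  { rewrite <- EE. unfold E, E'. cmat_ring. }
  unfold twist. fold E E'.
  assert (A1 : cmul (cadj p0) m0 = cadj v0).
  { rewrite Ep0, cadj_mul, <- cmul_assoc, cmul_adj_l, cmul_1_r; auto. }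
  transitivity (cmul (cmul p (cmul E (cmul (cmul (cadj p0) m0) E'))) (cadj m0)).
  - rewrite A1, Ep, Ev. f_equal.
    rewrite <- (cmul_assoc m), <- (cmul_assoc E), <- (cmul_assoc v0),
      (cmul_assoc E' E), EE', cmul_1_l, (cmul_assoc v0), cmul_adj_r, cmul_1_l, EE,
      cmul_1_r by auto. reflexivity.
  - rewrite <- !cmul_assoc. f_equal.
    rewrite !cmul_assoc. f_equal. f_equal. f_equal. f_equal.
    rewrite cmul_adj_l by auto. now rewrite cmul_1_l.
Qed.

Lemma moment_phase_shift (n : nat) (dX dT : R) (f : C -> C) : circle_cont f ->
  moment n (fun z => phase_shift dX dT z * f z)%C
  = (RtoC dX * moment (S n) f + RtoC dT * moment (S (S n)) f)%C.
Proof.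
  intros Hf.
  assert (C1 : circle_cont (fun z => z * f z)%C)
    by (apply circle_cont_mult; auto using circle_cont_id).
  assert (C2 : circle_cont (fun z => z * (z * f z))%C)
    by (apply circle_cont_mult; auto using circle_cont_id).
  rewrite (moment_ext n _ (fun z => RtoC dX * (z * f z) + RtoC dT * (z * (z * f z)))%C)
    by (intros; unfold phase_shift; ring).
  rewrite moment_plus, !moment_scal, moment_id, (moment_id n (fun z => z * f z)%C),
    moment_id; auto; apply circle_cont_mult; auto using circle_cont_const.
Qed.

Lemma moment_estimate (n : nat) (dX dT c c' : R) (u D X Y g : C -> C) (l : C) :
  circle_cont D -> circle_cont X -> circle_cont Y -> hardy g l ->
  (forall t, turn t -> Y (cis t) = Cconj (g (cis t))) ->
  (forall t, turn t -> Cmod (D (cis t) +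
    Ci * phase_shift dX dT (cis t) * (X (cis t) - Y (cis t))) <= c) ->
  Cmod (moment (S n) u + moment (S n) D) <= c' ->
  Cmod (moment (S n) u -
    Ci * (RtoC dX * moment (S (S n)) X + RtoC dT * moment (S (S (S n))) X)) <= c' + 2 * c.
Proof.
  intros CD CX CY Hg HY HR Hu.
  assert (MY : forall m, moment (S m) Y = RtoC 0).
  { intros m. rewrite (moment_ext _ _ (fun z => Cconj (g z)) HY). eapply moment_conj_hardy, Hg. }
  assert (Cs : circle_cont (fun z => phase_shift dX dT z * (X z - Y z))%C)
    by (apply circle_cont_mult; auto using phase_shift_cont, circle_cont_minus).
  assert (Cr : circle_cont (fun z => D z + Ci * (phase_shift dX dT z * (X z - Y z)))%C)
    by (apply circle_cont_plus; auto; apply circle_cont_mult; auto using circle_cont_const).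
  pose proof (Cmod_moment_le (S n) _ (fun _ => RtoC c) Cr (circle_cont_const _)) as M.
  rewrite mean_const in M. simpl (Re (RtoC c)) in M.
  assert (M' : Cmod (moment (S n)
    (fun z => D z + Ci * (phase_shift dX dT z * (X z - Y z)))%C) <= 2 * c).
  { apply M. intros t Ht. rewrite Cmult_assoc. auto. }
  rewrite moment_plus, moment_scal, moment_phase_shift, !moment_minus, !MY in M'; auto;
    try (apply circle_cont_minus; auto; fail);
    try (apply circle_cont_mult; auto using circle_cont_const; fail).
  replace (moment (S n) u -
    Ci * (RtoC dX * moment (S (S n)) X + RtoC dT * moment (S (S (S n))) X))%C with
    ((moment (S n) u + moment (S n) D) - (moment (S n) D + Ci *
      (RtoC dX * (moment (S (S n)) X - 0) + RtoC dT * (moment (S (S (S n))) X - 0))))%C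
    by ring.
  eapply Rle_trans; [apply Cmod_triangle|]. rewrite Cmod_opp. lra.
Qed.

Definition bounded_by (B : R) (A : cmat) : Prop :=
  Cmod (c11 A) <= B /\ Cmod (c12 A) <= B /\ Cmod (c21 A) <= B /\ Cmod (c22 A) <= B.

Lemma bounded_by_le (B B' : R) (A : cmat) : B <= B' -> bounded_by B A -> bounded_by B' A.
Proof. unfold bounded_by. intros H. lra. Qed.

Lemma entrywise_bounded (p : C -> cmat) : entrywise circle_cont p ->
  exists B, 0 <= B /\ forall t, turn t -> bounded_by B (p (cis t)).
Proof.
  intros [H1 [H2 [H3 H4]]].
  destruct (circle_bounded _ H1) as [B1 [P1 K1]], (circle_bounded _ H2) as [B2 [P2 K2]],
    (circle_bounded _ H3) as [B3 [P3 K3]], (circle_bounded _ H4) as [B4 [P4 K4]].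
  exists (B1 + B2 + B3 + B4). split; [lra|]. intros t Ht.
  specialize (K1 t Ht). specialize (K2 t Ht). specialize (K3 t Ht). specialize (K4 t Ht).
  unfold bounded_by. lra.
Qed.

Lemma bounded_by_mul (B : R) (A A' : cmat) : 0 <= B ->
  bounded_by B A -> bounded_by B A' -> bounded_by (2 * (B * B)) (cmul A A').
Proof.
  intros HB (?&?&?&?) (?&?&?&?). unfold bounded_by, cmul. cbn [c11 c12 c21 c22].
  assert (K : forall x y x' y', Cmod x <= B -> Cmod y <= B -> Cmod x' <= B ->
    Cmod y' <= B -> Cmod (x * y + x' * y') <= 2 * (B * B)).
  { intros x y x' y' Hx Hy Hx' Hy'.
    eapply Rle_trans; [apply Cmod_triangle|]. rewrite !Cmod_mult.
    replace (2 * (B * B)) with (B * B + B * B) by ring.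
    apply Rplus_le_compat; apply Rmult_le_compat; auto using Cmod_ge_0. }
  repeat split; apply K; auto.
Qed.

Definition csub1 (A : cmat) : cmat := CM (c11 A - 1) (c12 A) (c21 A) (c22 A - 1).

Lemma hardy_csub1 (p : C -> cmat) (L : cmat) : hardy_mat p L ->
  hardy_mat (fun z => csub1 (p z)) (csub1 L).
Proof.
  intros (?&?&?&?). unfold csub1, hardy_mat. cbn [c11 c12 c21 c22].
  split; [|split; [|split]]; auto; apply hardy_minus; auto; apply hardy_const.
Qed.

Lemma cont_csub1 (p : C -> cmat) : entrywise circle_cont p ->
  entrywise circle_cont (fun z => csub1 (p z)).
Proof.
  intros (?&?&?&?). unfold csub1, entrywise. cbn [c11 c12 c21 c22].
  split; [|split; [|split]]; auto; apply circle_cont_minus; auto; apply circle_cont_const.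
Qed.

Lemma Cmod_1_le : Cmod 1 <= 1.
Proof. rewrite Cmod_1; lra. Qed.

Lemma Cmod_0_le : Cmod 0 <= 1.
Proof. rewrite Cmod_0; lra. Qed.

Lemma twist_estimate (s : C) (P M : cmat) (h B : R) :
  cdet P = RtoC 1 -> cdet M = RtoC 1 -> 0 <= B -> Cmod s <= h -> h <= 1 / 4 ->
  bounded_by B (dress P) -> bounded_by B (dress M) ->
  let C0 := 4 + 16 * B + 8 * (B * B) in
  let W := csub1 (twist s P M) in
  bounded_by ((C0 + 2 * B) * h) W /\
  Cmod (c11 W + Ci * s * (c11 (dress P) - c11 (dress M))) <= C0 * (h * h) /\
  Cmod (c12 W + Ci * s * (c12 (dress P) - c12 (dress M))) <= C0 * (h * h) /\
  Cmod (c21 W + Ci * s * (c21 (dress P) - c21 (dress M))) <= C0 * (h * h) /\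
  Cmod (c22 W + Ci * s * (c22 (dress P) - c22 (dress M))) <= C0 * (h * h).
Proof.
  intros HP HM HB Hs Hh BP BM C0 W.
  destruct (half_bounds s h Hs Hh) as [H1 H2].
  pose proof (bounded_by_mul B _ _ HB BP BM) as BU.
  destruct BP as (P1&P2&P3&P4), BM as (M1&M2&M3&M4), BU as (U1&U2&U3&U4).
  unfold W, bounded_by. rewrite twist_expand by auto.
  cbv zeta. unfold csub1. cbn [c11 c12 c21 c22].
  set (a := half_sum s) in *. set (b := half_diff s) in *.
  set (SP := dress P) in *. set (SM := dress M) in *. set (U := cmul SP SM) in *.
  assert (I1 : forall x, (1 + x - 1)%C = x) by (intros; ring).
  rewrite !I1.
  destruct (entry_estimate a b s (c11 SP) (c11 SM) 1 (c11 U) h B) as [E1 F1];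
    auto using Cmod_1_le.
  destruct (entry_estimate a b s (c12 SP) (c12 SM) 0 (c12 U) h B) as [E2 F2];
    auto using Cmod_0_le.
  destruct (entry_estimate a b s (c21 SP) (c21 SM) 0 (c21 U) h B) as [E3 F3];
    auto using Cmod_0_le.
  destruct (entry_estimate a b s (c22 SP) (c22 SM) 1 (c22 U) h B) as [E4 F4];
    auto using Cmod_1_le.
Qed.

Section Perturbation.

Variables (v0 p0 k0 : C -> cmat).
Hypothesis det_v0 : forall t, turn t -> cdet (v0 (cis t)) = RtoC 1.
Hypothesis F0 : factorization v0 p0 k0.

Definition quotient (p : C -> cmat) (z : C) : cmat := cmul (p z) (cadj (p0 z)).

Lemma quotient_hardy (p : C -> cmat) : hardy_mat p cid -> hardy_mat (quotient p) cid.
Proof.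
  intros Hp. unfold quotient. replace cid with (cmul cid (cadj cid)) by cmat_ring.
  apply hardy_mat_mul; auto. apply hardy_mat_adj, F0.
Qed.

Definition msq_mat (p : C -> cmat) : R :=
  msq (fun z => c11 (p z)) + msq (fun z => c12 (p z)) +
  (msq (fun z => c21 (p z)) + msq (fun z => c22 (p z))).

Definition entry_moments (n : nat) (p : C -> cmat) : cmat :=
  CM (moment n (fun z => c11 (p z))) (moment n (fun z => c12 (p z)))
     (moment n (fun z => c21 (p z))) (moment n (fun z => c22 (p z))).

Definition lin (dX dT : R) (x y : C) : C := (Ci * (RtoC dX * x + RtoC dT * y))%C.

Lemma quotient_estimate : exists K h0, 0 <= K /\ 0 < h0 <= 1 / 4 /\
  forall dX dT h v p k, 0 <= h <= h0 -> Rabs dX + Rabs dT <= h ->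
    perturbed dX dT v0 v -> factorization v p k ->
    let u z := csub1 (quotient p z) in
    let Q n := entry_moments n (fun z => dress (p0 z)) in
    msq_mat u <= K * (h * h) /\
    forall n,
      let U := entry_moments (S n) u in
      let Q1 := Q (S (S n)) in let Q2 := Q (S (S (S n))) in
      Cmod (c11 U - lin dX dT (c11 Q1) (c11 Q2)) <= K * (h * h) /\
      Cmod (c12 U - lin dX dT (c12 Q1) (c12 Q2)) <= K * (h * h) /\
      Cmod (c21 U - lin dX dT (c21 Q1) (c21 Q2)) <= K * (h * h) /\
      Cmod (c22 U - lin dX dT (c22 Q1) (c22 Q2)) <= K * (h * h).
Proof.
  pose proof F0 as [Hp0 [[L0 Hk0] E0]].
  pose proof (factorization_det v0 det_v0 p0 k0 F0) as Det0.
  set (m0 := fun z => cmconj (k0 z)).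
  assert (CP : entrywise circle_cont (fun z => dress (p0 z))).
  { eapply hardy_mat_cont, hardy_dress, Hp0. }
  assert (Cm0 : entrywise circle_cont m0).
  { apply cont_mat_conj. eapply hardy_mat_cont, Hk0. }
  assert (HT : hardy_mat (fun z => dress (k0 z)) (cmul L0 (cmul csigma (cadj L0)))).
  { apply hardy_mat_mul; auto. apply hardy_mat_mul; [apply hardy_mat_const|].
    now apply hardy_mat_adj. }
  assert (CM0 : entrywise circle_cont (fun z => dress (m0 z))).
  { unfold dress. apply cont_mat_mul; auto. apply cont_mat_mul.
    - eapply hardy_mat_cont, hardy_mat_const.
    - now apply cont_mat_adj. }
  destruct (entrywise_bounded _ CP) as [B1 [PB1 HB1]].
  destruct (entrywise_bounded _ CM0) as [B2 [PB2 HB2]].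
  set (B := B1 + B2).
  assert (PB : 0 <= B) by (unfold B; lra).
  set (C0 := 4 + 16 * B + 8 * (B * B)).
  assert (PC0 : 4 <= C0) by (unfold C0; nra).
  set (C1 := C0 + 2 * B).
  assert (PC1 : 4 <= C1) by (unfold C1; lra).
  exists (24 * (C1 * C1) + 2 * C0), (1 / (4 * C1)).
  assert (Ph : 0 < 1 / (4 * C1) <= 1 / 4).
  { split; [apply Rdiv_lt_0_compat; lra|].
    apply Rmult_le_compat_l; [lra|]. apply Rinv_le_contravar; lra. }
  split; [nra|]. split; auto.
  intros dX dT h v p k Hh Hd Hv Fp u Q.
  assert (Hh4 : h <= 1 / 4) by lra.
  assert (Hd4 : C1 * h <= 1 / 4).
  { apply Rle_trans with (C1 * (1 / (4 * C1))); [apply Rmult_le_compat_l; lra|].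
    right. field. lra. }
  set (s := phase_shift dX dT).
  assert (Bs : forall t, Cmod (s (cis t)) <= h) by (intros; now apply phase_shift_bound).
  set (W := fun z => csub1 (twist (s z) (p0 z) (m0 z))).
  assert (CW : entrywise circle_cont W).
  { apply cont_csub1, twist_cont; auto.
    - apply phase_shift_cont.
    - eapply hardy_mat_cont, Hp0. }
  pose proof Fp as [Hp [[L Hk] Ep]].
  assert (He : hardy_mat u (csub1 cid)) by (apply hardy_csub1, quotient_hardy; auto).
  replace (csub1 cid) with (CM 0 0 0 0) in He
    by (apply cmat_ext; unfold csub1, cid, cdiag; cbn [c11 c12 c21 c22]; ring).
  assert (HK : hardy_mat (fun z => csub1 (cmul (k z) (cadj (k0 z))))
    (csub1 (cmul L (cadj L0)))).
  { apply hardy_csub1, hardy_mat_mul; auto. now apply hardy_mat_adj. }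
  assert (HE : forall t, turn t ->
    cmconj (cmul (k (cis t)) (cadj (k0 (cis t)))) =
    cmul (quotient p (cis t)) (twist (s (cis t)) (p0 (cis t)) (m0 (cis t)))).
  { intros t Ht. destruct (Det0 t Ht) as [D1 D2].
    rewrite cmconj_mul, cmconj_adj.
    apply (perturbed_jump (s (cis t)) (p (cis t)) (p0 (cis t))
      (cmconj (k (cis t))) (m0 (cis t)) (v (cis t)) (v0 (cis t)));
      unfold m0; auto. }
  assert (EST : forall t, turn t -> _) by (intros t Ht; exact
    (twist_estimate (s (cis t)) (p0 (cis t)) (m0 (cis t)) h B
      (proj1 (Det0 t Ht)) (proj2 (Det0 t Ht)) PB (Bs t) Hh4
      (bounded_by_le B1 B _ ltac:(unfold B; lra) (HB1 t Ht))
      (bounded_by_le B2 B _ ltac:(unfold B; lra) (HB2 t Ht)))).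
  cbv zeta in EST. fold C0 in EST. fold C1 in EST.
  destruct CW as (W1&W2&W3&W4).
  destruct He as (h1&h2&h3&h4), HK as (g1&g2&g3&g4). cbn [c11 c12 c21 c22] in h1,h2,h3,h4.
  assert (Ent : forall (A X Y : cmat), cmconj A = cmul X Y ->
    let a := csub1 A in let x := csub1 X in let y := csub1 Y in
    c11 x = (Cconj (c11 a) - (c11 y + (c11 x * c11 y + c12 x * c21 y)))%C /\
    c12 x = (Cconj (c12 a) - (c12 y + (c11 x * c12 y + c12 x * c22 y)))%C /\
    c21 x = (Cconj (c21 a) - (c21 y + (c21 x * c11 y + c22 x * c21 y)))%C /\
    c22 x = (Cconj (c22 a) - (c22 y + (c21 x * c12 y + c22 x * c22 y)))%C).
  { intros A X Y HA. cbv zeta. unfold csub1. cbn [c11 c12 c21 c22].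
    rewrite !Cconj_minus, Cconj_RtoC.
    pose proof (f_equal c11 HA) as A1. pose proof (f_equal c12 HA) as A2.
    pose proof (f_equal c21 HA) as A3. pose proof (f_equal c22 HA) as A4.
    unfold cmconj, cmul in A1, A2, A3, A4. cbn [c11 c12 c21 c22] in A1, A2, A3, A4.
    rewrite A1, A2, A3, A4. repeat split; ring. }
  assert (Pd : 0 <= C1 * h <= 1 / 4) by (split; [apply Rmult_le_pos; lra|auto]).
  assert (R1 := row_bound (fun z => c11 (u z)) (fun z => c12 (u z)) (C1 * h) h1 h2 Pd
    _ _ (fun z => c11 (W z)) (fun z => c12 (W z))
    (fun z => c11 (W z)) (fun z => c12 (W z)) (fun z => c21 (W z)) (fun z => c22 (W z))
    _ _ g1 g2 W1 W2 W1 W2 W3 W4).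
  assert (R2 := row_bound (fun z => c21 (u z)) (fun z => c22 (u z)) (C1 * h) h3 h4 Pd
    _ _ (fun z => c21 (W z)) (fun z => c22 (W z))
    (fun z => c11 (W z)) (fun z => c12 (W z)) (fun z => c21 (W z)) (fun z => c22 (W z))
    _ _ g3 g4 W3 W4 W1 W2 W3 W4).
  destruct R1 as [N1 M1].
  { intros t Ht. destruct (EST t Ht) as [(?&?&?&?) _]. auto 10. }
  { intros t Ht. apply (Ent _ _ _ (HE t Ht)). }
  { intros t Ht. apply (Ent _ _ _ (HE t Ht)). }
  destruct R2 as [N2 M2].
  { intros t Ht. destruct (EST t Ht) as [(?&?&?&?) _]. auto 10. }
  { intros t Ht. apply (Ent _ _ _ (HE t Ht)). }
  { intros t Ht. apply (Ent _ _ _ (HE t Ht)). }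
  assert (Sqh : C1 * h * (C1 * h) = C1 * C1 * (h * h)) by ring.
  rewrite Sqh in *.
  assert (Pq : 0 <= C1 * C1 * (h * h)) by (rewrite <- Sqh; nra).
  assert (Pc : 0 <= C0 * (h * h)) by (apply Rmult_le_pos; nra).
  split; [unfold msq_mat; lra|].
  intros n. cbv zeta. unfold entry_moments. cbn [c11 c12 c21 c22].
  destruct (M1 n) as [Ma Mb], (M2 n) as [Mc Md].
  destruct CP as (X1&X2&X3&X4), CM0 as (Y1&Y2&Y3&Y4), HT as (G1&G2&G3&G4).
  assert (ED : forall t, dress (m0 (cis t)) = cmconj (dress (k0 (cis t))))
    by (intros; unfold m0; now rewrite cmconj_dress).
  assert (KK : 14 * (C1 * C1 * (h * h)) + 2 * (C0 * (h * h))
    <= (24 * (C1 * C1) + 2 * C0) * (h * h)) by lra.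
  unfold lin, Q, entry_moments. cbn [c11 c12 c21 c22].
  repeat split; (eapply Rle_trans; [|exact KK]).
  - refine (moment_estimate n dX dT _ _ _ _ _ _ _ _ W1 X1 Y1 G1 _ _ Ma).
    + intros t _. now rewrite ED.
    + intros t Ht. apply (EST t Ht).
  - refine (moment_estimate n dX dT _ _ _ _ _ _ _ _ W2 X2 Y2 G2 _ _ Mb).
    + intros t _. now rewrite ED.
    + intros t Ht. apply (EST t Ht).
  - refine (moment_estimate n dX dT _ _ _ _ _ _ _ _ W3 X3 Y3 G3 _ _ Mc).
    + intros t _. now rewrite ED.
    + intros t Ht. apply (EST t Ht).
  - refine (moment_estimate n dX dT _ _ _ _ _ _ _ _ W4 X4 Y4 G4 _ _ Md).
    + intros t _. now rewrite ED.
    + intros t Ht. apply (EST t Ht).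
Qed.

End Perturbation.

(** * Variation of the dressed matrix *)

Definition commutator12 (u A : cmat) : C :=
  (c11 u * c12 A + c12 u * c22 A - c12 u * c11 A - c22 u * c12 A)%C.

Definition remainder12 (u A : cmat) : C :=
  ((c11 u * c12 A + c12 u * c22 A) * c11 u - (c11 u * c11 A + c12 u * c21 A) * c12 u
   - (c11 u * c22 u - c12 u * c21 u) * c12 A)%C.

(* [e A e^-1 = A + [u, A] + O(u^2)] for [e = 1 + u]; the trace of [u] is
   quadratically small since [det e = 1]. *)
Lemma conjugation12 (e A : cmat) : cdet e = RtoC 1 -> let u := csub1 e in
  c12 (cmul e (cmul A (cadj e))) = (c12 A + (commutator12 u A + remainder12 u A))%C.
Proof.
  intros H u.
  replace (c12 (cmul e (cmul A (cadj e)))) with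
    (c12 A + (commutator12 u A + remainder12 u A) + (cdet e - 1) * c12 A)%C.
  - rewrite H. ring.
  - unfold u, commutator12, remainder12, cmul, cadj, cdet, csub1.
    cbn [c11 c12 c21 c22]. ring.
Qed.

Lemma Cmod_plus_le (x y : C) (r s : R) :
  Cmod x <= r -> Cmod y <= s -> Cmod (x + y) <= r + s.
Proof. intros. pose proof (Cmod_triangle x y). lra. Qed.

Lemma Cmod_opp_le (x : C) (r : R) : Cmod x <= r -> Cmod (- x) <= r.
Proof. now rewrite Cmod_opp. Qed.

Lemma remainder12_bound (u A : cmat) (B : R) : 0 <= B -> bounded_by B A ->
  Cmod (remainder12 u A) <= 3 * B *
    (Cmod (c11 u) * Cmod (c11 u) + Cmod (c12 u) * Cmod (c12 u) +
     (Cmod (c21 u) * Cmod (c21 u) + Cmod (c22 u) * Cmod (c22 u))).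
Proof.
  intros HB (A1&A2&A3&A4). unfold remainder12.
  destruct u as [a b c d]; cbn [c11 c12 c21 c22].
  set (x := Cmod a). set (y := Cmod b). set (z := Cmod c). set (w := Cmod d).
  pose proof (Cmod_ge_0 a : 0 <= x). pose proof (Cmod_ge_0 b : 0 <= y).
  pose proof (Cmod_ge_0 c : 0 <= z). pose proof (Cmod_ge_0 d : 0 <= w).
  assert (K : forall p q X, Cmod X <= B -> Cmod (p * X * q) <= B * (Cmod p * Cmod q)).
  { intros p q X HX. rewrite !Cmod_mult.
    replace (Cmod p * Cmod X * Cmod q) with (Cmod X * (Cmod p * Cmod q)) by ring.
    apply Rmult_le_compat_r; auto. apply Rmult_le_pos; apply Cmod_ge_0. }
  replace ((a * c12 A + b * c22 A) * a - (a * c11 A + b * c21 A) * b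
    - (a * d - b * c) * c12 A)%C with
    (a * c12 A * a + (b * c22 A * a + (- (a * c11 A * b) + (- (b * c21 A * b)
     + (- (a * c12 A * d) + b * c12 A * c)))))%C by ring.
  eapply Rle_trans.
  { repeat first [apply Cmod_plus_le | apply Cmod_opp_le]; apply K; eauto. }
  fold x y z w.
  pose proof (Rle_0_sqr (x - y)) as Q1. pose proof (Rle_0_sqr (x - w)) as Q2.
  pose proof (Rle_0_sqr (y - z)) as Q3. unfold Rsqr in *.
  replace (B * (x * x) + (B * (y * x) + (B * (x * y) + (B * (y * y) + (B * (x * w)
    + B * (y * z)))))) with (B * (x * x + y * x + x * y + y * y + x * w + y * z)) by ring.
  replace (3 * B * (x * x + y * y + (z * z + w * w))) with
    (B * (3 * (x * x + y * y + (z * z + w * w)))) by ring.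
  apply Rmult_le_compat_l; auto. nra.
Qed.

Lemma commutator12_bound (u A : cmat) (B h : R) : 0 <= B -> 0 < h -> bounded_by B A ->
  Cmod (commutator12 u A) <= B / h * (2 * (h * h) +
    (Cmod (c11 u) * Cmod (c11 u) + Cmod (c12 u) * Cmod (c12 u) +
     (Cmod (c21 u) * Cmod (c21 u) + Cmod (c22 u) * Cmod (c22 u)))).
Proof.
  intros HB Hh (A1&A2&A3&A4). unfold commutator12.
  destruct u as [a b c d]; cbn [c11 c12 c21 c22].
  set (x := Cmod a). set (y := Cmod b). set (z := Cmod c). set (w := Cmod d).
  assert (K : forall p X, Cmod X <= B -> Cmod (p * X) <= B * Cmod p).
  { intros p X HX. rewrite Cmod_mult, Rmult_comm.
    apply Rmult_le_compat_r; auto. apply Cmod_ge_0. }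
  replace (a * c12 A + b * c22 A - b * c11 A - d * c12 A)%C with
    (a * c12 A + (b * c22 A + (- (b * c11 A) + - (d * c12 A))))%C by ring.
  eapply Rle_trans.
  { repeat first [apply Cmod_plus_le | apply Cmod_opp_le]; apply K; eauto. }
  fold x y z w.
  replace (B * x + (B * y + (B * y + B * w))) with (B / h * (h * (x + y + y + w)))
    by (field; lra).
  apply Rmult_le_compat_l; [apply Rdiv_le_0_compat; lra|].
  pose proof (Rle_0_sqr (x - h)) as Q1. pose proof (Rle_0_sqr (y - h)) as Q2.
  pose proof (Rle_0_sqr (w - h)) as Q3. pose proof (Rle_0_sqr z). unfold Rsqr in *. nra.
Qed.

Lemma Re_mean_sq_mat (k a : R) (u : C -> cmat) : entrywise circle_cont u ->
  let g := fun z => (RtoC a * (RtoC k + (sq (fun y => c11 (u y)) z + sq (fun y => c12 (u y)) z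
    + (sq (fun y => c21 (u y)) z + sq (fun y => c22 (u y)) z))))%C in
  circle_cont g /\ Re (mean g) = a * (k + msq_mat u) /\
  forall t, Re (g (cis t)) = a * (k + (
    Cmod (c11 (u (cis t))) * Cmod (c11 (u (cis t))) +
    Cmod (c12 (u (cis t))) * Cmod (c12 (u (cis t))) +
    (Cmod (c21 (u (cis t))) * Cmod (c21 (u (cis t))) +
     Cmod (c22 (u (cis t))) * Cmod (c22 (u (cis t)))))).
Proof.
  intros (U1&U2&U3&U4) g.
  assert (C1 : circle_cont (fun z => sq (fun y => c11 (u y)) z + sq (fun y => c12 (u y)) z)%C)
    by (apply circle_cont_plus; now apply sq_cont).
  assert (C2 : circle_cont (fun z => sq (fun y => c21 (u y)) z + sq (fun y => c22 (u y)) z)%C)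
    by (apply circle_cont_plus; now apply sq_cont).
  split; [|split].
  - apply circle_cont_mult; [apply circle_cont_const|].
    apply circle_cont_plus; [apply circle_cont_const|]. now apply circle_cont_plus.
  - unfold g. rewrite Re_mean_affine by auto.
    rewrite !mean_plus by now apply sq_cont. unfold msq_mat, msq. simpl. ring.
  - intros t. unfold g.
    rewrite <- (Re_sq (fun y => c11 (u y))), <- (Re_sq (fun y => c12 (u y))),
      <- (Re_sq (fun y => c21 (u y))), <- (Re_sq (fun y => c22 (u y))).
    generalize (sq (fun y => c11 (u y)) (cis t)) (sq (fun y => c12 (u y)) (cis t))
      (sq (fun y => c21 (u y)) (cis t)) (sq (fun y => c22 (u y)) (cis t)).
    intros. unfold Re. simpl. ring.
Qed.

Definition m12 (n : nat) (p : C -> cmat) : C := moment n (fun z => c12 (dress (p z))).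
Definition m21 (n : nat) (p : C -> cmat) : C := moment n (fun z => c21 (dress (p z))).
Definition m11 (n : nat) (p : C -> cmat) : C := moment n (fun z => c11 (dress (p z))).
Definition m22 (n : nat) (p : C -> cmat) : C := moment n (fun z => c22 (dress (p z))).

Lemma diagonal_moments (p : C -> cmat) : hardy_mat p cid ->
  (forall t, turn t -> cdet (p (cis t)) = RtoC 1) ->
  m11 1 p = RtoC 0 /\ m22 1 p = RtoC 0 /\
  (m11 2 p - m22 2 p)%C = (- (m12 1 p * m21 1 p))%C.
Proof.
  intros Hp Det. destruct Hp as (H1&H2&H3&H4).
  unfold cid, cdiag in H1, H2, H3, H4. cbn [c11 c12 c21 c22] in H1, H2, H3, H4.
  set (a := fun z => c11 (p z)) in *. set (b := fun z => c12 (p z)) in *.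
  set (c := fun z => c21 (p z)) in *. set (d := fun z => c22 (p z)) in *.
  assert (Hbc : hardy (fun z => b z * c z)%C (0 * 0)) by now apply hardy_mult.
  assert (Cbc : circle_cont (fun z => b z * c z)%C) by (eapply hardy_circle_cont, Hbc).
  assert (one : forall n, moment (S n) (fun _ => RtoC 1) = RtoC 0).
  { intros n. rewrite (moment_ext _ _ (fun z => Cconj (RtoC 1))).
    - apply moment_conj_hardy with (l := RtoC 1) (g := fun _ => RtoC 1). apply hardy_const.
    - intros. now rewrite Cconj_RtoC. }
  assert (E11 : forall n, m11 (S n) p = (2 * moment (S n) (fun z => b z * c z))%C).
  { intros n. unfold m11. rewrite (moment_ext _ _ (fun z => 1 + 2 * (b z * c z))%C).
    - rewrite moment_plus, moment_scal, one; auto using circle_cont_const, circle_cont_mult.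
      ring.
    - intros t Ht. rewrite <- (Det t Ht) at 1. unfold b, c, dress, cmul, cadj, cdet, csigma, cdiag.
      cbn [c11 c12 c21 c22]. ring. }
  assert (E22 : forall n, m22 (S n) p = (- (2) * moment (S n) (fun z => b z * c z))%C).
  { intros n. unfold m22. rewrite (moment_ext _ _ (fun z => - (1) * 1 + - (2) * (b z * c z))%C).
    - rewrite moment_plus, !moment_scal, one; auto using circle_cont_const, circle_cont_mult.
      ring.
    - intros t Ht. rewrite <- (Det t Ht) at 2. unfold b, c, dress, cmul, cadj, cdet, csigma, cdiag.
      cbn [c11 c12 c21 c22]. ring. }
  assert (Cb : circle_cont b) by (eapply hardy_circle_cont, H2).
  assert (Cc : circle_cont c) by (eapply hardy_circle_cont, H3).
  assert (E12 : m12 1 p = (- (2) * moment 1 b)%C).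
  { unfold m12. rewrite (moment_ext _ _ (fun z => - (2) * (b z * a z))%C).
    - rewrite moment_scal, (moment_1_mult b a 1); auto; [ring|].
      apply circle_cont_mult; auto. eapply hardy_circle_cont, H1.
    - intros t Ht. unfold a, b, dress, cmul, cadj, csigma, cdiag.
      cbn [c11 c12 c21 c22]. ring. }
  assert (E21 : m21 1 p = (2 * moment 1 c)%C).
  { unfold m21. rewrite (moment_ext _ _ (fun z => 2 * (c z * d z))%C).
    - rewrite moment_scal, (moment_1_mult c d 1); auto; [ring|].
      apply circle_cont_mult; auto. eapply hardy_circle_cont, H4.
    - intros t Ht. unfold c, d, dress, cmul, cadj, csigma, cdiag.
      cbn [c11 c12 c21 c22]. ring. }
  rewrite !E11, !E22, E12, E21, (moment_1_mult b c 0), (moment_2_mult b c 0) by auto.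
  repeat split; ring.
Qed.

Lemma commutator12_moments (u A : C -> cmat) :
  hardy_mat u (CM 0 0 0 0) -> hardy_mat A csigma ->
  let U n := entry_moments n u in let Q n := entry_moments n A in
  c11 (Q 1%nat) = RtoC 0 -> c22 (Q 1%nat) = RtoC 0 ->
  moment 1 (fun z => commutator12 (u z) (A z)) = (- (2) * c12 (U 1%nat))%C /\
  moment 2 (fun z => commutator12 (u z) (A z)) =
    (- (2) * c12 (U 2%nat) + (c11 (U 1%nat) - c22 (U 1%nat)) * c12 (Q 1%nat))%C.
Proof.
  intros Hu HA U Q Q1 Q2.
  pose proof (hardy_mat_cont _ _ Hu) as (u1&u2&u3&u4).
  pose proof (hardy_mat_cont _ _ HA) as (a1&a2&a3&a4).
  destruct Hu as (U1&U2&U3&U4), HA as (A1&A2&A3&A4).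
  unfold csigma, cdiag in A1, A2, A3, A4. cbn [c11 c12 c21 c22] in *.
  unfold U, Q, entry_moments in *. cbn [c11 c12 c21 c22] in *.
  unfold commutator12.
  assert (Ex : forall n, moment n (fun z => c11 (u z) * c12 (A z) + c12 (u z) * c22 (A z)
    - c12 (u z) * c11 (A z) - c22 (u z) * c12 (A z))%C =
    (moment n (fun z => c11 (u z) * c12 (A z)) + moment n (fun z => c12 (u z) * c22 (A z))
     - moment n (fun z => c12 (u z) * c11 (A z)) - moment n (fun z => c22 (u z) * c12 (A z)))%C).
  { intros n. rewrite !moment_minus, moment_plus; auto;
      repeat first [assumption|apply circle_cont_minus|apply circle_cont_plus|apply circle_cont_mult]. }
  rewrite !Ex.
  rewrite (moment_1_mult _ _ _ U1 A2), (moment_1_mult _ _ _ U2 A4),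
    (moment_1_mult _ _ _ U2 A1), (moment_1_mult _ _ _ U4 A2),
    (moment_2_mult _ _ _ U1 A2), (moment_2_mult _ _ _ U2 A4),
    (moment_2_mult _ _ _ U2 A1), (moment_2_mult _ _ _ U4 A2), Q1, Q2.
  split; ring.
Qed.

Lemma dress_quotient (P P0 : cmat) : cdet P0 = RtoC 1 ->
  cmul (cmul P (cadj P0)) (cmul (dress P0) (cadj (cmul P (cadj P0)))) = dress P.
Proof.
  intros H. transitivity (dress (cmul (cmul P (cadj P0)) P0)).
  - generalize (cmul P (cadj P0)). intros E. unfold dress. rewrite cadj_mul.
    now rewrite !cmul_assoc.
  - f_equal. now rewrite <- cmul_assoc, cmul_adj_l, cmul_1_r.
Qed.

Section Difference.

Variables (v0 p0 k0 : C -> cmat).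
Hypothesis det_v0 : forall t, turn t -> cdet (v0 (cis t)) = RtoC 1.
Hypothesis F0 : factorization v0 p0 k0.

Lemma det_perturbed (dX dT : R) (v : C -> cmat) : perturbed dX dT v0 v ->
  forall t, turn t -> cdet (v (cis t)) = RtoC 1.
Proof.
  intros Hv t Ht. rewrite (Hv t Ht), !cdet_mul, det_v0 by auto.
  unfold cdet, cdiag. cbn [c11 c12 c21 c22].
  generalize (phase_shift dX dT (cis t)). intros s.
  transitivity ((Cexp (- (Ci * s)) * Cexp (Ci * s)) * (Cexp (- (Ci * s)) * Cexp (Ci * s)))%C.
  - ring.
  - rewrite Cexp_opp. ring.
Qed.

Lemma dress_estimate : exists K h0, 0 <= K /\ 0 < h0 /\
  forall dX dT h v p k, 0 < h <= h0 -> Rabs dX + Rabs dT <= h ->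
    perturbed dX dT v0 v -> factorization v p k ->
    Cmod (m12 1 p - m12 1 p0 + 2 * lin dX dT (m12 2 p0) (m12 3 p0)) <= K * (h * h) /\
    (dT = 0 -> Cmod (m12 2 p - m12 2 p0 + RtoC dX * (2 * Ci * m12 3 p0
       + Ci * (m12 1 p0 * m21 1 p0) * m12 1 p0)) <= K * (h * h)) /\
    forall n, Cmod (m12 n p - m12 n p0) <= K * h.
Proof.
  destruct (quotient_estimate v0 p0 k0 det_v0 F0) as [K [h0 [PK [Ph H]]]].
  pose proof F0 as [Hp0 _].
  pose proof (fun t Ht => proj1 (factorization_det v0 det_v0 p0 k0 F0 t Ht)) as Det0.
  assert (HS : hardy_mat (fun z => dress (p0 z)) csigma) by now apply hardy_dress.
  assert (CS : entrywise circle_cont (fun z => dress (p0 z))) by (eapply hardy_mat_cont, HS).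
  destruct (entrywise_bounded _ CS) as [B [PB HB]].
  set (M := Cmod (m12 1 p0)).
  assert (PM : 0 <= M) by apply Cmod_ge_0.
  exists ((2 + 2 * M + 8 * B) * K + 4 * B), h0.
  assert (PK1 : 0 <= M * K) by (apply Rmult_le_pos; auto).
  assert (PK2 : 0 <= B * K) by (apply Rmult_le_pos; auto).
  split; [nra|]. split; [lra|].
  intros dX dT h v p k Hh Hd Hv Fp.
  destruct (H dX dT h v p k) as [N E]; auto; [lra|]. clear H.
  set (u := fun z => csub1 (quotient p0 p z)) in *.
  pose proof Fp as [Hp _].
  assert (Det : forall t, turn t -> cdet (p (cis t)) = RtoC 1).
  { intros t Ht.
    apply (factorization_det v (det_perturbed _ _ _ Hv) p k Fp t Ht). }
  assert (Hu : hardy_mat u (CM 0 0 0 0)).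
  { replace (CM 0 0 0 0) with (csub1 cid)
      by (apply cmat_ext; unfold csub1, cid, cdiag; cbn [c11 c12 c21 c22]; ring).
    apply hardy_csub1. eapply quotient_hardy; eauto. }
  assert (Cu : entrywise circle_cont u) by (eapply hardy_mat_cont, Hu).
  set (A := fun z => dress (p0 z)) in *.
  set (com := fun z => commutator12 (u z) (A z)).
  set (rem := fun z => remainder12 (u z) (A z)).
  assert (Ccom : circle_cont com).
  { unfold com, commutator12. destruct Cu as (?&?&?&?), CS as (?&?&?&?).
    repeat first [assumption|apply circle_cont_minus|apply circle_cont_plus|apply circle_cont_mult]. }
  assert (Crem : circle_cont rem).
  { unfold rem, remainder12. destruct Cu as (?&?&?&?), CS as (?&?&?&?).
    repeat first [assumption|apply circle_cont_minus|apply circle_cont_plus|apply circle_cont_mult]. }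
  assert (Dif : forall n, m12 n p = (m12 n p0 + (moment n com + moment n rem))%C).
  { intros n. unfold m12. rewrite <- !moment_plus; auto.
    - apply moment_ext. intros t Ht.
      assert (Dq : cdet (quotient p0 p (cis t)) = RtoC 1).
      { unfold quotient. rewrite cdet_mul, Det by auto.
        transitivity (1 * cdet (p0 (cis t)))%C.
        - f_equal. unfold cdet, cadj. cbn [c11 c12 c21 c22]. ring.
        - rewrite Det0 by auto. ring. }
      change (dress (p0 (cis t))) with (A (cis t)).
      unfold com, rem, u. rewrite <- (conjugation12 _ _ Dq). f_equal.
      symmetry. now apply dress_quotient, Det0.
    - apply CS.
    - now apply circle_cont_plus. }
  assert (Brem : forall n, Cmod (moment n rem) <= 6 * (B * K) * (h * h)).
  { intros n. destruct (Re_mean_sq_mat 0 (3 * B) u Cu) as (Cg & Mg & Gt).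
    eapply Rle_trans; [apply (Cmod_moment_le n rem _ Crem Cg)|].
    - intros t Ht. rewrite Gt, Rplus_0_l. apply remainder12_bound; [lra|exact (HB t Ht)].
    - eapply Rle_trans; [apply Rmult_le_compat_l; [lra|right; exact Mg]|].
      apply Rle_trans with (2 * (3 * B * (0 + K * (h * h)))).
      + apply Rmult_le_compat_l; [lra|]. apply Rmult_le_compat_l; lra.
      + right; ring. }
  assert (Bcom : forall n, Cmod (moment n com) <= 2 * B * (K + 2) * h).
  { intros n. destruct (Re_mean_sq_mat (2 * (h * h)) (B / h) u Cu) as (Cg & Mg & Gt).
    eapply Rle_trans; [apply (Cmod_moment_le n com _ Ccom Cg)|].
    - intros t Ht. rewrite Gt. apply commutator12_bound; [lra|lra|exact (HB t Ht)].
    - eapply Rle_trans; [apply Rmult_le_compat_l; [lra|right; exact Mg]|].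
      apply Rle_trans with (2 * (B / h * (2 * (h * h) + K * (h * h)))).
      + apply Rmult_le_compat_l; [lra|].
        apply Rmult_le_compat_l; [apply Rdiv_le_0_compat; lra|lra].
      + right. field. lra. }
  destruct (diagonal_moments p0 Hp0 Det0) as (D1 & D2 & D3).
  destruct (commutator12_moments u A Hu HS D1 D2) as [K1 K2].
  change (moment 1 com = (- (2) * c12 (entry_moments 1 u))%C) in K1.
  change (moment 2 com = (- (2) * c12 (entry_moments 2 u) +
    (c11 (entry_moments 1 u) - c22 (entry_moments 1 u)) * m12 1 p0)%C) in K2.
  pose proof (E 0%nat) as (E11 & E12 & _ & E22).
  pose proof (E 1%nat) as (_ & F12 & _ & _). clear E.
  fold u A in E11, E12, E22, F12.
  change (c11 (entry_moments 2 A)) with (m11 2 p0) in *.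
  change (c22 (entry_moments 2 A)) with (m22 2 p0) in *.
  change (c12 (entry_moments 1 A)) with (m12 1 p0) in *.
  change (c12 (entry_moments 2 A)) with (m12 2 p0) in *.
  change (c12 (entry_moments 3 A)) with (m12 3 p0) in *.
  set (U1 := entry_moments 1 u) in *. set (U2 := entry_moments 2 u) in *.
  assert (P2 : 0 <= h * h) by nra.
  assert (Q1 : 0 <= K * (h * h)) by (apply Rmult_le_pos; auto).
  assert (Q2 : 0 <= M * K * (h * h)) by (apply Rmult_le_pos; auto).
  assert (Q3 : 0 <= B * K * (h * h)) by (apply Rmult_le_pos; auto).
  assert (Q4 : 0 <= B * (h * h)) by (apply Rmult_le_pos; auto).
  assert (M2 : Cmod 2 = 2) by (rewrite Cmod_R; apply Rabs_right; lra).
  split; [|split].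
  - rewrite Dif, K1.
    replace (m12 1 p0 + (- (2) * c12 U1 + moment 1 rem) - m12 1 p0
      + 2 * lin dX dT (m12 2 p0) (m12 3 p0))%C with
      (- (2 * (c12 U1 - lin dX dT (m12 2 p0) (m12 3 p0))) + moment 1 rem)%C by ring.
    eapply Rle_trans; [apply Cmod_triangle|]. rewrite Cmod_opp, Cmod_mult, M2.
    pose proof (Brem 1%nat). lra.
  - intros ->. rewrite Dif, K2.
    assert (L0 : forall x y, lin dX 0 x y = (Ci * RtoC dX * x)%C)
      by (intros; unfold lin; ring).
    rewrite L0 in E11, E12, E22, F12.
    replace (m12 2 p0 + (- (2) * c12 U2 + (c11 U1 - c22 U1) * m12 1 p0 + moment 2 rem)
      - m12 2 p0 + RtoC dX * (2 * Ci * m12 3 p0 + Ci * (m12 1 p0 * m21 1 p0) * m12 1 p0))%C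
    with (- (2 * (c12 U2 - Ci * RtoC dX * m12 3 p0)) +
      (((c11 U1 - Ci * RtoC dX * m11 2 p0) - (c22 U1 - Ci * RtoC dX * m22 2 p0)) * m12 1 p0
       + moment 2 rem))%C.
    2:{ replace (m12 1 p0 * m21 1 p0)%C with (- (m11 2 p0 - m22 2 p0))%C
          by (rewrite D3; ring). ring. }
    eapply Rle_trans; [apply Cmod_triangle|].
    eapply Rle_trans; [apply Rplus_le_compat_l, Cmod_triangle|].
    rewrite Cmod_opp, !Cmod_mult, M2. fold M.
    assert (T : Cmod ((c11 U1 - Ci * RtoC dX * m11 2 p0)
      - (c22 U1 - Ci * RtoC dX * m22 2 p0)) <= 2 * (K * (h * h))).
    { eapply Rle_trans; [apply Cmod_triangle|]. rewrite Cmod_opp. lra. }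
    apply (Rmult_le_compat_r M) in T; auto.
    pose proof (Brem 2%nat). lra.
  - intros n. rewrite Dif.
    replace (m12 n p0 + (moment n com + moment n rem) - m12 n p0)%C
      with (moment n com + moment n rem)%C by ring.
    eapply Rle_trans; [apply Cmod_triangle|].
    pose proof (Brem n). pose proof (Bcom n).
    assert (h * h <= 1 / 4 * h) by (apply Rmult_le_compat_r; lra).
    assert (6 * (B * K) * (h * h) <= 6 * (B * K) * (1 / 4 * h))
      by (apply Rmult_le_compat_l; lra).
    assert (0 <= K * h) by (apply Rmult_le_pos; lra).
    assert (0 <= M * K * h) by (apply Rmult_le_pos; lra).
    assert (0 <= B * K * h) by (apply Rmult_le_pos; lra).
    lra.
Qed.

End Difference.

(** * From the Riemann-Hilbert problem to factorizations *)

Lemma locally_C_ball (z : C) (eps : R) : 0 < eps ->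
  @locally C_UniformSpace z (fun w => Cmod (w - z) < eps).
Proof.
  intros He. assert (P : 0 < eps / 2) by lra. exists (mkposreal _ P).
  intros w [H1 H2]. unfold ball in H1, H2; simpl in H1, H2.
  unfold AbsRing_ball, abs, minus, plus, opp in H1, H2; simpl in H1, H2.
  eapply Rle_lt_trans; [apply Cmod_le_sum|]. simpl. unfold Rminus in *. lra.
Qed.

Lemma locally_C_elim (z : C) (Q : C -> Prop) : @locally C_UniformSpace z Q ->
  exists d, 0 < d /\ forall w, Cmod (w - z) < d -> Q w.
Proof.
  intros [d Hd]. exists d. split; [apply cond_pos|]. intros w Hw. apply Hd.
  pose proof (re_le_Cmod (w - z)) as H1. pose proof (im_le_Cmod (w - z)) as H2.
  simpl in H1, H2. split; unfold ball; simpl;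
    unfold AbsRing_ball, abs, minus, plus, opp; simpl; unfold Re, Im in *; lra.
Qed.

Lemma filterlim_within_elim (f : C -> C) (D : C -> Prop) (z l : C) :
  filterlim f (within D (@locally C_UniformSpace z)) (@locally C_UniformSpace l) ->
  forall eps, 0 < eps -> exists d, 0 < d /\
    forall w, D w -> Cmod (w - z) < d -> Cmod (f w - l) < eps.
Proof.
  intros H eps He. specialize (H _ (locally_C_ball l eps He)).
  destruct (locally_C_elim _ _ H) as [d [Hd K]]. exists d. split; auto.
Qed.

Lemma filterlim_infinity_elim (f : C -> C) (l : C) :
  filterlim f C_infinity (@locally C_UniformSpace l) -> lim_infinity f l.
Proof.
  intros H eps He. exact (H _ (locally_C_ball l eps He)).
Qed.

Lemma ex_derive_cdiff (f : C -> C) (z : C) :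
  ex_derive (K := C_AbsRing) (V := C_NormedModule) f z -> cdiff f z.
Proof.
  intros [l [_ H]].
  specialize (H z (fun P HP => HP)).
  exists (fun w => if Ceq_dec w z then l else ((f w - f z) / (w - z))%C).
  assert (N0 : forall w, w <> z -> (w - z)%C <> RtoC 0).
  { intros w N E. apply N. replace w with (w - z + z)%C by ring. rewrite E. ring. }
  split.
  - intros eps He. assert (P : 0 < eps / 2) by lra.
    destruct (H (mkposreal _ P)) as [d Hd].
    exists d. split; [apply cond_pos|]. intros w _ Hw.
    destruct (Ceq_dec z z); [|easy]. destruct (Ceq_dec w z) as [_|N].
    + replace (l - l)%C with (RtoC 0) by ring. now rewrite Cmod_0.
    + specialize (Hd w Hw). simpl in Hd.
      assert (Hd' : Cmod (f w - f z - (w - z) * l) <= eps / 2 * Cmod (w - z)) by exact Hd.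
      pose proof (proj1 (Cmod_gt_0 _) (N0 w N)) as Pw.
      replace ((f w - f z) / (w - z) - l)%C
        with ((f w - f z - (w - z) * l) * / (w - z))%C by (field; auto).
      rewrite Cmod_mult, Cmod_inv by auto.
      apply Rle_lt_trans with (eps / 2 * Cmod (w - z) * / Cmod (w - z)).
      * apply Rmult_le_compat_r; auto. left. now apply Rinv_0_lt_compat.
      * rewrite Rmult_assoc, Rinv_r; lra.
  - intros w. destruct (Ceq_dec w z) as [->|N]; [ring|]. field. auto.
Qed.

Lemma C_infinity_proper : ProperFilter C_infinity.
Proof.
  constructor.
  - intros Q [r Hr]. exists (RtoC (Rabs r + 1)). apply Hr.
    rewrite Cmod_R, Rabs_right; pose proof (Rabs_pos r); pose proof (Rle_abs r); lra.
  - constructor.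
    + exists 0. auto.
    + intros Q Q' [r Hr] [s Hs]. exists (Rmax r s). intros z Hz.
      split; [apply Hr|apply Hs]; (eapply Rle_lt_trans; [|exact Hz]);
        [apply Rmax_l|apply Rmax_r].
    + intros Q Q' H [r Hr]. exists r. auto.
Qed.

Lemma limit_at_infinity_unique (f : C -> C) (l : C) :
  lim_infinity f l -> limit_at_infinity f = l.
Proof.
  intros H. unfold limit_at_infinity. pose proof C_infinity_proper as PF.
  set (L := @lim C_R_CompleteNormedModule (filtermap f C_infinity) : C).
  assert (Hc : forall eps : posreal,
    filtermap f C_infinity (@ball C_R_CompleteNormedModule L eps)).
  { apply (@complete_cauchy C_R_CompleteNormedModule).
    - now apply filtermap_proper_filter.
    - intros eps. exists l. destruct (H eps (cond_pos eps)) as [r Hr].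
      exists r. intros z Hz. specialize (Hr z Hz).
      pose proof (re_le_Cmod (f z - l)) as H1. pose proof (im_le_Cmod (f z - l)) as H2.
      simpl in H1, H2. split; unfold ball; simpl;
        unfold AbsRing_ball, abs, minus, plus, opp; simpl; unfold Re, Im in *; lra. }
  assert (Z : (l - L)%C = RtoC 0).
  { apply Cmod_eq_0. apply Rle_antisym; [|apply Cmod_ge_0].
    apply le_epsilon. intros eps He. rewrite Rplus_0_l.
    assert (P : 0 < eps / 3) by lra.
    assert (H1 : C_infinity (fun z => @ball C_R_CompleteNormedModule L (mkposreal _ P) (f z)))
      by exact (Hc (mkposreal _ P)).
    assert (H2 : C_infinity (fun z => Cmod (f z - l) < eps / 3)) by now apply H.
    destruct (filter_ex _ (filter_and _ _ H1 H2)) as [z [[A1 A2] A3]].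
    unfold ball in A1, A2; simpl in A1, A2.
    unfold AbsRing_ball, abs, minus, plus, opp in A1, A2; simpl in A1, A2.
    assert (A4 : Cmod (f z - L) <= eps / 3 + eps / 3).
    { eapply Rle_trans; [apply Cmod_le_sum|]. simpl. unfold Re, Im, Rminus in *. lra. }
    replace (l - L)%C with (- (f z - l) + (f z - L))%C by ring.
    eapply Rle_trans; [apply Cmod_triangle|]. rewrite Cmod_opp. lra. }
  replace L with (l - (l - L))%C by ring. rewrite Z. ring.
Qed.

Definition cmat_of (M : mat2) : cmat :=
  CM (entry M 0 0) (entry M 0 1) (entry M 1 0) (entry M 1 1).

Lemma cmat_of_mul (M N : mat2) : cmat_of (mul2 M N) = cmul (cmat_of M) (cmat_of N).
Proof.
  apply cmat_ext; unfold cmat_of, cmul, entry, mul2, Mmult; cbn [c11 c12 c21 c22];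
    rewrite coeff_mat_bij by lia; simpl pred; rewrite sum_Sn, sum_O; reflexivity.
Qed.

Lemma cmat_of_id2 : cmat_of id2 = cid.
Proof.
  apply cmat_ext; unfold cmat_of, id2, entry, Mone, cid, cdiag; cbn [c11 c12 c21 c22];
    rewrite coeff_mat_bij by lia; reflexivity.
Qed.

Definition glue (f g : C -> C) (z : C) : C := if Req_EM_T (Cmod z) 1 then g z else f z.

Lemma glue_off (f g : C -> C) (z : C) : Cmod z <> 1 -> glue f g z = f z.
Proof. unfold glue. now destruct (Req_EM_T (Cmod z) 1). Qed.

Lemma glue_on (f g : C -> C) (z : C) : Cmod z = 1 -> glue f g z = g z.
Proof. unfold glue. now destruct (Req_EM_T (Cmod z) 1). Qed.

Lemma glue_cdiff (f g : C -> C) (z : C) : Cmod z <> 1 -> cdiff f z -> cdiff (glue f g) z.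
Proof.
  intros Hz. assert (P : 0 < Rabs (Cmod z - 1)) by (apply Rabs_pos_lt; lra).
  apply cdiff_local with (d := Rabs (Cmod z - 1)); auto.
  intros w Hw. symmetry. apply glue_off. intros E. rewrite <- E in Hw.
  pose proof (Cmod_ge_minus z w). pose proof (Cmod_ge_minus w z).
  rewrite (Cmod_minus_sym z w) in H.
  assert (Rabs (Cmod z - Cmod w) <= Cmod (w - z)) by (apply Rabs_le; lra). lra.
Qed.

Lemma glue_cont (f g : C -> C) (D : C -> Prop) (z : C) : Cmod z = 1 ->
  filterlim f (within D (@locally C_UniformSpace z)) (@locally C_UniformSpace (g z)) ->
  filterlim g (within (fun w => Cmod w = 1) (@locally C_UniformSpace z))
    (@locally C_UniformSpace (g z)) ->
  cont_within (fun w => Cmod w = 1 \/ D w) (glue f g) z.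
Proof.
  intros Hz H1 H2 eps He.
  destruct (filterlim_within_elim _ _ _ _ H1 eps He) as [d1 [Hd1 K1]].
  destruct (filterlim_within_elim _ _ _ _ H2 eps He) as [d2 [Hd2 K2]].
  exists (Rmin d1 d2). split; [now apply Rmin_pos|]. intros w Dw Hw.
  rewrite (glue_on f g z Hz). unfold glue. destruct (Req_EM_T (Cmod w) 1).
  - apply K2; auto. eapply Rlt_le_trans; [apply Hw|apply Rmin_r].
  - destruct Dw as [|Dw]; [easy|].
    apply K1; auto. eapply Rlt_le_trans; [apply Hw|apply Rmin_l].
Qed.

Lemma rhp_factorization (G0 : mat2) (X T : R) (P : C -> mat2) :
  is_RHP_solution G0 X T P ->
  exists p k, factorization (fun z => cmat_of (jump G0 X T z)) p k /\
    forall z, 1 < Cmod z -> c12 (p z) = entry (P z) 0 1.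
Proof.
  intros [An [Pp [Pm [Bp [Bm J]]]] Lim].
  set (e := fun i j => glue (fun z => entry (P z) i j) (fun z => entry (Pp z) i j)).
  set (h := fun i j => glue (fun z => entry (P z) i j) (fun z => entry (Pm z) i j)).
  set (k := fun i j z => Cconj (h i j (/ Cconj z)%C)).
  exists (fun z => CM (e 0%nat 0%nat z) (e 0%nat 1%nat z) (e 1%nat 0%nat z) (e 1%nat 1%nat z)),
    (fun z => CM (k 0%nat 0%nat z) (k 0%nat 1%nat z) (k 1%nat 0%nat z) (k 1%nat 1%nat z)).
  assert (He : forall i j, (i < 2)%nat -> (j < 2)%nat -> hardy (e i j) (entry id2 i j)).
  { intros i j Hi Hj. repeat split.
    - intros z Hz. apply glue_cdiff; [lra|]. apply ex_derive_cdiff, An; auto. lra.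
    - intros z Hz. destruct (Bp z Hz) as [B1 B2].
      apply cont_within_mono with (D := fun w => Cmod w = 1 \/ 1 < Cmod w).
      + unfold outside. intros w [Hw|Hw]; auto.
      + apply glue_cont; auto.
    - apply lim_infinity_ext with (f := fun z => entry (P z) i j) (r := 1).
      + intros z Hz. unfold e. rewrite glue_off; auto. lra.
      + apply filterlim_infinity_elim, Lim; auto. }
  assert (Hk : forall i j, (i < 2)%nat -> (j < 2)%nat -> hardy (k i j) (Cconj (h i j 0))).
  { intros i j Hi Hj. apply hardy_reflect.
    - intros z Hz. apply glue_cdiff; [lra|]. apply ex_derive_cdiff, An; auto. lra.
    - intros z Hz. destruct (Bm z Hz) as [B1 B2].
      apply cont_within_mono with (D := fun w => Cmod w = 1 \/ Cmod w < 1).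
      + intros w [Hw|Hw]; auto.
      + apply glue_cont; auto. }
  split; [split; [|split]|].
  - rewrite <- cmat_of_id2. unfold hardy_mat, cmat_of. cbn [c11 c12 c21 c22].
    repeat split; apply He; lia.
  - exists (CM (Cconj (h 0%nat 0%nat 0)) (Cconj (h 0%nat 1%nat 0))
      (Cconj (h 1%nat 0%nat 0)) (Cconj (h 1%nat 1%nat 0))).
    unfold hardy_mat. cbn [c11 c12 c21 c22].
    split; [|split; [|split]]; apply Hk; lia.
  - intros t Ht. pose proof (Cmod_cis t) as C1.
    assert (Ek : forall i j, Cconj (k i j (cis t)) = entry (Pm (cis t)) i j).
    { intros i j. unfold k. rewrite Cconj_conj, <- Cinv_cis.
      replace (/ / cis t)%C with (cis t) by (field; apply cis_neq_0).
      unfold h. now rewrite glue_on. }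
    unfold cmconj. cbn [c11 c12 c21 c22]. rewrite !Ek.
    unfold e. rewrite !glue_on by auto.
    change (cmat_of (Pp (cis t)) = cmul (cmat_of (Pm (cis t))) (cmat_of (jump G0 X T (cis t)))).
    now rewrite J, cmat_of_mul.
  - intros z Hz. cbn [c12]. unfold e. rewrite glue_off; auto. lra.
Qed.

Lemma cmat_of_exp_sigma3 (f : C) : cmat_of (exp_sigma3 f) = cdiag (Cexp f) (Cexp (- f)).
Proof. reflexivity. Qed.

Lemma cmat_of_jump (G0 : mat2) (X T : R) (z : C) :
  let f := (Ci * phase X T z)%C in
  cmat_of (jump G0 X T z) =
  cmul (cdiag (Cexp (- f)) (Cexp f)) (cmul (cmat_of G0) (cdiag (Cexp f) (Cexp (- f)))).
Proof.
  intros f. unfold jump. fold f. rewrite !cmat_of_mul, !cmat_of_exp_sigma3.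
  now replace (- - f)%C with f by ring.
Qed.

Lemma jump_perturbed (G0 : mat2) (X0 T0 X T : R) :
  perturbed (X - X0) (T - T0) (fun z => cmat_of (jump G0 X0 T0 z))
    (fun z => cmat_of (jump G0 X T z)).
Proof.
  intros t _ s. rewrite !cmat_of_jump. cbv zeta.
  assert (E : (Ci * phase X T (cis t))%C = (Ci * s + Ci * phase X0 T0 (cis t))%C).
  { unfold s, phase_shift, phase. rewrite !RtoC_minus. ring. }
  rewrite E. set (f := (Ci * phase X0 T0 (cis t))%C). set (g := (Ci * s)%C).
  replace (- (g + f))%C with (- g + - f)%C by ring. rewrite !Cexp_plus.
  cmat_ring.
Qed.

Definition ctilde (A : cmat) : cmat :=
  CM (Cconj (c22 A)) (- Cconj (c21 A)) (- Cconj (c12 A)) (Cconj (c11 A)).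

Lemma ctilde_mul (A B : cmat) : ctilde (cmul A B) = cmul (ctilde A) (ctilde B).
Proof.
  apply cmat_ext; unfold ctilde, cmul; cbn [c11 c12 c21 c22];
    rewrite !Cplus_conj, !Cmult_conj; ring.
Qed.

Lemma ctilde_conj (A : cmat) : ctilde (cmconj A) = cmconj (ctilde A).
Proof.
  apply cmat_ext; unfold ctilde, cmconj; cbn [c11 c12 c21 c22]; auto using Cconj_opp.
Qed.

Lemma Cconj_Cexp (w : C) : Cconj (Cexp w) = Cexp (Cconj w).
Proof.
  destruct w as [x y]. unfold Cexp; simpl. rewrite cos_neg, sin_neg.
  apply injective_projections; simpl; ring.
Qed.

Lemma Cconj_cis (t : R) : Cconj (cis t) = cis (2 * PI - t).
Proof.
  unfold cis, Cexp; simpl. rewrite exp_0.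
  rewrite cos_minus, sin_minus, cos_2PI, sin_2PI.
  apply injective_projections; simpl; ring.
Qed.

Lemma hardy_tilde (p : C -> cmat) (L : cmat) : hardy_mat p L ->
  hardy_mat (fun z => ctilde (p (Cconj z))) (ctilde L).
Proof.
  intros (H1&H2&H3&H4). unfold hardy_mat, ctilde. cbn [c11 c12 c21 c22].
  split; [|split; [|split]].
  - now apply (hardy_conj_conj (fun z => c22 (p z))).
  - apply hardy_opp. now apply (hardy_conj_conj (fun z => c21 (p z))).
  - apply hardy_opp. now apply (hardy_conj_conj (fun z => c12 (p z))).
  - now apply (hardy_conj_conj (fun z => c11 (p z))).
Qed.

Lemma factorization_symmetry (v p k : C -> cmat) :
  (forall t, turn t -> cdet (v (cis t)) = RtoC 1) ->
  (forall t, turn t -> ctilde (v (Cconj (cis t))) = v (cis t)) ->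
  factorization v p k -> m21 1 p = Cconj (m12 1 p).
Proof.
  intros Det Sym F. pose proof F as [Hp [[L Hk] E]].
  assert (F' : factorization v (fun z => ctilde (p (Cconj z))) (fun z => ctilde (k (Cconj z)))).
  { split; [|split].
    - replace cid with (ctilde cid).
      + now apply hardy_tilde.
      + apply cmat_ext; unfold ctilde, cid, cdiag; cbn [c11 c12 c21 c22];
          apply injective_projections; simpl; ring.
    - exists (ctilde L). now apply hardy_tilde.
    - intros t Ht. rewrite <- ctilde_conj, <- (Sym t Ht), Cconj_cis, <- ctilde_mul.
      f_equal. apply E. unfold turn in *. lra. }
  pose proof (factorization_unique v Det _ _ _ _ F F') as U.
  assert (H12 : hardy (fun z => c12 (dress (p z))) 0).
  { destruct (hardy_dress p Hp) as (_&H&_&_). exact H. }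
  set (f := fun z => c12 (dress (p z))) in *.
  pose proof (hardy_conj_conj _ _ (hardy_shift f 0 H12)) as HF.
  assert (E12 : m12 1 p = mean (fun z => z * f z)%C)
    by (unfold m12, moment, f; apply mean_ext; intros; cbn [monom]; ring).
  rewrite E12, <- (hardy_mean _ _ HF).
  unfold m21, moment. apply mean_ext. intros t Ht. unfold f, monom.
  pose proof (U t Ht) as Ut.
  set (P := p (cis t)). set (P' := p (Cconj (cis t))).
  change (ctilde P' = P) in Ut. clearbody P P'.
  assert (D : c21 (dress P) = Cconj (c12 (dress P'))).
  { rewrite <- Ut. unfold dress, ctilde, cmul, csigma, cadj, cdiag. cbn [c11 c12 c21 c22].
    repeat rewrite ?Cplus_conj, ?Cmult_conj, ?Cconj_opp, ?Cconj_RtoC. ring. }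
  rewrite D, Cmult_conj, Cconj_minus, Cconj_conj, Cconj_RtoC. ring.
Qed.

Lemma entry_G (a b : C) : let r := RtoC (sqrt (Cmod a ^ 2 + Cmod b ^ 2)) in
  cmat_of (G a b) = CM (a / r) (Cconj b / r) (- b / r) (Cconj a / r).
Proof. reflexivity. Qed.

Lemma norm_pos (a b : C) : (a, b) <> (RtoC 0, RtoC 0) ->
  0 < sqrt (Cmod a ^ 2 + Cmod b ^ 2).
Proof.
  intros H. apply sqrt_lt_R0.
  destruct (Ceq_dec a 0) as [->|Na].
  - destruct (Ceq_dec b 0) as [->|Nb]; [easy|].
    pose proof (proj1 (Cmod_gt_0 b) Nb). pose proof (Cmod_ge_0 0). nra.
  - pose proof (proj1 (Cmod_gt_0 a) Na). pose proof (Cmod_ge_0 b). nra.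
Qed.

Lemma cdet_G (a b : C) : (a, b) <> (RtoC 0, RtoC 0) -> cdet (cmat_of (G a b)) = RtoC 1.
Proof.
  intros H. pose proof (norm_pos a b H) as Pr. rewrite entry_G. cbv zeta.
  set (r := sqrt (Cmod a ^ 2 + Cmod b ^ 2)) in *.
  assert (N : RtoC r <> RtoC 0) by (apply RtoC_neq_0; lra).
  assert (E : (RtoC r * RtoC r)%C = (a * Cconj a + b * Cconj b)%C).
  { rewrite <- RtoC_mult. unfold r. rewrite sqrt_sqrt.
    - rewrite RtoC_plus, !Cmod2_conj. reflexivity.
    - pose proof (Cmod_ge_0 a). pose proof (Cmod_ge_0 b). nra. }
  unfold cdet. cbn [c11 c12 c21 c22].
  transitivity ((a * Cconj a + b * Cconj b) / (RtoC r * RtoC r))%C.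
  - field. auto.
  - rewrite <- E. field. auto.
Qed.

Lemma cdet_jump (G0 : mat2) (X T : R) (z : C) : cdet (cmat_of G0) = RtoC 1 ->
  cdet (cmat_of (jump G0 X T z)) = RtoC 1.
Proof.
  intros H. rewrite cmat_of_jump. cbv zeta. rewrite !cdet_mul, H.
  generalize (Ci * phase X T z)%C. intros f.
  unfold cdet, cdiag. cbn [c11 c12 c21 c22].
  transitivity ((Cexp (- f) * Cexp f) * (Cexp (- f) * Cexp f))%C.
  - ring.
  - rewrite Cexp_opp. ring.
Qed.

Lemma ctilde_G (a b : C) : ctilde (cmat_of (G a b)) = cmat_of (G a b).
Proof.
  rewrite entry_G. cbv zeta. set (r := sqrt _).
  assert (Cr : forall x, Cconj (x / RtoC r) = (Cconj x / RtoC r)%C).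
  { intros x. unfold Cdiv. rewrite Cmult_conj. f_equal.
    destruct (Req_dec r 0) as [->|N].
    - apply injective_projections; simpl; unfold Rdiv; ring.
    - rewrite Cinv_conj, Cconj_RtoC; auto. now apply RtoC_neq_0. }
  apply cmat_ext; unfold ctilde; cbn [c11 c12 c21 c22]; rewrite !Cr, ?Cconj_conj,
    ?Cconj_opp; unfold Cdiv; ring.
Qed.

Lemma ctilde_jump (a b : C) (X T t : R) :
  ctilde (cmat_of (jump (G a b) X T (Cconj (cis t)))) = cmat_of (jump (G a b) X T (cis t)).
Proof.
  rewrite !cmat_of_jump. cbv zeta. rewrite !ctilde_mul, ctilde_G.
  assert (Ed : forall x y, ctilde (cdiag x y) = cdiag (Cconj y) (Cconj x)).
  { intros. apply cmat_ext; unfold ctilde, cdiag; cbn [c11 c12 c21 c22]; auto;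
      apply injective_projections; simpl; ring. }
  assert (Ep : Cconj (Ci * phase X T (Cconj (cis t))) = (- (Ci * phase X T (cis t)))%C).
  { unfold phase, Cdiv. rewrite <- Cinv_cis.
    replace (/ / cis t)%C with (cis t) by (field; apply cis_neq_0).
    rewrite !Cinv_cis, Cmult_conj, !Cplus_conj, !Cmult_conj, !Cconj_conj, !Cconj_RtoC.
    replace (Cconj Ci) with (- Ci)%C by (apply injective_projections; simpl; ring).
    ring. }
  rewrite !Ed, !Cconj_Cexp, Cconj_opp, Ep.
  now replace (- - (Ci * phase X T (cis t)))%C with (Ci * phase X T (cis t))%C by ring.
Qed.

Lemma Psi_of_moment (P : C -> mat2) (p : C -> cmat) : hardy_mat p cid ->
  (forall z, 1 < Cmod z -> c12 (p z) = entry (P z) 0 1) ->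
  Psi_of P = (- Ci * m12 1 p)%C.
Proof.
  intros (H1&H2&_&_) E. unfold Psi_of.
  pose proof (hardy_shift _ _ H2) as [_ [_ HL]]. change (c12 cid) with (RtoC 0) in *.
  change (c11 cid) with (RtoC 1) in *.
  rewrite (limit_at_infinity_unique _ (moment 1 (fun z => c12 (p z)))).
  - assert (M : m12 1 p = (- (2) * moment 1 (fun z => c12 (p z)))%C).
    { unfold m12. rewrite (moment_ext _ _ (fun z => - (2) * (c12 (p z) * c11 (p z)))%C).
      - rewrite moment_scal, (moment_1_mult (fun z => c12 (p z)) (fun z => c11 (p z)) 1);
          auto; [ring|].
        apply circle_cont_mult; eapply hardy_circle_cont; eauto.
      - intros t Ht. unfold dress, cmul, cadj, csigma, cdiag.
        cbn [c11 c12 c21 c22]. ring. }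
    rewrite M. ring.
  - apply lim_infinity_ext with (f := fun z => (z * (c12 (p z) - 0))%C) (r := 1).
    + intros z Hz. rewrite E by auto. ring.
    + replace (moment 1 (fun z => c12 (p z))) with (mean (fun z => z * c12 (p z))%C); auto.
      apply mean_ext. intros; simpl; ring.
Qed.

Lemma is_derive_quadratic (f : R -> C) (x : R) (l : C) (K h0 : R) : 0 <= K -> 0 < h0 ->
  (forall y h, 0 < h <= h0 -> Rabs (y - x) <= h ->
    Cmod (f y - f x - RtoC (y - x) * l) <= K * (h * h)) ->
  is_derive (V := C_R_NormedModule) f x l.
Proof.
  intros PK Ph H. split; [apply is_linear_scal_l|].
  intros x' Hx'.
  assert (Ex : x = x') by (apply is_filter_lim_locally_unique; exact Hx').
  subst x'. intros eps.
  assert (Pd : 0 < Rmin h0 (eps / (K + 1))).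
  { apply Rmin_pos; auto. apply Rdiv_lt_0_compat; [apply cond_pos|lra]. }
  exists (mkposreal _ Pd). intros y Hy.
  assert (Hy' : Rabs (y - x) < Rmin h0 (eps / (K + 1))) by exact Hy.
  pose proof (Rmin_l h0 (eps / (K + 1))). pose proof (Rmin_r h0 (eps / (K + 1))).
  assert (N : forall c : C, norm (V := C_R_NormedModule) c <= Cmod c).
  { intros c. right. unfold Cmod. unfold norm; simpl. unfold prod_norm, norm; simpl.
    unfold abs; simpl. f_equal. rewrite !Rmult_1_r, <- !Rabs_mult.
    f_equal; apply Rabs_right; apply Rle_ge, Rle_0_sqr. }
  eapply Rle_trans; [apply N|].
  match goal with |- Cmod ?e <= _ =>
    replace e with (f y - f x - RtoC (y - x) * l)%C end.
  2:{ apply injective_projections; unfold minus, plus, opp, scal; simpl;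
      unfold plus, opp, scal, mult; simpl; unfold mult; simpl; ring. }
  change (norm (minus y x)) with (Rabs (y - x)).
  destruct (Req_dec y x) as [->|Ny].
  - replace (f x - f x - RtoC (x - x) * l)%C with (RtoC 0).
    + rewrite Cmod_0. replace (x - x) with 0 by ring. rewrite Rabs_R0. lra.
    + replace (x - x) with 0 by ring. ring.
  - assert (Pa : 0 < Rabs (y - x)) by (apply Rabs_pos_lt; lra).
    eapply Rle_trans; [apply (H y (Rabs (y - x))); lra|].
    assert (K * Rabs (y - x) <= eps).
    { apply Rle_trans with ((K + 1) * (eps / (K + 1))).
      - apply Rmult_le_compat; lra.
      - right. field. lra. }
    nra.
Qed.

Lemma continuous_on_plane_intro (f : R -> R -> C) :
  (forall z : C, cont_at (fun w => f (fst w) (snd w)) z) -> continuous_on_plane f.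
Proof.
  intros H p Q HQ.
  destruct (locally_C_elim _ _ HQ) as [e [He K]].
  destruct (H p e He) as [d [Hd L]].
  destruct (locally_C_ball p d Hd) as [r Hr]. exists r. intros w Hw.
  apply K, L; auto.
Qed.

Theorem theorem1p10 (a b : C) (hab : (a, b) <> (RtoC 0, RtoC 0))
  (P : R -> R -> C -> mat2)
  (HP : forall X T : R, is_RHP_solution (G a b) X T (P X T)) :
  global_NLS_solution (fun X T : R => Psi_of (P X T)).
Proof.
  set (v := fun X T z => cmat_of (jump (G a b) X T z)).
  assert (Ex : forall X T, exists pk : (C -> cmat) * (C -> cmat),
    factorization (v X T) (fst pk) (snd pk) /\
    forall z, 1 < Cmod z -> c12 (fst pk z) = entry (P X T z) 0 1).
  { intros X T. destruct (rhp_factorization _ _ _ _ (HP X T)) as [p [k H]].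
    now exists (p, k). }
  set (pk := fun X T => constructive_indefinite_description _ (Ex X T)).
  set (p := fun X T => fst (proj1_sig (pk X T))).
  set (k := fun X T => snd (proj1_sig (pk X T))).
  assert (F : forall X T, factorization (v X T) (p X T) (k X T))
    by (intros X T; apply (proj2_sig (pk X T))).
  assert (Ep : forall X T z, 1 < Cmod z -> c12 (p X T z) = entry (P X T z) 0 1)
    by (intros X T; apply (proj2_sig (pk X T))).
  clearbody p k. clear pk Ex.
  assert (Det : forall X T t, turn t -> cdet (v X T (cis t)) = RtoC 1)
    by (intros; apply cdet_jump, cdet_G; auto).
  set (Q := fun n X T => m12 n (p X T)).
  assert (Psi : forall X T, Psi_of (P X T) = (- Ci * Q 1%nat X T)%C)
    by (intros X T; apply Psi_of_moment; [apply F|apply Ep]).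
  assert (Sym : forall X T, m21 1 (p X T) = Cconj (Q 1%nat X T)).
  { intros X T. apply (factorization_symmetry (v X T) _ (k X T)); auto.
    intros; apply ctilde_jump. }
  assert (Est : forall X0 T0, exists K h0, 0 <= K /\ 0 < h0 /\
    forall X T h, 0 < h <= h0 -> Rabs (X - X0) + Rabs (T - T0) <= h ->
    Cmod (Q 1%nat X T - Q 1%nat X0 T0 +
      2 * lin (X - X0) (T - T0) (Q 2%nat X0 T0) (Q 3%nat X0 T0)) <= K * (h * h) /\
    (T - T0 = 0 -> Cmod (Q 2%nat X T - Q 2%nat X0 T0 + RtoC (X - X0) * (2 * Ci * Q 3%nat X0 T0
       + Ci * (Q 1%nat X0 T0 * Cconj (Q 1%nat X0 T0)) * Q 1%nat X0 T0)) <= K * (h * h)) /\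
    forall n, Cmod (Q n X T - Q n X0 T0) <= K * h).
  { intros X0 T0.
    destruct (dress_estimate (v X0 T0) (p X0 T0) (k X0 T0) (Det X0 T0) (F X0 T0))
      as [K [h0 [PK [Ph H]]]].
    exists K, h0. split; auto. split; auto. intros X T h Hh Hd.
    rewrite <- Sym. apply (H (X - X0) (T - T0) h (v X T) (p X T) (k X T)); auto.
    apply jump_perturbed. }
  assert (Cont : forall n z, cont_at (fun w => Q n (fst w) (snd w)) z).
  { intros n [X0 T0] eps He. destruct (Est X0 T0) as [K [h0 [PK [Ph H]]]].
    set (h := Rmin h0 (eps / (K + 1))).
    assert (Pe : 0 < eps / (K + 1)) by (apply Rdiv_lt_0_compat; lra).
    assert (P0 : 0 < h) by now apply Rmin_pos.
    exists (h / 2). split; [lra|]. intros [X T] _ Hw. simpl.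
    pose proof (re_le_Cmod ((X, T) - (X0, T0))) as R1.
    pose proof (im_le_Cmod ((X, T) - (X0, T0))) as R2. simpl in R1, R2.
    destruct (H X T h) as [_ [_ H3]].
    { split; auto. apply Rmin_l. }
    { unfold Rminus. lra. }
    eapply Rle_lt_trans; [apply H3|].
    apply Rle_lt_trans with (K * (eps / (K + 1))).
    - apply Rmult_le_compat_l; auto. apply Rmin_r.
    - apply Rlt_le_trans with ((K + 1) * (eps / (K + 1))); [nra|].
      right. field. lra. }
  assert (Mi : forall z, Cmod (- Ci * z) = Cmod z).
  { intros z. rewrite Cmod_mult, Cmod_opp, Cmod_Ci. ring. }
  assert (M2 : forall z, Cmod (- (2) * z) = 2 * Cmod z).
  { intros z. rewrite Cmod_mult, Cmod_opp, Cmod_R, Rabs_right; lra. }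
  assert (CiCi : (Ci * Ci)%C = (- (1))%C)
    by (apply injective_projections; simpl; ring).
  exists (fun X T => - (2) * Q 2%nat X T)%C,
    (fun X T => 4 * Ci * Q 3%nat X T +
      2 * Ci * (Q 1%nat X T * Cconj (Q 1%nat X T) * Q 1%nat X T))%C,
    (fun X T => - (2) * Q 3%nat X T)%C.
  split; [|split; [|split; [|split; [|split]]]].
  - intros X T. destruct (Est X T) as [K [h0 [PK [Ph H]]]].
    split; [|split].
    + apply (is_derive_ext (fun x => (- Ci * Q 1%nat x T)%C)).
      { intros; now rewrite Psi. }
      apply (is_derive_quadratic _ _ _ K h0); auto. intros y h Hh Hy.
      destruct (H y T h Hh) as [H1 _].
      { replace (T - T) with 0 by ring. rewrite Rabs_R0. lra. }
      replace (- Ci * Q 1%nat y T - - Ci * Q 1%nat X T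
        - RtoC (y - X) * (- (2) * Q 2%nat X T))%C with
        (- Ci * (Q 1%nat y T - Q 1%nat X T +
          2 * lin (y - X) (T - T) (Q 2%nat X T) (Q 3%nat X T)))%C.
      * now rewrite Mi.
      * unfold lin. replace (T - T) with 0 by ring. ring [CiCi].
    + apply (is_derive_quadratic _ _ _ (2 * K) h0); [lra|auto|]. intros y h Hh Hy.
      destruct (H y T h Hh) as [_ [H2 _]].
      { replace (T - T) with 0 by ring. rewrite Rabs_R0. lra. }
      replace (T - T) with 0 in H2 by ring. specialize (H2 eq_refl).
      match type of H2 with Cmod ?x <= _ => set (d := x) in H2 end.
      match goal with |- Cmod ?x <= _ => replace x with (- (2) * d)%C by (unfold d; ring) end.
      rewrite M2. lra.
    + apply (is_derive_ext (fun t => (- Ci * Q 1%nat X t)%C)).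
      { intros; now rewrite Psi. }
      apply (is_derive_quadratic _ _ _ K h0); auto. intros y h Hh Hy.
      destruct (H X y h Hh) as [H1 _].
      { replace (X - X) with 0 by ring. rewrite Rabs_R0. lra. }
      replace (- Ci * Q 1%nat X y - - Ci * Q 1%nat X T
        - RtoC (y - T) * (- (2) * Q 3%nat X T))%C with
        (- Ci * (Q 1%nat X y - Q 1%nat X T +
          2 * lin (X - X) (y - T) (Q 2%nat X T) (Q 3%nat X T)))%C.
      * now rewrite Mi.
      * unfold lin. replace (X - X) with 0 by ring. ring [CiCi].
  - apply continuous_on_plane_intro. intros z.
    apply cont_within_ext with (f := fun w => (- Ci * Q 1%nat (fst w) (snd w))%C); auto.
    apply cont_within_mult; [apply cont_within_const|apply Cont].
  - apply continuous_on_plane_intro. intros z.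
    apply cont_within_mult; [apply cont_within_const|apply Cont].
  - apply continuous_on_plane_intro. intros z.
    apply cont_within_plus; (apply cont_within_mult; [apply cont_within_const|]).
    + apply Cont.
    + apply cont_within_mult; [|apply Cont].
      apply cont_within_mult; [apply Cont|]. apply cont_within_conj, Cont.
  - apply continuous_on_plane_intro. intros z.
    apply cont_within_mult; [apply cont_within_const|apply Cont].
  - intros X T. rewrite Psi, Mi, Cmod2_conj.
    replace (RtoC (1 / 2)) with (/ 2)%C.
    + field.
    + rewrite RtoC_div by lra. unfold Cdiv. ring.
Qed.
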